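(* Assume (in the setting and notation of the context) that the unitary $U$ and the unit vector $\Omega$ satisfy Assumptions (i)–(v), and that the self-adjoint operators $T_\pm\in\mathcal A_{S_\pm}$ appearing in Assumption (ii) are chosen such that $$e^{2\pi \mathrm{i}(Q+T_-)}=1+\mathcal O(L^{-\infty}),\qquad \|T_\pm\|\le C|\Lambda|$$ for some $C$ independent of $L$. Then $$\langle\Omega,T_-\Omega\rangle\in\mathbb Z_{(\mathcal O(L^{-\infty}))},$$ i.e. $\mathrm{dist}(\langle\Omega,T_-\Omega\rangle,\mathbb Z)=\mathcal O(L^{-\infty})$.
   Context: Setup. Fix $d,n\ge 1$; $L$ ranges over even positive integers. $\Lambda=\Lambda_L=\mathbb Z_L^d$ with $\mathbb Z_L=\mathbb Z/L\mathbb Z$ identified with $\{-L/2+1,\dots,L/2\}$; $\mathrm{dist}$ is the graph distance on $\Lambda$ and, for $X\subset\Lambda$ and $r\in\mathbb N$, $X^r=\{x\in\Lambda:\mathrm{dist}(x,X)\le r\}$. The quantum system is either (spins) $\mathcal H=\bigotimes_{x\in\Lambda}\mathbb C^n$, $\mathcal A=\mathcal L(\mathcal H)$, with $\mathcal A_X$ the operators of the form $O_X\otimes 1_{\Lambda\setminus X}$; or (fermions) $\mathcal H$ the antisymmetric Fock space over $\ell^2(\Lambda,\mathbb C^n)$ with CAR operators $c_{x,\sigma}$, and $\mathcal A_X$ the algebra of even elements (those commuting with the fermion parity) of the algebra generated by $c_{x,\sigma},c^*_{x,\sigma}$, $x\in X$; $\mathcal A=\mathcal A_\Lambda$. An operator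 in $\mathcal A_X$ is said to be supported in $X$. Sets: $\Gamma=\{x:0\le x_1<L/2\}$, $\partial_-=\{x:x_1=0\}$, $\partial_+=\{x:x_1=L/2-1\}$, $S_-=\{-L/8\le x_1\le L/8\}$, $S_m=\{L/8<x_1<L/2-L/8\}$, $S_+=\{-L/8\le x_1-L/2\le L/8\}$ (with $x_1$ taken mod $L$). For $X,X'\subset\Lambda$, $d_1(X,X')=\min\{|x_1-x_1'|:x\in X,x'\in X'\}$. Asymptotic conventions: all operators and states are sequences indexed by $L$; constants $C,c$ are independent of $L$. A quantity is $\mathcal O(L^{-\infty})$ if for every $k$ it is bounded by $C_kL^{-k}$ for all $L$ (for operators: in operator norm). $\mathbb Z_{(\epsilon)}=\{z\in\mathbb R:\mathrm{dist}(z,\mathbb Z)\le\epsilon\}$. For a unit vector $\psi$, $\mathrm{Var}_\psi(A)=\|(A-\langle\psi,A\psi\rangle)\psi\|^2$. A unit vector $\psi$ is clustering in the $x_1$-direction if there are $0<c,C<\infty$ (independent of $L$) with $|\langle\psi,AB\psi\rangle-\langle\psi,A\psi\rangle\langle\psi,B\psi\rangle|\le C\|A\|\|B\||X||X'|e^{-c\,d_1(X,X')}$ for all $X,X'$, $A\in\mathcal A_X$, $B\in\mathcal A_{X'}$. Charges: self-adjoint $Q_x\in\mathcal A_{\{x\}}$ with $\mathrm{Spec}(Q_x)\subset\mathbb Z$; $Q_X=\sum_{x\in X}Q_x$; $Q=Q_\Gamma$. Assumptions on a unitary $U\in\mathcal A$ and unit vector $\Omega\in\mathcal H$: (i) (almost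 locality) for every $k$ there is $C_k$ such that for all $X$, all $A\in\mathcal A_X$ and all $n\in\mathbb N$ there is $R_n\in\mathcal A_{X^n}$ with $\|U^*AU-R_n\|\le C_k\|A\||X|n^{-k}$; (ii) there are self-adjoint $T_\pm\in\mathcal A_{S_\pm}$ with $\|(U^*QU-Q)-T_--T_+\|=\mathcal O(L^{-\infty})$; (iii) $\mathrm{Var}_\Omega(U)=\mathcal O(L^{-\infty})$; (iv) (local charge fluctuations) there are self-adjoint $K_\pm\in\mathcal A_{\partial_\pm^{L/16}}$ with $\|K_\pm\|\le C|\Lambda|$ and $\mathrm{Var}_\Omega(Q-K_--K_+)=\mathcal O(L^{-\infty})$; (v) $\Omega$ is clustering in the $x_1$-direction. *)

(* Defs.v *)
From mathcomp Require Import all_boot.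
From Stdlib Require Import Reals ZArith ClassicalEpsilon.
Delimit Scope R_scope with R.
Set Implicit Arguments. Unset Strict Implicit. Unset Printing Implicit Defensive.

Record Cplx := mkC { Re : R; Im : R }.
Definition C0 : Cplx := mkC 0%R 0%R.
Definition C1 : Cplx := mkC 1%R 0%R.
Definition RC (r : R) : Cplx := mkC r 0%R.
Definition Cadd (a b : Cplx) : Cplx := mkC (Re a + Re b)%R (Im a + Im b)%R.
Definition Copp (a : Cplx) : Cplx := mkC (- Re a)%R (- Im a)%R.
Definition Csub (a b : Cplx) : Cplx := Cadd a (Copp b).
Definition Cmul (a b : Cplx) : Cplx :=
  mkC (Re a * Re b - Im a * Im b)%R (Re a * Im b + Im a * Re b)%R.
Definition Cconj (a : Cplx) : Cplx := mkC (Re a) (- Im a)%R.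
Definition Cnorm (a : Cplx) : R := sqrt (Re a * Re a + Im a * Im a)%R.

Section Linalg.
Variable B : finType.
Definition vec := B -> Cplx.
Definition op := B -> B -> Cplx.

Definition csum (F : B -> Cplx) : Cplx := \big[Cadd/C0]_(j : B) F j.

Definition opid : op := fun i j => if i == j then C1 else C0.
Definition opzero : op := fun _ _ => C0.
Definition opadd (A A' : op) : op := fun i j => Cadd (A i j) (A' i j).
Definition opsub (A A' : op) : op := fun i j => Csub (A i j) (A' i j).
Definition opscale (c : Cplx) (A : op) : op := fun i j => Cmul c (A i j).
Definition opmul (A A' : op) : op := fun i j => csum (fun k => Cmul (A i k) (A' k j)).
Definition adj (A : op) : op := fun i j => Cconj (A j i).
Definition apply (A : op) (v : vec) : vec := fun i => csum (fun j => Cmul (A i j) (v j)).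

Definition inner (u v : vec) : Cplx := csum (fun i => Cmul (Cconj (u i)) (v i)).
Definition vnorm (v : vec) : R := sqrt (Re (inner v v)).
Definition unit_vec (v : vec) : Prop := vnorm v = 1%R.

(* supremum of a set of reals (the least upper bound, which exists for the
   bounded nonempty sets used below) *)
Definition Rsup (E : R -> Prop) : R := epsilon (inhabits 0%R) (fun s => is_lub E s).

Definition opnorm (A : op) : R :=
  Rsup (fun r => exists v : vec, (vnorm v <= 1)%R /\ r = vnorm (apply A v)).

Definition selfadj (A : op) : Prop := forall i j, A i j = Cconj (A j i).
Definition unitary (U : op) : Prop :=
  forall i j, opmul (adj U) U i j = opid i j /\ opmul U (adj U) i j = opid i j.

Definition spec_in_Z (A : op) : Prop :=
  forall (lam : Cplx) (v : vec), (exists i, v i <> C0) ->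
    (forall i, apply A v i = Cmul lam (v i)) -> exists z : Z, lam = RC (IZR z).

Definition expect (psi : vec) (A : op) : Cplx := inner psi (apply A psi).
Definition Var (psi : vec) (A : op) : R :=
  (vnorm (apply (opsub A (opscale (expect psi A) opid)) psi) ^ 2)%R.

Fixpoint oppow (A : op) (k : nat) : op :=
  match k with O => opid | S k' => opmul A (oppow A k') end.
Fixpoint expsum (A : op) (N : nat) : op :=
  match N with
  | O => opid
  | S N' => opadd (expsum A N') (opscale (RC (/ INR (fact N))) (oppow A N))
  end.
Definition mexp (A : op) : op :=
  epsilon (inhabits opzero) (fun E => forall i j,
    Un_cv (fun N => Re (expsum A N i j)) (Re (E i j)) /\
    Un_cv (fun N => Im (expsum A N i j)) (Im (E i j))).
End Linalg.

(* Z_L is represented by 'I_L; the representative in {-L/2+1,...,L/2}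
   of a : 'I_L is a if a <= L/2 and a - L otherwise. *)
Definition site (d L : nat) : finType := {ffun 'I_d -> 'I_L}.

Definition pdist (L a b : nat) : nat :=
  let t := if a <= b then b - a else a - b in minn t (L - t).

Definition dist d L (x y : site d L) : nat := \sum_(i < d) pdist L (x i) (y i).

Definition x1 d L (x : site d L) : nat :=
  match [pick i : 'I_d | val i == 0] with Some i => val (x i) | None => 0 end.

Definition fatten d L (X : {set site d L}) (r : nat) : {set site d L} :=
  [set y | [exists x in X, dist x y <= r]].

Definition Gam d L : {set site d L} := [set x | 2 * x1 x < L].
Definition bdm d L : {set site d L} := [set x | x1 x == 0].
Definition bdp d L : {set site d L} := [set x | x1 x == L./2 - 1].
Definition Sm d L : {set site d L} := [set x | 8 * pdist L (x1 x) 0 <= L].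
Definition Sp d L : {set site d L} := [set x | 8 * pdist L (x1 x) L./2 <= L].

Definition dist1 d L (X X' : {set site d L}) : nat :=
  \big[minn/L]_(x in X) \big[minn/L]_(y in X') pdist L (x1 x) (x1 y).

Inductive system := Spin | Fermion.

(* orthonormal basis of H: spin configurations, resp. occupation sets of
   the one-particle modes (x, sigma) in Lambda x {1..n} (Fock basis) *)
Definition basis (sys : system) (d n L : nat) : finType :=
  match sys with
  | Spin => {ffun site d L -> 'I_n}
  | Fermion => {set (site d L * 'I_n)}
  end.

(* Spins: A in A_X iff A = O_X (x) 1_{Lambda \ X}, i.e. the matrix element
   <s|A|t> vanishes unless s,t agree off X and then only depends on s|_X, t|_X. *)
Definition spin_loc d n L (X : {set site d L}) (A : op {ffun site d L -> 'I_n}) : Prop :=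
  (forall s t : {ffun site d L -> 'I_n}, (exists y, y \notin X /\ s y <> t y) -> A s t = C0) /\
  (forall s t s' t' : {ffun site d L -> 'I_n},
     (forall y, y \notin X -> s y = t y /\ s' y = t' y) ->
     (forall y, y \in X -> s y = s' y /\ t y = t' y) -> A s t = A s' t').

(* Fermions: CAR annihilation operators on the Fock space (Jordan-Wigner
   sign w.r.t. the enumeration order of the modes) *)
Definition fock d n L := {set (site d L * 'I_n)}.
Definition cop d n L (m : site d L * 'I_n) : op (fock d n L) :=
  fun S' S => if (m \in S) && (S' == S :\ m) then
     RC ((-1) ^ #|[set j in S | ltn (enum_rank j) (enum_rank m)]|)%R else C0.
Definition parity d n L : op (fock d n L) :=
  fun S' S => if S' == S then RC ((-1) ^ #|S|)%R else C0.

Inductive fgen d n L (X : {set site d L}) : op (fock d n L) -> Prop :=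
  | fg_id : fgen X (opid (B := fock d n L))
  | fg_c : forall x s, x \in X -> fgen X (cop (x, s))
  | fg_cs : forall x s, x \in X -> fgen X (adj (cop (x, s)))
  | fg_add : forall A A', fgen X A -> fgen X A' -> fgen X (opadd A A')
  | fg_mul : forall A A', fgen X A -> fgen X A' -> fgen X (opmul A A')
  | fg_scale : forall c A, fgen X A -> fgen X (opscale c A).

Definition ferm_loc d n L (X : {set site d L}) (A : op (fock d n L)) : Prop :=
  (exists A', fgen X A' /\ forall i j, A i j = A' i j) /\
  (forall i j, opmul A (@parity d n L) i j = opmul (@parity d n L) A i j).

Definition loc (sys : system) d n L (X : {set site d L}) : op (basis sys d n L) -> Prop :=
  match sys as s return op (basis s d n L) -> Prop with
  | Spin => fun A => spin_loc X A
  | Fermion => fun A => ferm_loc X A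
  end.

Definition evenpos (L : nat) : Prop := 0 < L /\ ~~ odd L.

Definition negl (f : nat -> R) : Prop :=
  forall k : nat, exists Ck : R, forall L, evenpos L -> (f L <= Ck * / INR L ^ k)%R.

Definition Qset (B : finType) d L (Qc : site d L -> op B) (X : {set site d L}) : op B :=
  \big[@opadd B/@opzero B]_(x in X) Qc x.

(* Main.v *)
(** Write [Q] for the charge of the half torus, [Qb = Q - K_- - K_+] and
    [z(s) = <Omega, exp(is(Q + T_- - U^* K_- U)) exp(-is(Q - K_-)) Omega>].

    The product of [exp(is(Q + T_- - U^* K_- U)) exp(-is(Q - K_-))] with its analogue at the
    other boundary is close to [U^* exp(is Qb) U exp(-is Qb)], and [Omega] is almost an
    eigenvector of [U] and of [Qb]; so its expectation is close to [1], and by clustering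
    [|z(s)|] is close to [1], i.e. [Omega] is almost an eigenvector of each factor.
    Therefore [z' = i tau z] up to a small error, where [tau] is the expectation of
    [T_- - U^* K_- U + K_-], hence close to [<T_->], and [z(2 pi)] is close to
    [exp(2 pi i <T_->)].

    On the other hand [exp(2 pi i (Q + T_-)) = 1] and the integrality of the charges make
    [exp(2 pi i (Q + T_- - U^* K_- U))] close to [U^* W U] with [W = exp(2 pi i (Q - K_-))],
    and [Omega] is almost an eigenvector of [W] by clustering again, so that
    [z(2 pi)] is also close to [1].

    The charges [Q_x] carry no uniform bound, so [Q] only enters through the unitaries
    [exp(isQ)], and the differential equations are integrated by telescoping over small steps
    ([increments_bound]), whose quadratic remainders may depend on [Q]. *)

From HB Require Import structures.
From mathcomp Require Import all_boot all_algebra boolp Rstruct complex zify.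
From Stdlib Require Import Reals ZArith Lra Lia ClassicalEpsilon.
Require Import Defs.
Delimit Scope R_scope with R.
Delimit Scope ring_scope with ring.
Delimit Scope nat_scope with N.
Set Implicit Arguments. Unset Strict Implicit. Unset Printing Implicit Defensive.
Import GRing.Theory.
Local Open Scope R_scope.

(** * Operators as a ring *)

(** The integrality enters through a third unitary group. Let [q1] be the part of [Q] in [S_-] and
    [G = adj U (Q - q1) U - T_+]. Assumption (ii) reads [Q + T_- = adj U q1 U + G] up to a small
    error; subtracting [adj U K_- U] gives [Q + T_- - adj U K_- U = adj U (q1 - K_-) U + G]. In both
    sums the two terms almost commute, because only the commutator of [T_+] with an operator almost
    supported near [S_-] is left, so the exponentials factorise. Since [exp(2 pi i q1) = 1], the
    first identity makes [exp(2 pi i G)] close to [1], and the second then relates the exponential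
    at [2 pi] to [adj U W U].

    As [adj U K_- U] is not supported in a strip, a self-adjoint operator that is takes its place.

    Two losses shape the estimates: [|z|] close to [1] makes [Omega] an approximate eigenvector only
    up to a square root, and the norms of [T] and [K] may grow like the volume. Both are polynomial,
    so an estimate of the form [(1 + a) (e + sqrt e)] at fixed size suffices, with [a] the norms and
    [e] the errors. *)

Lemma CplxP (a b : Cplx) : Re a = Re b -> Im a = Im b -> a = b.
Proof. by case: a b => [x y] [x' y'] /= -> ->. Qed.

HB.instance Definition _ := gen_eqMixin Cplx.
HB.instance Definition _ := gen_choiceMixin Cplx.

Fact CaddA : associative Cadd.
Proof. by move=> a b c; apply: CplxP => /=; ring. Qed.
Fact CaddC : commutative Cadd.
Proof. by move=> a b; apply: CplxP => /=; ring. Qed.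
Fact Cadd0 : left_id C0 Cadd.
Proof. by move=> a; apply: CplxP => /=; ring. Qed.
Fact CaddN : left_inverse C0 Copp Cadd.
Proof. by move=> a; apply: CplxP => /=; ring. Qed.
Fact CmulA : associative Cmul.
Proof. by move=> a b c; apply: CplxP => /=; ring. Qed.
Fact CmulC : commutative Cmul.
Proof. by move=> a b; apply: CplxP => /=; ring. Qed.
Fact Cmul1 : left_id C1 Cmul.
Proof. by move=> a; apply: CplxP => /=; ring. Qed.
Fact CmulDl : left_distributive Cmul Cadd.
Proof. by move=> a b c; apply: CplxP => /=; ring. Qed.
Fact Cone_neq0 : C1 != C0.
Proof. by apply/eqP => -[]; lra. Qed.

HB.instance Definition _ := GRing.isZmodule.Build Cplx CaddA CaddC Cadd0 CaddN.
HB.instance Definition _ :=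
  GRing.Zmodule_isComNzRing.Build Cplx CmulA CmulC Cmul1 CmulDl Cone_neq0.

Lemma CaddE (a b : Cplx) : Cadd a b = (a + b)%ring. Proof. by []. Qed.
Lemma CmulE (a b : Cplx) : Cmul a b = (a * b)%ring. Proof. by []. Qed.

Section OpRing.
Variable B : finType.

Definition opopp (A : op B) : op B := fun i j => Copp (A i j).

HB.instance Definition _ := gen_eqMixin (op B).
HB.instance Definition _ := gen_choiceMixin (op B).

Lemma opP (A A' : op B) : (forall i j, A i j = A' i j) -> A = A'.
Proof. by move=> h; apply/funext => i; apply/funext => j. Qed.

Fact opaddA : associative (@opadd B).
Proof. by move=> a b c; apply: opP => i j; apply: CaddA. Qed.
Fact opaddC : commutative (@opadd B).
Proof. by move=> a b; apply: opP => i j; apply: CaddC. Qed.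
Fact opadd0 : left_id (@opzero B) (@opadd B).
Proof. by move=> a; apply: opP => i j; apply: Cadd0. Qed.
Fact opaddN : left_inverse (@opzero B) opopp (@opadd B).
Proof. by move=> a; apply: opP => i j; apply: CaddN. Qed.
HB.instance Definition _ := GRing.isZmodule.Build (op B) opaddA opaddC opadd0 opaddN.

Lemma opmulEij (A A' : op B) i j : opmul A A' i j = (\sum_k A i k * A' k j)%ring.
Proof. by []. Qed.

Fact opmulA : associative (@opmul B).
Proof.
move=> a b c; apply: opP => i j; rewrite !opmulEij.
under eq_bigr do rewrite opmulEij mulr_sumr.
rewrite exchange_big /=; apply: eq_bigr => k _.
by rewrite opmulEij mulr_suml; apply: eq_bigr => l _; rewrite mulrA.
Qed.
Fact opmul1 : left_id (@opid B) (@opmul B).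
Proof.
move=> a; apply: opP => i j; rewrite opmulEij (bigD1 i) //= big1 ?addr0.
  by rewrite /opid eqxx; exact: mul1r.
by move=> k /negbTE ki; rewrite /opid eq_sym ki; exact: mul0r.
Qed.
Fact opmulr1 : right_id (@opid B) (@opmul B).
Proof.
move=> a; apply: opP => i j; rewrite opmulEij (bigD1 j) //= big1 ?addr0.
  by rewrite /opid eqxx; exact: mulr1.
by move=> k /negbTE ki; rewrite /opid ki; exact: mulr0.
Qed.
Fact opmulDl : left_distributive (@opmul B) (@opadd B).
Proof.
move=> a b c; apply: opP => i j; rewrite /opadd CaddE !opmulEij -big_split /=.
by apply: eq_bigr => k _; rewrite -mulrDl.
Qed.
Fact opmulDr : right_distributive (@opmul B) (@opadd B).
Proof.
move=> a b c; apply: opP => i j; rewrite /opadd CaddE !opmulEij -big_split /=.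
by apply: eq_bigr => k _; rewrite -mulrDr.
Qed.
(** [B] may be empty, in which case [1 = 0]; hence the ring structure that allows this. *)
HB.instance Definition _ :=
  GRing.Zmodule_isPzRing.Build (op B) opmulA opmul1 opmulr1 opmulDl opmulDr.

Fact opscaleA (a b : Cplx) (A : op B) :
  opscale a (opscale b A) = opscale (a * b)%ring A.
Proof. by apply: opP => i j; exact: CmulA. Qed.
Fact opscale1 : left_id 1%ring (@opscale B).
Proof. by move=> A; apply: opP => i j; exact: Cmul1. Qed.
Fact opscaleDr : right_distributive (@opscale B) +%R.
Proof. by move=> c a b; apply: opP => i j; exact: (mulrDr (c : Cplx)). Qed.
Fact opscaleDl (A : op B) : {morph (@opscale B)^~ A : a b / (a + b)%ring}.
Proof. by move=> a b; apply: opP => i j; exact: CmulDl. Qed.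
HB.instance Definition _ :=
  GRing.Zmodule_isLmodule.Build Cplx (op B) opscaleA opscale1 opscaleDr opscaleDl.

Lemma opscaleAl (c : Cplx) (A A' : op B) : (c *: A * A' = c *: (A * A'))%ring.
Proof.
apply: opP => i j.
have -> : (c *: (A * A'))%ring i j = (c * \sum_k A i k * A' k j)%ring by [].
by rewrite mulr_sumr; apply: eq_bigr => k _; rewrite mulrA.
Qed.
Lemma opscaleAr (c : Cplx) (A A' : op B) : (A * (c *: A') = c *: (A * A'))%ring.
Proof.
apply: opP => i j.
have -> : (c *: (A * A'))%ring i j = (c * \sum_k A i k * A' k j)%ring by [].
by rewrite mulr_sumr; apply: eq_bigr => k _; rewrite mulrCA.
Qed.

End OpRing.

(** * Norms and states *)

Lemma Cnorm_ge0 (a : Cplx) : 0 <= Cnorm a.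
Proof. exact: sqrt_pos. Qed.
Lemma Cnorm_sqr (a : Cplx) : Cnorm a * Cnorm a = Re a * Re a + Im a * Im a.
Proof. by apply: sqrt_sqrt; nra. Qed.
Lemma CnormE (a : Cplx) x : 0 <= x -> x * x = Re a * Re a + Im a * Im a -> Cnorm a = x.
Proof. by move=> x0 h; rewrite /Cnorm -h sqrt_square. Qed.
Lemma Cnorm_le (a : Cplx) x : 0 <= x -> Re a * Re a + Im a * Im a <= x * x -> Cnorm a <= x.
Proof. by move=> x0 h; have := Cnorm_sqr a; have := Cnorm_ge0 a; nra. Qed.
Lemma CnormM (a b : Cplx) : Cnorm (a * b)%ring = Cnorm a * Cnorm b.
Proof.
apply: CnormE; first by apply: Rmult_le_pos; exact: Cnorm_ge0.
have := Cnorm_sqr a; have := Cnorm_sqr b => hb ha.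
transitivity ((Cnorm a * Cnorm a) * (Cnorm b * Cnorm b)); first ring.
by rewrite ha hb /=; ring.
Qed.
Lemma CnormN (a : Cplx) : Cnorm (- a)%ring = Cnorm a.
Proof. by rewrite /Cnorm /=; congr sqrt; ring. Qed.
Lemma Cnorm_conj (a : Cplx) : Cnorm (Cconj a) = Cnorm a.
Proof. by rewrite /Cnorm /=; congr sqrt; ring. Qed.
Lemma Cnorm_RC x : Cnorm (RC x) = Rabs x.
Proof. by apply: CnormE; [exact: Rabs_pos | rewrite /= -Rabs_mult Rabs_pos_eq; nra]. Qed.
Lemma Cnorm0 : Cnorm 0%ring = 0.
Proof. by apply: CnormE => /=; lra. Qed.
Lemma Cnorm1 : Cnorm 1%ring = 1.
Proof. by apply: CnormE => /=; lra. Qed.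
Lemma CnormD (a b : Cplx) : Cnorm (a + b)%ring <= Cnorm a + Cnorm b.
Proof.
have ha := Cnorm_ge0 a; have hb := Cnorm_ge0 b.
apply: Cnorm_le; first lra.
have := sqrt_cauchy (Re a) (Im a) (Re b) (Im b); rewrite /Rsqr -!/(Cnorm _).
have := Cnorm_sqr a; have := Cnorm_sqr b => /= h1 h2 h3; nra.
Qed.
Lemma CnormB (a b : Cplx) : Cnorm (a - b)%ring <= Cnorm a + Cnorm b.
Proof. by apply: Rle_trans (CnormD _ _) _; rewrite CnormN; lra. Qed.
Lemma CnormD_le (a b : Cplx) x y : Cnorm a <= x -> Cnorm b <= y -> Cnorm (a + b)%ring <= x + y.
Proof. by move=> h h'; apply: Rle_trans (CnormD _ _) _; lra. Qed.
Lemma CnormB_le (a b : Cplx) x y : Cnorm a <= x -> Cnorm b <= y -> Cnorm (a - b)%ring <= x + y.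
Proof. by move=> h h'; apply: Rle_trans (CnormB _ _) _; lra. Qed.
Lemma Cnorm_sub (a b : Cplx) : Cnorm (a - b)%ring = Cnorm (b - a)%ring.
Proof. by rewrite -CnormN opprB. Qed.
Lemma Cnorm_sub_tri (a b c : Cplx) :
  Cnorm (a - c)%ring <= Cnorm (a - b)%ring + Cnorm (b - c)%ring.
Proof. by have := CnormD (a - b)%ring (b - c)%ring; rewrite addrA subrK. Qed.
Lemma Re_le_Cnorm (a : Cplx) : Rabs (Re a) <= Cnorm a.
Proof. by rewrite -(sqrt_Rsqr_abs (Re a)); apply: sqrt_le_1_alt; have := Rle_0_sqr (Im a); rewrite /Rsqr; lra. Qed.
Lemma Im_le_Cnorm (a : Cplx) : Rabs (Im a) <= Cnorm a.
Proof. by rewrite -(sqrt_Rsqr_abs (Im a)); apply: sqrt_le_1_alt; have := Rle_0_sqr (Re a); rewrite /Rsqr; lra. Qed.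
Lemma Cnorm_le_ReIm (a : Cplx) : Cnorm a <= Rabs (Re a) + Rabs (Im a).
Proof.
have h1 := Rabs_pos (Re a); have h2 := Rabs_pos (Im a).
apply: Cnorm_le; first lra.
by have := Rsqr_abs (Re a); have := Rsqr_abs (Im a); rewrite /Rsqr; nra.
Qed.

Lemma CconjD (a b : Cplx) : Cconj (a + b)%ring = (Cconj a + Cconj b)%ring.
Proof. by apply: CplxP => /=; ring. Qed.
Lemma CconjM (a b : Cplx) : Cconj (a * b)%ring = (Cconj a * Cconj b)%ring.
Proof. by apply: CplxP => /=; ring. Qed.
Lemma CconjK (a : Cplx) : Cconj (Cconj a) = a.
Proof. by apply: CplxP => /=; ring. Qed.
Lemma Cconj_sum I r (P : pred I) (F : I -> Cplx) :
  Cconj (\sum_(i <- r | P i) F i)%ring = (\sum_(i <- r | P i) Cconj (F i))%ring.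
Proof. by apply: big_morph; [exact: CconjD | apply: CplxP => /=; ring]. Qed.

Lemma Re_sum I r (P : pred I) (F : I -> Cplx) :
  Re (\sum_(i <- r | P i) F i)%ring = \big[Rplus/0]_(i <- r | P i) Re (F i).
Proof. by apply: big_morph. Qed.

Lemma Rsum_le I r (P : pred I) (F G : I -> R) :
  (forall i, P i -> F i <= G i) ->
  \big[Rplus/0]_(i <- r | P i) F i <= \big[Rplus/0]_(i <- r | P i) G i.
Proof. by move=> h; apply: (big_ind2 Rle) => //; [lra | move=> *; lra]. Qed.
Lemma Rsum_ge0 I r (P : pred I) (F : I -> R) :
  (forall i, P i -> 0 <= F i) -> 0 <= \big[Rplus/0]_(i <- r | P i) F i.
Proof. by move=> h; apply: (big_ind (Rle 0)) => //; [lra | move=> *; lra]. Qed.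
Lemma Rsum_ge_term (I : finType) (F : I -> R) i :
  (forall j, 0 <= F j) -> F i <= \big[Rplus/0]_j F j.
Proof.
move=> h; rewrite (bigD1 i) //=.
by have := @Rsum_ge0 I (index_enum I) (fun j => j != i) F (fun j _ => h j); lra.
Qed.
Lemma Cnorm_sum I r (P : pred I) (F : I -> Cplx) :
  Cnorm (\sum_(i <- r | P i) F i)%ring <= \big[Rplus/0]_(i <- r | P i) Cnorm (F i).
Proof.
apply: (big_ind2 (fun a x => Cnorm a <= x)) => [|a x b y h1 h2|i _].
- rewrite Cnorm0; lra.
- by apply: Rle_trans (CnormD _ _) _; lra.
- lra.
Qed.

Section Vectors.
Variable B : finType.
Implicit Types (A : op B) (u v w psi : vec B).

Lemma adjD A A' : adj (A + A')%ring = (adj A + adj A')%ring.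
Proof. by apply: opP => i j; exact: CconjD. Qed.
Lemma adjN A : adj (- A)%ring = (- adj A)%ring.
Proof. by apply: opP => i j; apply: CplxP => /=; ring. Qed.
Lemma adjB A A' : adj (A - A')%ring = (adj A - adj A')%ring.
Proof. by rewrite adjD adjN. Qed.
Lemma adjZ c A : adj (c *: A)%ring = (Cconj c *: adj A)%ring.
Proof. by apply: opP => i j; exact: CconjM. Qed.
Lemma adjM A A' : adj (A * A')%ring = (adj A' * adj A)%ring.
Proof.
apply: opP => i j; rewrite /adj [LHS]Cconj_sum.
by apply: eq_bigr => k _; rewrite CmulE CconjM mulrC.
Qed.
Lemma adjK A : adj (adj A) = A.
Proof. by apply: opP => i j; exact: CconjK. Qed.
Lemma adj1 : adj 1%ring = 1%ring :> op B.
Proof.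
apply: opP => i j; rewrite /adj.
change (Cconj (opid j i) = opid i j); rewrite /opid eq_sym; by case: eqP => _; apply: CplxP => /=; lra.
Qed.
Lemma adj0 : adj 0%ring = 0%ring :> op B.
Proof. by apply: opP => i j; apply: CplxP => /=; ring. Qed.
Lemma selfadjP A : selfadj A <-> adj A = A.
Proof.
split=> [h|h i j]; last by rewrite -{1}h.
by apply: opP => i j; rewrite [RHS]h.
Qed.

Lemma applyEi A v i : apply A v i = (\sum_j A i j * v j)%ring.
Proof. by []. Qed.
Lemma innerE u v : inner u v = (\sum_i Cconj (u i) * v i)%ring.
Proof. by []. Qed.

Lemma applyM A A' v : apply (A * A')%ring v = apply A (apply A' v).
Proof.
apply/funext => i; rewrite !applyEi.
under [RHS]eq_bigr do rewrite applyEi mulr_sumr.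
rewrite exchange_big /=; apply: eq_bigr => j _.
rewrite -[(A * A')%ring]/(opmul A A') opmulEij mulr_suml.
by apply: eq_bigr => k _; rewrite mulrA.
Qed.
Lemma apply1 v : apply 1%ring v = v.
Proof.
apply/funext => i; rewrite applyEi (bigD1 i) //= big1 ?addr0.
  by rewrite -[1%ring]/(opid (B:=B)) /opid eqxx mul1r.
by move=> k /negbTE ki; rewrite -[1%ring]/(opid (B:=B)) /opid eq_sym ki mul0r.
Qed.

Lemma inner_adj A u v : inner (apply A u) v = inner u (apply (adj A) v).
Proof.
rewrite !innerE.
under eq_bigr do rewrite applyEi Cconj_sum mulr_suml.
rewrite exchange_big /=; apply: eq_bigr => j _.
rewrite applyEi mulr_sumr; apply: eq_bigr => i _.
by rewrite CconjM -mulrA mulrCA mulrA /adj.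
Qed.

Lemma inner_conj u v : Cconj (inner u v) = inner v u.
Proof.
rewrite !innerE Cconj_sum; apply: eq_bigr => i _.
by rewrite CconjM CconjK mulrC.
Qed.

Lemma expectD psi A A' : expect psi (A + A')%ring = (expect psi A + expect psi A')%ring.
Proof.
rewrite /expect !innerE -big_split /=; apply: eq_bigr => i _.
rewrite -mulrDr; congr (_ * _)%ring; rewrite !applyEi -big_split /=.
by apply: eq_bigr => j _; rewrite -mulrDl.
Qed.
Lemma expectZ psi c A : expect psi (c *: A)%ring = (c * expect psi A)%ring.
Proof.
rewrite /expect !innerE mulr_sumr; apply: eq_bigr => i _.
rewrite mulrCA; congr (_ * _)%ring; rewrite !applyEi mulr_sumr.
by apply: eq_bigr => j _; rewrite mulrA.
Qed.
Lemma expectN psi A : expect psi (- A)%ring = (- expect psi A)%ring.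
Proof. by rewrite -scaleN1r expectZ mulN1r. Qed.
Lemma expectB psi A A' : expect psi (A - A')%ring = (expect psi A - expect psi A')%ring.
Proof. by rewrite expectD expectN. Qed.
Lemma expect_adj psi A : expect psi (adj A) = Cconj (expect psi A).
Proof. by rewrite /expect inner_conj inner_adj. Qed.
Lemma expect_selfadj psi A : selfadj A -> expect psi A = RC (Re (expect psi A)).
Proof.
move=> /selfadjP h; have := expect_adj psi A; rewrite h => /(congr1 Im) /= hi.
by apply: CplxP => //=; lra.
Qed.

Lemma Re_inner u : Re (inner u u) = \big[Rplus/0]_i (Cnorm (u i) * Cnorm (u i)).
Proof.
rewrite innerE Re_sum; apply: eq_bigr => i _; rewrite Cnorm_sqr /=; ring.
Qed.
Lemma inner_ge0 u : 0 <= Re (inner u u).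
Proof. by rewrite Re_inner; apply: Rsum_ge0 => i _; have := Cnorm_ge0 (u i); nra. Qed.
Lemma vnorm_ge0 u : 0 <= vnorm u.
Proof. exact: sqrt_pos. Qed.
Lemma vnorm_sqr u : vnorm u * vnorm u = Re (inner u u).
Proof. by apply: sqrt_sqrt; exact: inner_ge0. Qed.

Lemma vnorm_ge_entry u i : Cnorm (u i) <= vnorm u.
Proof.
rewrite -(sqrt_square (Cnorm (u i))); last exact: Cnorm_ge0.
apply: sqrt_le_1_alt; rewrite Re_inner.
by apply: (@Rsum_ge_term _ (fun i => Cnorm (u i) * Cnorm (u i))) => j; have := Cnorm_ge0 (u j); nra.
Qed.
Lemma vnorm_le_sum u : vnorm u <= \big[Rplus/0]_i Cnorm (u i).
Proof.
have s0 : 0 <= \big[Rplus/0]_i Cnorm (u i) by apply: Rsum_ge0 => i _; exact: Cnorm_ge0.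
rewrite -(sqrt_square _ s0); apply: sqrt_le_1_alt; rewrite Re_inner big_distrl /=.
apply: Rsum_le => i _; apply: Rmult_le_compat_l; first exact: Cnorm_ge0.
by apply: (@Rsum_ge_term _ (fun i => Cnorm (u i))) => j; exact: Cnorm_ge0.
Qed.

(** A crude bound, only meant to show that the supremum in [opnorm] is finite and that small entries
    give a small norm. *)
Definition entry_sum A := \big[Rplus/0]_i \big[Rplus/0]_j Cnorm (A i j).

Lemma vnorm_apply_crude A v : vnorm (apply A v) <= entry_sum A * vnorm v.
Proof.
apply: Rle_trans (vnorm_le_sum _) _.
rewrite /entry_sum big_distrl /=; apply: Rsum_le => i _.
rewrite applyEi big_distrl /=; apply: Rle_trans (Cnorm_sum _ _ _) _.
apply: Rsum_le => j _; rewrite CnormM; apply: Rmult_le_compat_l; first exact: Cnorm_ge0.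
exact: vnorm_ge_entry.
Qed.

(** [Rsup] is chosen by [epsilon], so everything about [opnorm] rests on the existence of the
    supremum: the set is bounded by [entry_sum] and contains the value at the zero vector. *)
Lemma opnorm_lub A :
  is_lub (fun r => exists v : vec B, vnorm v <= 1 /\ r = vnorm (apply A v)) (opnorm A).
Proof.
rewrite /opnorm /Rsup; apply: epsilon_spec.
have v0 : vnorm (fun _ : B => C0) = 0.
  by rewrite /vnorm Re_inner big1 ?sqrt_0 // => i _; rewrite Cnorm0; ring.
have [||s hs] := completeness
  (fun r => exists v : vec B, vnorm v <= 1 /\ r = vnorm (apply A v)).
- exists (entry_sum A) => r [v [hv ->]].
  apply: Rle_trans (vnorm_apply_crude _ _) _.
  suff : 0 <= entry_sum A by nra.
  by apply: Rsum_ge0 => i _; apply: Rsum_ge0 => j _; exact: Cnorm_ge0.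
- by exists (vnorm (apply A (fun _ => C0))), (fun _ => C0); split => //; lra.
- by exists s.
Qed.

Lemma opnorm_le A M : (forall v, vnorm v <= 1 -> vnorm (apply A v) <= M) -> opnorm A <= M.
Proof. by move=> h; case: (opnorm_lub A) => _; apply => r [v [hv ->]]; exact: h. Qed.

Lemma opnorm_ge0 A : 0 <= opnorm A.
Proof.
apply: Rle_trans (vnorm_ge0 (apply A (fun _ => C0))) _.
case: (opnorm_lub A) => h _; apply: h; exists (fun _ => C0); split => //.
by rewrite /vnorm Re_inner big1 ?sqrt_0 => [|i _]; [lra | rewrite Cnorm0; ring].
Qed.

Lemma applyZv c A v : apply A (fun i => Cmul c (v i)) = (fun i => Cmul c (apply A v i)).
Proof.
apply/funext => i; rewrite CmulE !applyEi mulr_sumr; apply: eq_bigr => j _.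
by rewrite CmulE mulrCA.
Qed.
Lemma vnormZ c v : vnorm (fun i => Cmul c (v i)) = Cnorm c * vnorm v.
Proof.
rewrite /vnorm !Re_inner -{1}(sqrt_square (Cnorm c)); last exact: Cnorm_ge0.
rewrite -sqrt_mult_alt; last by have := Cnorm_ge0 c; nra.
rewrite big_distrr /=; congr sqrt; apply: eq_bigr => i _.
by rewrite CmulE CnormM; ring.
Qed.

Lemma vnorm_apply A v : vnorm (apply A v) <= opnorm A * vnorm v.
Proof.
have [v0|v0] := Rle_lt_or_eq_dec _ _ (vnorm_ge0 v); last first.
  by have := vnorm_apply_crude A v; rewrite -v0; lra.
have -> : vnorm (apply A v) = vnorm v * vnorm (apply A (fun i => Cmul (RC (/ vnorm v)) (v i))).
  rewrite applyZv vnormZ Cnorm_RC Rabs_pos_eq; last by apply/Rlt_le/Rinv_0_lt_compat.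
  field; lra.
rewrite Rmult_comm; apply: Rmult_le_compat_r; first lra.
case: (opnorm_lub A) => h _; apply: h; eexists; split; last reflexivity.
rewrite vnormZ Cnorm_RC Rabs_pos_eq; last by apply/Rlt_le/Rinv_0_lt_compat.
by right; field; lra.
Qed.

Lemma opnorm_ge_entry A i j : Cnorm (A i j) <= opnorm A.
Proof.
pose e : vec B := fun k => if k == j then C1 else C0.
have he : vnorm e <= 1.
  rewrite /vnorm Re_inner (bigD1 j) //= big1 => [|k /negbTE kj].
    by rewrite /e eqxx Cnorm1 Rmult_1_r Rplus_0_r sqrt_1; lra.
  by rewrite /e kj Cnorm0; ring.
have -> : A i j = apply A e i.
  rewrite applyEi (bigD1 j) //= big1 ?addr0 => [|k /negbTE kj].
    by rewrite /e eqxx mulr1.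
  by rewrite /e kj mulr0.
apply: Rle_trans (vnorm_ge_entry _ _) _.
by apply: Rle_trans (vnorm_apply _ _) _; have := opnorm_ge0 A; nra.
Qed.
Lemma opnorm_le_entries A : opnorm A <= entry_sum A.
Proof.
apply: opnorm_le => v hv; apply: Rle_trans (vnorm_apply_crude _ _) _.
suff : 0 <= entry_sum A by nra.
by apply: Rsum_ge0 => i _; apply: Rsum_ge0 => j _; exact: Cnorm_ge0.
Qed.
Lemma opnorm_eq0 A : opnorm A <= 0 -> A = 0%ring.
Proof.
move=> h; apply: opP => i j.
have := opnorm_ge_entry A i j; have := Cnorm_ge0 (A i j); have := Cnorm_sqr (A i j) => h1 h2 h3.
have e0 : Cnorm (A i j) = 0 by lra.
by rewrite e0 in h1; apply: CplxP => /=; nra.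
Qed.

(** The GNS seminorm of the state [psi]. Vectors only occur as [A psi], so estimates on vectors
    reduce to identities in the ring of operators. *)
Definition nrm psi A : R := vnorm (apply A psi).

Lemma nrm_ge0 psi A : 0 <= nrm psi A.
Proof. exact: vnorm_ge0. Qed.
Lemma nrm_sqr psi A : nrm psi A * nrm psi A = Re (expect psi (adj A * A)%ring).
Proof. by rewrite /nrm vnorm_sqr inner_adj /expect applyM. Qed.
Lemma nrmE psi A x : 0 <= x -> x * x = Re (expect psi (adj A * A)%ring) -> nrm psi A = x.
Proof. by rewrite -nrm_sqr; have := nrm_ge0 psi A; nra. Qed.
Lemma nrm_mul psi A A' : nrm psi (A * A')%ring <= opnorm A * nrm psi A'.
Proof. by rewrite /nrm applyM; exact: vnorm_apply. Qed.

(** One expansion with three uses: a multiple of the conjugate overlap as [c] gives Cauchy-Schwarz,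
    [c = -1] the triangle inequality, and [A' = 1] the variance. *)
Lemma expect_form_expand psi A A' (c : Cplx) :
  nrm psi (A - c *: A')%ring * nrm psi (A - c *: A')%ring =
  nrm psi A * nrm psi A - 2 * Re (c * expect psi (adj A * A')%ring)%ring
  + (Cnorm c * Cnorm c) * (nrm psi A' * nrm psi A').
Proof.
have hX : expect psi (adj A' * A)%ring = Cconj (expect psi (adj A * A')%ring).
  by rewrite -expect_adj adjM adjK.
have E : (adj (A - c *: A') * (A - c *: A') = adj A * A - c *: (adj A * A')
    - (Cconj c *: (adj A' * A) - (Cconj c * c) *: (adj A' * A')))%ring.
  by rewrite adjB adjZ mulrBl !mulrBr !opscaleAl !opscaleAr scalerA.
rewrite !nrm_sqr E !expectB !expectZ hX Cnorm_sqr /=; ring.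
Qed.

Lemma expect_cauchy_schwarz psi A A' :
  Cnorm (expect psi (adj A * A')%ring) <= nrm psi A * nrm psi A'.
Proof.
set f := expect _ _; set a := nrm psi A; set b := nrm psi A'.
have a0 : 0 <= a by exact: nrm_ge0. have b0 : 0 <= b by exact: nrm_ge0.
have n0 := Cnorm_ge0 f.
(* The phase of [c] is chosen so that the cross term is real; [t] is then optimised as
   [/ (b * b)]. *)
have key t : 0 <= a * a - 2 * t * (Cnorm f * Cnorm f) + t * t * (Cnorm f * Cnorm f) * (b * b).
  have := expect_form_expand psi A A' (RC t * Cconj f)%ring; rewrite -/a -/b -/f.
  rewrite CnormM Cnorm_conj Cnorm_RC.
  have -> : Re (RC t * Cconj f * f)%ring = t * (Cnorm f * Cnorm f) by rewrite Cnorm_sqr /=; ring.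
  have -> : Rabs t * Cnorm f * (Rabs t * Cnorm f) = (t * t) * (Cnorm f * Cnorm f).
    by rewrite -[in RHS](Rabs_pos_eq (t * t)); [rewrite Rabs_mult; ring | nra].
  by have := nrm_ge0 psi (A - RC t * Cconj f *: A')%ring; nra.
case: (Rle_lt_or_eq_dec _ _ b0) => [bp|bz].
  have := key (/ (b * b)).
  have -> : / (b * b) * / (b * b) * (Cnorm f * Cnorm f) * (b * b) = / (b * b) * (Cnorm f * Cnorm f).
    by field; lra.
  move=> h; have hb : 0 < b * b by nra.
  have : 0 <= (b * b) * (a * a - 2 * / (b * b) * (Cnorm f * Cnorm f) + / (b * b) * (Cnorm f * Cnorm f)).
    by apply: Rmult_le_pos; lra.
  have -> : (b * b) * (a * a - 2 * / (b * b) * (Cnorm f * Cnorm f) + / (b * b) * (Cnorm f * Cnorm f))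
     = a * a * (b * b) - Cnorm f * Cnorm f by field; lra.
  move=> h2; apply: Rsqr_incr_0_var; rewrite /Rsqr; nra.
case: (Rle_lt_or_eq_dec _ _ n0) => [np|<-]; last by rewrite -bz; lra.
have hf : 0 < Cnorm f * Cnorm f by nra.
(* For [b = 0] the bound is affine in [t], and this [t] makes it negative unless [f = 0]. *)
have := key ((a * a + 1) / (Cnorm f * Cnorm f)); rewrite -bz.
have -> : a * a - 2 * ((a * a + 1) / (Cnorm f * Cnorm f)) * (Cnorm f * Cnorm f)
   = a * a - 2 * (a * a + 1) by field; lra.
by nra.
Qed.

Lemma nrmD psi A A' : nrm psi (A + A')%ring <= nrm psi A + nrm psi A'.
Proof.
have := expect_form_expand psi A A' (-1)%ring.
have -> : (A - -1 *: A' = A + A')%ring by rewrite scaleN1r opprK.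
rewrite CnormN Cnorm1 mulN1r.
have := expect_cauchy_schwarz psi A A'; have := Re_le_Cnorm (expect psi (adj A * A')%ring).
set f := expect _ _ => h1 h2 /= h.
have := Rle_abs (Re f); have := nrm_ge0 psi A; have := nrm_ge0 psi A' => h3 h4 h5.
apply: Rsqr_incr_0_var; rewrite /Rsqr; nra.
Qed.
Lemma nrmZ psi c A : nrm psi (c *: A)%ring = Cnorm c * nrm psi A.
Proof.
apply: nrmE; first by apply: Rmult_le_pos; [exact: Cnorm_ge0 | exact: nrm_ge0].
rewrite adjZ opscaleAl opscaleAr !expectZ mulrA.
have -> : (Cconj c * c)%ring = RC (Cnorm c * Cnorm c) by rewrite Cnorm_sqr; apply: CplxP => /=; ring.
rewrite /= -nrm_sqr; ring.
Qed.
Lemma nrmN psi A : nrm psi (- A)%ring = nrm psi A.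
Proof. by rewrite -scaleN1r nrmZ CnormN Cnorm1; ring. Qed.
Lemma nrm1 psi : nrm psi 1%ring = vnorm psi.
Proof. by rewrite /nrm apply1. Qed.
Lemma nrm_sub_tri psi A A' A'' :
  nrm psi (A - A'')%ring <= nrm psi (A - A')%ring + nrm psi (A' - A'')%ring.
Proof. by have := nrmD psi (A - A')%ring (A' - A'')%ring; rewrite addrA subrK. Qed.
Lemma nrmD_le psi A A' x y :
  nrm psi A <= x -> nrm psi A' <= y -> nrm psi (A + A')%ring <= x + y.
Proof. by move=> h h'; apply: Rle_trans (nrmD _ _ _) _; lra. Qed.

Lemma nrm_le_opnorm psi A : vnorm psi <= 1 -> nrm psi A <= opnorm A.
Proof.
move=> h; apply: Rle_trans (vnorm_apply _ _) _.
by have := opnorm_ge0 A; have := vnorm_ge0 psi; nra.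
Qed.
Lemma opnormD A A' : opnorm (A + A')%ring <= opnorm A + opnorm A'.
Proof.
apply: opnorm_le => v hv; apply: Rle_trans (nrmD _ _ _) _.
by have := nrm_le_opnorm A hv; have := nrm_le_opnorm A' hv; lra.
Qed.
Lemma opnormZ_le c A : opnorm (c *: A)%ring <= Cnorm c * opnorm A.
Proof.
apply: opnorm_le => v hv; rewrite -/(nrm _ _) nrmZ.
by apply: Rmult_le_compat_l; [exact: Cnorm_ge0 | exact: nrm_le_opnorm].
Qed.
Lemma opnormN A : opnorm (- A)%ring = opnorm A.
Proof.
have h (X : op B) : opnorm (- X)%ring <= opnorm X.
  by apply: opnorm_le => v hv; rewrite -/(nrm _ _) nrmN; exact: nrm_le_opnorm.
by apply: Rle_antisym => //; rewrite -{1}(opprK A).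
Qed.
Lemma opnormB A A' : opnorm (A - A')%ring <= opnorm A + opnorm A'.
Proof. by apply: Rle_trans (opnormD _ _) _; rewrite opnormN; lra. Qed.
Lemma opnormD_le A A' x y : opnorm A <= x -> opnorm A' <= y -> opnorm (A + A')%ring <= x + y.
Proof. by move=> h h'; apply: Rle_trans (opnormD _ _) _; lra. Qed.
Lemma opnormB_le A A' x y : opnorm A <= x -> opnorm A' <= y -> opnorm (A - A')%ring <= x + y.
Proof. by move=> h h'; apply: Rle_trans (opnormB _ _) _; lra. Qed.
Lemma opnorm_sub A A' : opnorm (A - A')%ring = opnorm (A' - A)%ring.
Proof. by rewrite -opnormN opprB. Qed.
Lemma opnorm_sub_tri A A' A'' :
  opnorm (A - A'')%ring <= opnorm (A - A')%ring + opnorm (A' - A'')%ring.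
Proof. by have := opnormD (A - A')%ring (A' - A'')%ring; rewrite addrA subrK. Qed.
Lemma opnormM A A' : opnorm (A * A')%ring <= opnorm A * opnorm A'.
Proof.
apply: opnorm_le => v hv; apply: Rle_trans (nrm_mul _ _ _) _.
by apply: Rmult_le_compat_l; [exact: opnorm_ge0 | exact: nrm_le_opnorm].
Qed.
Lemma opnorm0 : opnorm (0%ring : op B) = 0.
Proof.
apply: Rle_antisym; last exact: opnorm_ge0.
have E : (0 = 0 *: 0 :> op B)%ring by rewrite scale0r.
by rewrite E; apply: Rle_trans (opnormZ_le _ _) _; rewrite Cnorm0; lra.
Qed.
Lemma opnorm1 : opnorm (1%ring : op B) <= 1.
Proof. by apply: opnorm_le => v; rewrite apply1. Qed.

Lemma expect_le_nrm psi A : vnorm psi <= 1 -> Cnorm (expect psi A) <= nrm psi A.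
Proof.
move=> h; rewrite -[A]mul1r -{1}adj1; apply: Rle_trans (expect_cauchy_schwarz _ _ _) _.
by rewrite nrm1 mul1r; have := nrm_ge0 psi A; nra.
Qed.
Lemma expect_le_opnorm psi A : vnorm psi <= 1 -> Cnorm (expect psi A) <= opnorm A.
Proof. by move=> h; apply: Rle_trans (expect_le_nrm _ h) (nrm_le_opnorm _ h). Qed.

(** From [||adj A v||^2 = <v, A adj A v> <= ||A|| ||adj A v||] for [||v|| <= 1]. *)
Lemma opnorm_adj_le A : opnorm (adj A) <= opnorm A.
Proof.
apply: opnorm_le => v hv; rewrite -/(nrm _ _).
have h := nrm_sqr v (adj A); rewrite adjK in h.
have h2 : nrm v (adj A) * nrm v (adj A) <= opnorm A * nrm v (adj A).
  rewrite h; apply: Rle_trans (Rle_abs _) _; apply: Rle_trans (Re_le_Cnorm _) _.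
  by apply: Rle_trans (expect_le_nrm _ hv) _; exact: nrm_mul.
have := nrm_ge0 v (adj A); have := opnorm_ge0 A; nra.
Qed.
Lemma opnorm_adj A : opnorm (adj A) = opnorm A.
Proof. by apply: Rle_antisym; [|rewrite -{1}(adjK A)]; exact: opnorm_adj_le. Qed.

Definition isom (W : op B) := (adj W * W = 1)%ring.
Lemma nrm_isom psi W A : isom W -> nrm psi (W * A)%ring = nrm psi A.
Proof.
move=> h; apply: nrmE; first exact: nrm_ge0.
by rewrite nrm_sqr adjM -mulrA (mulrA (adj W)) h mul1r.
Qed.
Lemma opnorm_isom W : isom W -> opnorm W <= 1.
Proof. by move=> h; apply: opnorm_le => v hv; rewrite -/(nrm _ _) -[W]mulr1 nrm_isom // nrm1. Qed.

Definition cst (c : Cplx) : op B := (c *: (1 : op B))%ring.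

Lemma mul_cst c A : (cst c * A = c *: A)%ring.
Proof. by rewrite /cst opscaleAl mul1r. Qed.
Lemma mul_cstr c A : (A * cst c = c *: A)%ring.
Proof. by rewrite /cst opscaleAr mulr1. Qed.
Lemma adj_cst c : adj (cst c) = cst (Cconj c).
Proof. by rewrite /cst adjZ adj1. Qed.
Lemma expect_cst psi c : vnorm psi = 1 -> expect psi (cst c) = c.
Proof.
move=> h; rewrite /cst expectZ.
suff -> : expect psi 1%ring = 1%ring by rewrite mulr1.
have := nrm_sqr psi 1%ring; rewrite nrm1 h adj1 mul1r => hr.
have := expect_adj psi 1%ring; rewrite adj1 => /(congr1 Im) /= hi.
by apply: CplxP => /=; lra.
Qed.

(** Pythagoras for the component of [A psi] along [psi]. For an isometry the right-hand side is
    [1 - |<A>|^2], so an expectation of modulus near one forces an approximate eigenvector. *)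
Lemma nrm_sub_expect psi A : vnorm psi = 1 ->
  nrm psi (A - cst (expect psi A))%ring * nrm psi (A - cst (expect psi A))%ring
  = nrm psi A * nrm psi A - Cnorm (expect psi A) * Cnorm (expect psi A).
Proof.
move=> h; rewrite expect_form_expand nrm1 h mulr1 expect_adj.
rewrite Cnorm_sqr /=; ring.
Qed.

End Vectors.
Arguments cst {B} c.

(** * The matrix exponential *)

Lemma fact_factorial k : fact k = k`!.
Proof. by elim: k => [//|k IH]; rewrite factS -IH. Qed.

(** Stated over any ring because [mexpD] uses it twice, for operators and for the real series of
    their norms; the two remainders then match term by term. *)
Lemma cauchy_truncated (E : pzRingType) (x y : nat -> E) N :
  ((\sum_(j < N.+1) x j) * (\sum_(k < N.+1) y k)
     - \sum_(m < N.+1) \sum_(j < m.+1) x j * y (m - j)%N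
   = \sum_(j < N.+1) \sum_(k < N.+1 | (N < j + k)%N) x j * y k)%ring.
Proof.
have -> : (\sum_(m < N.+1) \sum_(j < m.+1) x j * y (m - j)%N
    = \sum_(j < N.+1) \sum_(k < N.+1 | ~~ (N < j + k)%N) x j * y k)%ring.
  transitivity (\sum_(m < N.+1) \sum_(j < N.+1 | (j <= m)%N) x j * y (m - j)%N)%ring.
    apply: eq_bigr => m _.
    by rewrite (big_ord_widen N.+1 (fun j => x j * y (m - j)%N)%ring) // ltn_ord.
  rewrite (exchange_big_dep xpredT) //=; apply: eq_bigr => j _.
  rewrite -(big_geq_mkord j N.+1 xpredT (fun m => x j * y (m - j)%N)%ring).
  rewrite -(big_mkord (fun k => ~~ (N < j + k))%N (fun k => x j * y k)%ring).
  rewrite -{1}[val j]add0n big_addn.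
  under eq_bigr do rewrite addnK.
  rewrite (big_nat_widen 0 (N.+1 - j) N.+1) ?leq_subr //.
  by apply: eq_bigl => k /=; rewrite -leqNgt ltn_subRL ltnS.
rewrite big_distrl /= -sumrB; apply: eq_bigr => j _.
by rewrite mulr_sumr (bigID (fun k : 'I_N.+1 => N < j + k)%N) /= addrK.
Qed.

Section Exponential.
Variable B : finType.
Implicit Types (A : op B).

Definition wfact k : Cplx := RC (/ INR (fact k)).

Lemma oppowE A k : oppow A k = (A ^+ k)%ring.
Proof. by elim: k => [//|k IH]; rewrite exprS -IH. Qed.
Lemma expsumE A N : expsum A N = (\sum_(k < N.+1) wfact k *: A ^+ k)%ring.
Proof.
elim: N => [|N IH].
  rewrite big_ord_recl big_ord0 addr0 expr0 /wfact /= Rinv_1.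
  by rewrite -[RC 1]/(1%ring : Cplx) scale1r.
by rewrite big_ord_recr -IH -oppowE.
Qed.

Definition rexpsum (a : R) N := sum_f_R0 (fun i => / INR (fact i) * a ^ i) N.

Lemma rexpsumE a N : rexpsum a N = \big[Rplus/0]_(k < N.+1) (/ INR (fact k) * a ^ k).
Proof.
elim: N => [|N IH]; first by rewrite big_ord_recl big_ord0 /rexpsum /= Rplus_0_r.
by rewrite big_ord_recr /= -IH.
Qed.
Lemma rexpsum_cv a : Un_cv (rexpsum a) (exp a).
Proof. by rewrite /exp; case: exist_exp. Qed.
Lemma inv_fact_gt0 k : 0 < / INR (fact k).
Proof. exact/Rinv_0_lt_compat/INR_fact_lt_0. Qed.
Lemma rexpsum_grow a : 0 <= a -> Un_growing (rexpsum a).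
Proof.
move=> a0 n; rewrite /rexpsum tech5.
have : 0 <= / INR (fact n.+1) * a ^ n.+1.
  by apply: Rmult_le_pos; [exact/Rlt_le/inv_fact_gt0 | exact: pow_le].
lra.
Qed.
Lemma rexpsum_le a N : 0 <= a -> rexpsum a N <= exp a.
Proof. by move=> a0; apply: growing_ineq (rexpsum_grow a0) (rexpsum_cv a) N. Qed.

Lemma opnorm_exp A k : opnorm (A ^+ k)%ring <= opnorm A ^ k.
Proof.
elim: k => [|k IH]; first exact: opnorm1.
rewrite exprS; apply: Rle_trans (opnormM _ _) _ => /=.
by apply: Rmult_le_compat_l => //; exact: opnorm_ge0.
Qed.
Lemma opnorm_term A k : opnorm (wfact k *: A ^+ k)%ring <= / INR (fact k) * opnorm A ^ k.
Proof.
apply: Rle_trans (opnormZ_le _ _) _.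
have := inv_fact_gt0 k => h.
rewrite Cnorm_RC Rabs_pos_eq; last lra.
by apply: Rmult_le_compat_l; [lra | exact: opnorm_exp].
Qed.
Lemma opnorm_sum I r (P : pred I) (F : I -> op B) :
  opnorm (\sum_(i <- r | P i) F i)%ring <= \big[Rplus/0]_(i <- r | P i) opnorm (F i).
Proof.
apply: (big_ind2 (fun (a : op B) x => opnorm a <= x)) => [|a x b y h1 h2|i _].
- rewrite opnorm0; lra.
- by apply: Rle_trans (opnormD _ _) _; lra.
- lra.
Qed.

Lemma expsumS A N : expsum A N.+1 = (expsum A N + wfact N.+1 *: A ^+ N.+1)%ring.
Proof. by rewrite -oppowE. Qed.
Lemma expsum_cauchy A N m :
  opnorm (expsum A (N + m) - expsum A N)%ring
  <= rexpsum (opnorm A) (N + m) - rexpsum (opnorm A) N.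
Proof.
elim: m => [|m IH]; first by rewrite addn0 subrr opnorm0; lra.
rewrite addnS expsumS addrAC; apply: Rle_trans (opnormD _ _) _.
rewrite [rexpsum _ (N + m).+1]tech5 -/(rexpsum _ _).
rewrite [X in _ <= X](_ : _ = (rexpsum (opnorm A) (N + m) - rexpsum (opnorm A) N)
  + / INR (fact (N + m).+1) * opnorm A ^ (N + m).+1); last by ring.
exact: Rplus_le_compat IH (opnorm_term A (N + m).+1).
Qed.

Lemma Un_cv0_le (f g : nat -> R) :
  (forall N, 0 <= f N <= g N) -> Un_cv g 0 -> Un_cv f 0.
Proof.
move=> h hg eps e0; have [N hN] := hg eps e0; exists N => n /hN.
by rewrite /Rdist !Rminus_0_r; have [h1 h2] := h n; rewrite !Rabs_pos_eq; lra.
Qed.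
Lemma Un_cv_const (c : R) : Un_cv (fun _ => c) c.
Proof. by move=> e e0; exists O => n _; rewrite Rdist_eq. Qed.
Lemma Un_cv_sum I (r : seq I) (F : I -> nat -> R) :
  (forall i, Un_cv (F i) 0) -> Un_cv (fun N => \big[Rplus/0]_(i <- r) F i N) 0.
Proof.
move=> h; elim: r => [|i r IH].
  by have := Un_cv_const 0; apply: Un_cv_ext => n; rewrite big_nil.
have := CV_plus _ _ _ _ (h i) IH; rewrite Rplus_0_r.
by apply: Un_cv_ext => n; rewrite big_cons.
Qed.

Definition tends (X : nat -> op B) (Y : op B) :=
  Un_cv (fun N => opnorm (X N - Y)%ring) 0.

Lemma tends_entries X (Y : op B) :
  (forall i j, Un_cv (fun N => Re (X N i j)) (Re (Y i j)) /\
               Un_cv (fun N => Im (X N i j)) (Im (Y i j))) -> tends X Y.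
Proof.
move=> h; apply: Un_cv0_le (fun N => \big[Rplus/0]_i \big[Rplus/0]_j
  (Rabs (Re (X N i j) - Re (Y i j)) + Rabs (Im (X N i j) - Im (Y i j)))) _ _ => [N|].
  split; first exact: opnorm_ge0.
  apply: Rle_trans (opnorm_le_entries _) _; apply: Rsum_le => i _; apply: Rsum_le => j _.
  exact: Cnorm_le_ReIm.
have h0 (u : nat -> R) l : Un_cv u l -> Un_cv (fun N => Rabs (u N - l)) 0.
  move=> hu eps e0; have [N hN] := hu eps e0; exists N => n /hN.
  by rewrite /Rdist Rminus_0_r Rabs_Rabsolu.
apply: Un_cv_sum => i; apply: Un_cv_sum => j; case: (h i j) => h1 h2.
by rewrite -(Rplus_0_r 0); apply: CV_plus; exact: h0.
Qed.

(** [mexp] is chosen by [epsilon], so a limit has to be produced: each real and imaginary part of an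
    entry is Cauchy, being dominated by the exponential series at [opnorm A]. *)
Lemma mexp_tends A : tends (expsum A) (mexp A).
Proof.
apply: tends_entries.
apply: (epsilon_spec (inhabits (opzero (B := B))) (fun E : op B => forall i j,
    Un_cv (fun N => Re (expsum A N i j)) (Re (E i j)) /\
    Un_cv (fun N => Im (expsum A N i j)) (Im (E i j)))).
have C := CV_Cauchy _ (exist _ _ (rexpsum_cv (opnorm A))).
have H (f : Cplx -> R) (i j : B) : (forall a b : Cplx, Rabs (f a - f b) <= Cnorm (a - b)%ring) ->
    {l | Un_cv (fun N => f (expsum A N i j)) l}.
  move=> hf; apply: R_complete => eps e0; have [N hN] := C eps e0; exists N.
  have W n m : (n >= N)%coq_nat -> (n <= m)%N -> Rdist (f (expsum A m i j)) (f (expsum A n i j)) < eps.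
    move=> hn nm; have hm : (m >= N)%coq_nat by apply: Nat.le_trans hn _; apply/leP.
    apply: Rle_lt_trans (hf _ _) _.
    apply: Rle_lt_trans (opnorm_ge_entry (expsum A m - expsum A n)%ring i j) _.
    have := expsum_cauchy A n (m - n); rewrite subnKC // => h.
    by apply: Rle_lt_trans h _; apply: Rle_lt_trans (Rle_abs _) (hN _ _ hm hn).
  move=> n m hn hm; case/orP: (leq_total n m) => nm; last exact: W.
  by rewrite Rdist_sym; exact: W.
have hRe (a b : Cplx) : Rabs (Re a - Re b) <= Cnorm (a - b)%ring by exact: (Re_le_Cnorm (a - b)%ring).
have hIm (a b : Cplx) : Rabs (Im a - Im b) <= Cnorm (a - b)%ring by exact: (Im_le_Cnorm (a - b)%ring).
exists (fun i j => mkC (sval (H Re i j hRe)) (sval (H Im i j hIm))) => i j /=.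
by split; [case: (H Re i j hRe) | case: (H Im i j hIm)].
Qed.

Lemma tends_le X (Y Z : op B) M N0 : tends X Y ->
  (forall N, (N0 <= N)%N -> opnorm (X N - Z)%ring <= M) -> opnorm (Y - Z)%ring <= M.
Proof.
move=> hX h; apply: Rle_plus_epsilon => e e0; have [N hN] := hX e e0.
have := hN (maxn N N0) (leP (leq_maxl _ _)); have := h (maxn N N0) (leq_maxr _ _).
rewrite /Rdist Rminus_0_r Rabs_pos_eq; last exact: opnorm_ge0.
by rewrite [opnorm (_ - Y)%ring]opnorm_sub; have := opnorm_sub_tri Y (X (maxn N N0)) Z; lra.
Qed.

Lemma tends_unique X (Y Z : op B) : tends X Y -> tends X Z -> Y = Z.
Proof.
move=> hY hZ; apply/eqP; rewrite -subr_eq0; apply/eqP/opnorm_eq0.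
apply: Rle_plus_epsilon => e e0; have [N hN] := hZ e e0.
rewrite Rplus_0_l; apply: (tends_le (N0 := N) hY) => n /leP /hN.
by rewrite /Rdist Rminus_0_r Rabs_pos_eq; [lra | exact: opnorm_ge0].
Qed.
Lemma tends_ext X X' (Y : op B) : (forall N, X N = X' N) -> tends X Y -> tends X' Y.
Proof. by move=> h; apply: Un_cv_ext => N; rewrite h. Qed.
Lemma tends_const (Y : op B) : tends (fun _ => Y) Y.
Proof. by apply: Un_cv_ext (Un_cv_const 0) => n; rewrite subrr opnorm0. Qed.
Lemma tends_add X X' (Y Y' : op B) :
  tends X Y -> tends X' Y' -> tends (fun N => X N + X' N)%ring (Y + Y')%ring.
Proof.
move=> h h'; have := CV_plus _ _ _ _ h h'; rewrite Rplus_0_r; apply: Un_cv0_le => N.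
split; first exact: opnorm_ge0.
by rewrite opprD addrACA; exact: opnormD.
Qed.
Lemma tends_mul X X' (Y Y' : op B) :
  tends X Y -> tends X' Y' -> tends (fun N => X N * X' N)%ring (Y * Y')%ring.
Proof.
move=> h h'.
have := CV_plus _ _ _ _ (CV_plus _ _ _ _ (CV_mult _ _ _ _ h h')
  (CV_mult _ _ _ _ (Un_cv_const (opnorm Y)) h')) (CV_mult _ _ _ _ h (Un_cv_const (opnorm Y'))).
rewrite !Rmult_0_l !Rmult_0_r !Rplus_0_r; apply: Un_cv0_le => N.
split; first exact: opnorm_ge0.
have -> : (X N * X' N - Y * Y' = (X N - Y) * (X' N - Y') + Y * (X' N - Y') + (X N - Y) * Y')%ring.
  by rewrite -mulrDl subrK mulrBr mulrBl addrA subrK.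
apply: Rle_trans (opnormD _ _) _; apply: Rplus_le_compat; last exact: opnormM.
by apply: Rle_trans (opnormD _ _) _; apply: Rplus_le_compat; exact: opnormM.
Qed.

Lemma wfact_bin (m j : nat) : (j <= m)%N ->
  (wfact m *+ 'C(m, j) = wfact (m - j) * wfact j)%ring.
Proof.
move=> jm; have e := bin_fact jm; rewrite -!fact_factorial in e.
have {}e : INR 'C(m, j) * (INR (fact j) * INR (fact (m - j)%N)) = INR (fact m).
  by rewrite -!mult_INR; congr INR.
have h n : (wfact m *+ n)%ring = RC (INR n * / INR (fact m)).
  elim: n => [|n IH]; first by rewrite mulr0n; apply: CplxP => /=; ring.
  by rewrite mulrS IH S_INR; apply: CplxP => /=; ring.
rewrite h -e; apply: CplxP => /=; last ring.
have := INR_fact_neq_0 j; have := INR_fact_neq_0 (m - j)%N => h1 h2.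
have h3 : INR 'C(m, j) <> 0 by apply: not_0_INR => h0; have := bin_gt0 m j; rewrite h0 jm.
by field.
Qed.

(** The product of the partial sums differs from the partial sum at [A + A'] by the terms with
    [j + k > N]. Their norms are dominated by the same terms for the numbers [a] and [a'], which
    tend to [exp a * exp a' - exp (a + a') = 0]. *)
Lemma mexpD A A' : (A * A' = A' * A)%ring -> mexp (A + A')%ring = (mexp A * mexp A')%ring.
Proof.
move=> hC; apply/esym/(tends_unique (tends_mul (mexp_tends A) (mexp_tends A'))).
suff : tends (fun N => expsum A N * expsum A' N - expsum (A + A') N)%ring 0%ring.
  move=> h; have := tends_add h (mexp_tends (A + A')%ring); rewrite add0r.
  by apply: tends_ext => N; rewrite subrK.
set a := opnorm A; set a' := opnorm A'.
have hl : Un_cv (fun N => rexpsum a N * rexpsum a' N - rexpsum (a + a') N) 0.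
  have := CV_minus _ _ _ _ (CV_mult _ _ _ _ (rexpsum_cv a) (rexpsum_cv a')) (rexpsum_cv (a + a')).
  by rewrite exp_plus Rminus_diag.
apply: Un_cv0_le hl => N; split; first exact: opnorm_ge0.
have E : (expsum A N * expsum A' N - expsum (A + A') N
   = \sum_(j < N.+1) \sum_(k < N.+1 | (N < j + k)%N) (wfact j *: A ^+ j) * (wfact k *: A' ^+ k))%ring.
  rewrite -(cauchy_truncated (fun j => wfact j *: A ^+ j)%ring (fun k => wfact k *: A' ^+ k)%ring).
  rewrite !expsumE; congr (_ - _)%ring; apply: eq_bigr => m _.
  rewrite addrC exprDn_comm // scaler_sumr; apply: eq_bigr => j _.
  rewrite opscaleAl opscaleAr scalerA -scalerMnr scalerMnl wfact_bin; last by rewrite -ltnS ltn_ord.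
  rewrite mulrC; congr (_ *: _)%ring; apply: commrX; apply/commr_sym/commrX.
  by rewrite /GRing.comm.
have E' : rexpsum a N * rexpsum a' N - rexpsum (a + a') N =
   \big[Rplus/0]_(j < N.+1) \big[Rplus/0]_(k < N.+1 | (N < j + k)%N)
      ((/ INR (fact j) * a ^ j) * (/ INR (fact k) * a' ^ k)).
  have := cauchy_truncated (fun j => (/ INR (fact j) * a ^ j) : R) (fun k => (/ INR (fact k) * a' ^ k) : R) N.
  move=> <-; rewrite !rexpsumE; congr (_ - _); apply: eq_bigr => m _.
  rewrite binomial scal_sum.
  have -> (F : nat -> R) : sum_f_R0 F m = \big[Rplus/0]_(k < m.+1) F k.
    elim: (nat_of_ord m) => [|n IH]; first by rewrite big_ord_recl big_ord0 Rplus_0_r.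
    by rewrite big_ord_recr /= -IH.
  apply: eq_bigr => j _; rewrite /Binomial.C -[RHS]/(Rmult _ _).
  rewrite -minusE; have := INR_fact_neq_0 j; have := INR_fact_neq_0 (m - j)%N; have := INR_fact_neq_0 m.
  by move=> h1 h2 h3; field.
rewrite subr0 E E'; apply: Rle_trans (opnorm_sum _ _ _) _; apply: Rsum_le => j _.
apply: Rle_trans (opnorm_sum _ _ _) _; apply: Rsum_le => k _.
apply: Rle_trans (opnormM _ _) _; apply: Rmult_le_compat; try exact: opnorm_ge0; exact: opnorm_term.
Qed.

Lemma mexp0 : mexp (0%ring : op B) = 1%ring.
Proof.
apply: tends_unique (mexp_tends _) _; apply: tends_ext (tends_const 1%ring) => N.
elim: N => [//|N IH]; by rewrite expsumS -IH exprS mul0r scaler0 addr0.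
Qed.
Lemma adj_tends X (Y : op B) : tends X Y -> tends (fun N => adj (X N)) (adj Y).
Proof. by apply: Un_cv_ext => N; rewrite -adjB opnorm_adj. Qed.
Lemma adjX A k : adj (A ^+ k)%ring = (adj A ^+ k)%ring.
Proof. by elim: k => [|k IH]; [exact: adj1 | rewrite exprS exprSr adjM IH]. Qed.
Lemma adj_expsum A N : adj (expsum A N) = expsum (adj A) N.
Proof.
elim: N => [|N IH]; first exact: adj1.
rewrite !expsumS adjD IH adjZ adjX; congr (_ + _ *: _)%ring; apply: CplxP => /=; ring.
Qed.
Lemma adj_mexp A : adj (mexp A) = mexp (adj A).
Proof.
apply: tends_unique (adj_tends (mexp_tends A)) _.
by apply: tends_ext (mexp_tends _) => N; rewrite adj_expsum.
Qed.

Lemma expsum_intertwine A A' (W : op B) N : (W * A = A' * W)%ring ->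
  (W * expsum A N = expsum A' N * W)%ring.
Proof.
move=> h; have hk k : (W * A ^+ k = A' ^+ k * W)%ring.
  by elim: k => [|k IH]; rewrite ?expr0 ?mulr1 ?mul1r // !exprSr mulrA IH -!mulrA h.
elim: N => [|N IH]; first by rewrite -[expsum _ _]/(1%ring : op B) mulr1 mul1r.
by rewrite !expsumS mulrDr mulrDl IH opscaleAl opscaleAr hk.
Qed.
(** Allowing [A] and [A'] to differ covers commutation ([A = A']), unitary conjugation, and
    eigenvector equations ([A = 0]) at once. *)
Lemma mexp_intertwine A A' (W : op B) : (W * A = A' * W)%ring ->
  (W * mexp A = mexp A' * W)%ring.
Proof.
move=> h; apply: tends_unique (tends_mul (tends_const W) (mexp_tends A)) _.
apply: tends_ext (tends_mul (mexp_tends A') (tends_const W)) => N.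
by rewrite (expsum_intertwine _ h).
Qed.

(** Multiply [1 - x <= exp (- x)] by [(1 + x) * exp x]. *)
Lemma exp_quadratic x : 0 <= x -> exp x - 1 - x <= x * x * exp x.
Proof.
move=> x0; have h := exp_ineq1_le (- x); have hp := exp_pos x.
have e : exp (- x) * exp x = 1 by rewrite -exp_plus Rplus_opp_l exp_0.
have : (1 - x) * ((1 + x) * exp x) <= exp (- x) * ((1 + x) * exp x).
  by apply: Rmult_le_compat_r; [apply: Rmult_le_pos; lra | lra].
have -> : exp (- x) * ((1 + x) * exp x) = 1 + x by rewrite -[RHS]Rmult_1_r -e; ring.
by nra.
Qed.

Lemma mexp_taylor A :
  opnorm (mexp A - (1 + A))%ring <= opnorm A * opnorm A * exp (opnorm A).
Proof.
have a0 := opnorm_ge0 A.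
apply: Rle_trans (exp_quadratic a0); apply: (tends_le (N0 := 1%N) (mexp_tends A)) => N N1.
have e1 : expsum A 1 = (1 + A)%ring.
  rewrite expsumS expr1 /wfact /= Rinv_1.
  by rewrite -[RC 1]/(1%ring : Cplx) scale1r.
rewrite -e1; have := expsum_cauchy A 1 (N - 1); rewrite subnKC // => h.
apply: Rle_trans h _; have := rexpsum_le N a0.
by rewrite /rexpsum /= Rinv_1; lra.
Qed.

End Exponential.

(** * One-parameter unitary groups *)

(** Proves identities that are linear in the operators, entry by entry. Products have to be
    generalised to variables first, which is what the [move: (...) => X] before its calls do. *)
Ltac oplin := apply: opP => ? ?; apply: CplxP => /=; ring.

(** A mean value inequality without derivatives: [D s t] stands for the size of [F t - F s]. Over
    [N] equal steps the quadratic remainders add up to [M T^2 / N], and [N] is free; hence [M] is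
    absent from the conclusion. *)
Lemma increments_bound (D : R -> R -> R) (K M T : R) :
  (forall s t u, D s u <= D s t + D t u) -> D 0 0 <= 0 -> 0 <= T ->
  (forall s h, 0 <= s -> 0 <= h <= 1 -> s + h <= T -> D s (s + h) <= K * h + M * (h * h)) ->
  D 0 T <= K * T.
Proof.
move=> tri D0 T0 hD; apply: Rle_plus_epsilon => e e0.
have [N [hN1 hN2]] : exists N : nat, 0 < INR N /\ T <= INR N /\ M * (T * T) <= e * INR N.
  have [n1 hn1] := INR_unbounded T; have [n2 hn2] := INR_unbounded (M * (T * T) / e).
  exists (n1 + n2 + 1)%coq_nat; rewrite !plus_INR /=.
  have p1 := pos_INR n1; have p2 := pos_INR n2; split; [lra | split; first lra].
  have -> : M * (T * T) = e * (M * (T * T) / e) by field; lra.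
  by apply: Rmult_le_compat_l; lra.
case: hN2 => hN2 hN3.
pose h := T / INR N.
have h0 : 0 <= h by apply: Rmult_le_pos => //; exact/Rlt_le/Rinv_0_lt_compat.
have h1 : h <= 1 by apply: (Rmult_le_reg_r (INR N)) => //; rewrite /h; field_simplify; lra.
have NhT : INR N * h = T by rewrite /h; field; lra.
have step k : (k <= N)%N -> D 0 (INR k * h) <= INR k * (K * h + M * (h * h)).
  elim: k => [_|k IH kN]; first by rewrite /= !Rmult_0_l.
  have := IH (ltnW kN); have := tri 0 (INR k * h) (INR k.+1 * h).
  have kh : 0 <= INR k * h by apply: Rmult_le_pos => //; exact: pos_INR.
  have kN' : INR k.+1 <= INR N by apply/le_INR/leP.
  have := hD (INR k * h) h kh (conj h0 h1); rewrite S_INR in kN' *.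
  have -> : (INR k + 1) * h = INR k * h + h by ring.
  have : INR k * h + h <= T by rewrite -NhT; nra.
  by move=> hT hh h2 h3; have := hh hT; lra.
have := step N (leqnn N); rewrite NhT.
have -> : INR N * (K * h + M * (h * h)) = K * T + M * (T * T) / INR N by rewrite /h; field; lra.
move=> hs; apply: Rle_trans hs _; apply: Rplus_le_compat_l.
by apply: (Rmult_le_reg_r (INR N)) => //; rewrite /Rdiv Rmult_assoc Rinv_l; lra.
Qed.

Definition cis (x : R) : Cplx := mkC (cos x) (sin x).
Definition iR (s : R) : Cplx := mkC 0 s.

Lemma cisD x y : cis (x + y) = (cis x * cis y)%ring.
Proof. by apply: CplxP; rewrite /= ?cos_plus ?sin_plus; ring. Qed.
Lemma cis0 : cis 0 = 1%ring.
Proof. by apply: CplxP; rewrite /= ?cos_0 ?sin_0. Qed.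
Lemma Cnorm_cis x : Cnorm (cis x) = 1.
Proof. by apply: CnormE; [lra | have := sin2_cos2 x; rewrite /Rsqr /=; lra]. Qed.
Lemma Cconj_cis x : Cconj (cis x) = cis (- x).
Proof. by apply: CplxP; rewrite /= ?cos_neg ?sin_neg. Qed.
Lemma Cnorm_iR s : Cnorm (iR s) = Rabs s.
Proof. by apply: CnormE; [exact: Rabs_pos | rewrite /= -Rabs_mult Rabs_pos_eq; nra]. Qed.
Lemma cisN x : (cis (- x) * cis x)%ring = 1%ring.
Proof. by rewrite -cisD Rplus_opp_l cis0. Qed.

Lemma sin_taylor x : Rabs (sin x - x) <= 2 * (x * x).
Proof.
have W y : 0 <= y -> Rabs (sin y - y) <= 2 * (y * y).
  move=> y0; case: (Rle_lt_dec y 1) => y1.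
    have y4 : y <= 4 by lra.
    have [h1 _] := pre_sin_bound y 0 y0 y4.
    have h2 : sin y <= y by case: y0 => [/sin_lt_x|<-]; rewrite ?sin_0; lra.
    have {}h1 : y - y * y * y / 6 <= sin y.
      apply: Rle_trans h1; rewrite /sin_approx /sin_term /=; lra.
    have h3 : y * y * y <= y * y by nra.
    by apply: Rabs_le; split; nra.
  by apply: Rabs_le; have := SIN_bound y; nra.
case: (Rle_lt_dec 0 x) => x0; first exact: W.
have := W (- x); rewrite sin_neg.
have -> : - sin x - - x = - (sin x - x) by ring.
rewrite Rabs_Ropp => h; have -> : x * x = - x * - x by ring.
by apply: h; lra.
Qed.
Lemma cos_taylor x : Rabs (cos x - 1) <= x * x.
Proof.
have -> : x = 2 * (x / 2) by field.
rewrite cos_2a_sin; set y := x / 2.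
have hs : sin y * sin y <= y * y.
  have W z : 0 <= z -> sin z * sin z <= z * z.
    move=> z0; have [zp|<-] := Rle_lt_or_eq_dec _ _ z0; last by rewrite sin_0; lra.
    case: (Rle_lt_dec z 1) => z1; last by have := SIN_bound z; nra.
    have := sin_lt_x z zp; have : 0 < sin z by apply: sin_gt_0 => //; have := PI2_1; lra.
    by nra.
  case: (Rle_lt_dec 0 y) => y0; first exact: W.
  by have := W (- y); rewrite sin_neg; lra.
by apply: Rabs_le; nra.
Qed.
Lemma cis_taylor x : Cnorm (cis x - (1 + iR x))%ring <= 3 * (x * x).
Proof.
apply: Rle_trans (Cnorm_le_ReIm _) _ => /=.
have -> : cos x + - (1 + 0) = cos x - 1 by ring.
have -> : sin x + - (0 + x) = sin x - x by ring.
by have := sin_taylor x; have := cos_taylor x; lra.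
Qed.

Section UnitaryGroups.
Variable B : finType.
Implicit Types (A H : op B) (psi : vec B).

Definition V H (s : R) : op B := mexp (iR s *: H)%ring.
Definition sa H := adj H = H.

Lemma VD H s t : V H (s + t) = (V H s * V H t)%ring.
Proof.
rewrite /V -mexpD; last by rewrite !opscaleAl !opscaleAr !scalerA mulrC.
by rewrite -scalerDl; congr (mexp (_ *: _)%ring); apply: CplxP => /=; ring.
Qed.
Lemma V0 H : V H 0 = 1%ring.
Proof. by rewrite /V -[iR 0]/(0%ring : Cplx) scale0r mexp0. Qed.
Lemma V_inv H s : (V H (- s) * V H s = 1)%ring.
Proof. by rewrite -VD Rplus_opp_l V0. Qed.
Lemma V_invr H s : (V H s * V H (- s) = 1)%ring.
Proof. by rewrite -VD Rplus_opp_r V0. Qed.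
Lemma V_adj H s : sa H -> adj (V H s) = V H (- s).
Proof.
by move=> h; rewrite /V adj_mexp adjZ h; congr (mexp (_ *: _)%ring); apply: CplxP => /=; ring.
Qed.
Lemma V_isom H s : sa H -> isom (V H s).
Proof. by move=> h; rewrite /isom V_adj // V_inv. Qed.
Lemma opnorm_V H s : sa H -> opnorm (V H s) <= 1.
Proof. by move=> h; apply/opnorm_isom/V_isom. Qed.
Lemma V_intertwine W H H' s : (W * H = H' * W)%ring -> (W * V H s = V H' s * W)%ring.
Proof. by move=> h; apply: mexp_intertwine; rewrite opscaleAl opscaleAr h. Qed.
Lemma V_comm H H' s t : (H * H' = H' * H)%ring -> (V H s * V H' t = V H' t * V H s)%ring.
Proof. by move=> h; apply: V_intertwine; apply/esym; apply: V_intertwine. Qed.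
Lemma V_sum H H' s : (H * H' = H' * H)%ring -> V (H + H')%ring s = (V H s * V H' s)%ring.
Proof. by move=> h; rewrite /V scalerDr mexpD // !opscaleAl !opscaleAr h. Qed.
Lemma V_conj (U : op B) H s : (U * adj U = 1)%ring -> (adj U * U = 1)%ring ->
  (adj U * V H s * U = V (adj U * H * U) s)%ring.
Proof.
move=> h1 h2; rewrite (@V_intertwine (adj U) H (adj U * H * U)%ring).
  by rewrite -mulrA h2 mulr1.
by rewrite -!mulrA h1 mulr1.
Qed.

Lemma V_taylor H : exists M, 0 <= M /\ forall h, Rabs h <= 1 ->
  opnorm (V H h - (1 + iR h *: H))%ring <= M * (h * h).
Proof.
exists (opnorm H * opnorm H * exp (opnorm H)).
have n0 := opnorm_ge0 H; have e0 := exp_pos (opnorm H).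
split; first by apply: Rmult_le_pos; [nra | lra].
move=> h h1; apply: Rle_trans (mexp_taylor _) _.
have hx := opnormZ_le (iR h) H; rewrite Cnorm_iR in hx.
have x0 := opnorm_ge0 (iR h *: H)%ring; set x := opnorm _ in hx x0 *.
have a0 := Rabs_pos h.
have x1 : x <= opnorm H by nra.
have ex : exp x <= exp (opnorm H) by case: x1 => [/exp_increasing|->]; lra.
have xx : x * x <= opnorm H * opnorm H * (h * h).
  have -> : h * h = Rabs h * Rabs h by rewrite -Rabs_mult Rabs_pos_eq; nra.
  have -> : opnorm H * opnorm H * (Rabs h * Rabs h) = (Rabs h * opnorm H) * (Rabs h * opnorm H) by ring.
  by apply: Rmult_le_compat.
apply: (Rle_trans _ ((opnorm H * opnorm H * (h * h)) * exp (opnorm H))); last by right; ring.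
by apply: Rmult_le_compat => //; [nra | have := exp_pos x; lra].
Qed.

Lemma opnorm_mul_le1 W A : opnorm W <= 1 -> opnorm (W * A)%ring <= opnorm A.
Proof. by move=> h; apply: Rle_trans (opnormM _ _) _; have := opnorm_ge0 A; nra. Qed.
Lemma opnorm_mulr_le1 A W : opnorm W <= 1 -> opnorm (A * W)%ring <= opnorm A.
Proof. by move=> h; apply: Rle_trans (opnormM _ _) _; have := opnorm_ge0 A; nra. Qed.

(** The increments are [V H t (V H h - 1) psi], and the isometry [V H t] drops out. The point is
    that [H] enters only through [H psi], not through its norm. *)
Lemma V_sub1_nrm psi H s : sa H -> 0 <= s -> nrm psi (V H s - 1)%ring <= nrm psi H * s.
Proof.
move=> hH s0; have [M [M0 hM]] := V_taylor H.
pose D s t := nrm psi (V H t - V H s)%ring.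
have := @increments_bound D (nrm psi H) (M * vnorm psi) s; rewrite /D V0; apply=> //.
- by move=> a b c; rewrite Rplus_comm; exact: nrm_sub_tri.
- by rewrite subrr -(scale0r (1%ring : op B)) nrmZ Cnorm0; lra.
move=> t h t0 [h0 h1] _.
have -> : (V H (t + h) - V H t = V H t * (V H h - 1))%ring by rewrite VD mulrBr mulr1.
rewrite nrm_isom; last exact: V_isom.
have -> : (V H h - 1 = (V H h - (1 + iR h *: H)) * 1 + iR h *: H)%ring.
  by rewrite mulr1 opprD addrA subrK.
apply: Rle_trans (nrmD _ _ _) _; rewrite nrmZ Cnorm_iR Rabs_pos_eq //.
have := nrm_mul psi (V H h - (1 + iR h *: H))%ring 1%ring; rewrite nrm1.
have := hM h; rewrite Rabs_pos_eq // => /(_ h1) h2 h3; have := vnorm_ge0 psi => h4.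
by have := nrm_ge0 psi H; nra.
Qed.

(** The product [V H' (- s) * V H s] starts at [1] and has derivative [i V H' (- s) (H - H') V H s],
    whose norm only involves the difference. *)
Lemma V_duhamel H H' s : sa H -> sa H' -> 0 <= s ->
  opnorm (V H s - V H' s)%ring <= opnorm (H - H')%ring * s.
Proof.
move=> hH hH' s0; have [M [M0 hM]] := V_taylor H; have [M' [M0' hM']] := V_taylor H'.
pose F s := (V H' (- s) * V H s)%ring.
pose D s t := opnorm (F t - F s)%ring.
have : D 0 s <= opnorm (H - H')%ring * s.
  apply: (@increments_bound D _ (M + M') s) => //.
  - by move=> a b c; rewrite Rplus_comm; exact: opnorm_sub_tri.
  - by rewrite /D subrr opnorm0; lra.
  move=> t h t0 [h0 h1] _; rewrite /D /F.
  have -> : (V H' (- (t + h)) * V H (t + h) - V H' (- t) * V H t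
     = V H' (- t) * V H' (- h) * (V H h - V H' h) * V H t)%ring.
    have -> : - (t + h) = - t + - h by ring.
    by rewrite VD (Rplus_comm t) VD mulrBr mulrBl -(mulrA (V H' (- t)) (V H' (- h)) (V H' h)) V_inv mulr1 !mulrA.
  apply: Rle_trans (opnorm_mulr_le1 _ (opnorm_V _ hH)) _.
  apply: Rle_trans (opnorm_mul_le1 _ _) _.
    by apply: Rle_trans (opnorm_mul_le1 _ (opnorm_V _ hH')) (opnorm_V _ hH').
  have -> : (V H h - V H' h = (V H h - (1 + iR h *: H)) - (V H' h - (1 + iR h *: H'))
     + iR h *: (H - H'))%ring.
    by move: (V H h) (V H' h) => X X'; oplin.
  have h4 := opnormZ_le (iR h) (H - H')%ring; rewrite Cnorm_iR Rabs_pos_eq // in h4.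
  have := hM h; have := hM' h; rewrite Rabs_pos_eq // => /(_ h1) h2 /(_ h1) h3.
  by apply: Rle_trans (opnormD_le (opnormB_le h3 h2) h4) _; lra.
rewrite /D /F Ropp_0 !V0 mulr1.
have -> : (V H' (- s) * V H s - 1 = V H' (- s) * (V H s - V H' s))%ring by rewrite mulrBr V_inv.
move=> h; have -> : (V H s - V H' s = V H' s * (V H' (- s) * (V H s - V H' s)))%ring.
  by rewrite mulrA V_invr mul1r.
by apply: Rle_trans (opnorm_mul_le1 _ (opnorm_V _ hH')) h.
Qed.
End UnitaryGroups.

(** * Product formulas and approximate eigenvalues of unitary groups *)

Section ProductFormulas.
Variable B : finType.
Implicit Types (A H C : op B) (psi : vec B).

Lemma saD A C : sa A -> sa C -> sa (A + C)%ring.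
Proof. by rewrite /sa adjD => -> ->. Qed.
Lemma saN A : sa A -> sa (- A)%ring.
Proof. by rewrite /sa adjN => ->. Qed.
Lemma saB A C : sa A -> sa C -> sa (A - C)%ring.
Proof. by move=> h h'; apply: saD => //; exact: saN. Qed.
Lemma sa_cst x : sa (cst (RC x) : op B).
Proof. by rewrite /sa adj_cst; congr cst; apply: CplxP => /=; ring. Qed.
Lemma sa_conj U A : sa A -> sa (adj U * A * U)%ring.
Proof. by rewrite /sa !adjM adjK mulrA => ->. Qed.

Lemma V_opp H s : V (- H)%ring s = V H (- s).
Proof. by rewrite /V; congr mexp; oplin. Qed.
Lemma V_zero s : V (0%ring : op B) s = 1%ring.
Proof. by rewrite /V scaler0 mexp0. Qed.
Lemma V_sub1 H s : sa H -> 0 <= s -> opnorm (V H s - 1)%ring <= opnorm H * s.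
Proof.
move=> hH s0; have := @V_duhamel _ H 0%ring s hH (adj0 B) s0.
by rewrite V_zero subr0.
Qed.

Lemma V_prod_taylor A C : sa A -> sa C -> exists M, 0 <= M /\ forall h, 0 <= h <= 1 ->
  opnorm (V A h * V C h - (1 + iR h *: (A + C)))%ring <= M * (h * h).
Proof.
move=> hA hC; have [M [M0 hM]] := V_taylor A; have [M' [M0' hM']] := V_taylor C.
have a0 := opnorm_ge0 A; have c0 := opnorm_ge0 C.
exists (M + opnorm A * opnorm C + M'); split; first by nra.
move=> h [h0 h1].
have -> : (V A h * V C h - (1 + iR h *: (A + C)) = (V A h - (1 + iR h *: A)) * V C h
    + iR h *: (A * (V C h - 1)) + (V C h - (1 + iR h *: C)))%ring.
  have -> : ((V A h - (1 + iR h *: A)) * V C h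
      = V A h * V C h - (V C h + iR h *: (A * V C h)))%ring.
    by rewrite mulrBl mulrDl mul1r opscaleAl.
  have -> : (A * (V C h - 1) = A * V C h - A)%ring by rewrite mulrBr mulr1.
  move: (V A h * V C h)%ring => X; move: (A * V C h)%ring => Z; move: (V C h) => Y.
  by oplin.
have := hM h; have := hM' h; rewrite Rabs_pos_eq // => /(_ h1) h2 /(_ h1) h3.
have h4 : opnorm ((V A h - (1 + iR h *: A)) * V C h)%ring <= M * (h * h).
  by apply: Rle_trans (opnorm_mulr_le1 _ (opnorm_V _ hC)) h3.
have h5 : opnorm (iR h *: (A * (V C h - 1)))%ring <= opnorm A * opnorm C * (h * h).
  apply: Rle_trans (opnormZ_le _ _) _; rewrite Cnorm_iR Rabs_pos_eq //.
  have -> : opnorm A * opnorm C * (h * h) = h * (opnorm A * (opnorm C * h)) by ring.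
  apply: Rmult_le_compat_l => //; apply: Rle_trans (opnormM _ _) _.
  by apply: Rmult_le_compat_l => //; exact: V_sub1.
by apply: Rle_trans (opnormD_le (opnormD_le h4 h5) h2) _; lra.
Qed.

(* Differentiating [V (A + C) (- s) * V A s * V C s] in [s] leaves only the
   commutator of [V A s] with [C]; no bound on the norms of [A] and [C] enters. *)
Lemma V_bch A C e T : sa A -> sa C -> 0 <= T ->
  (forall s, 0 <= s <= T -> opnorm (V A s * C - C * V A s)%ring <= e) ->
  opnorm (V (A + C)%ring T - V A T * V C T)%ring <= e * T.
Proof.
move=> hA hC T0 he; have hS := saD hA hC; set S := (A + C)%ring in hS *.
have [M [M0 hM]] := V_prod_taylor hA hC; have [M' [M0' hM']] := V_taylor S.
pose G s := (V S (- s) * V A s * V C s)%ring.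
pose D s t := opnorm (G t - G s)%ring.
have : D 0 T <= e * T.
  apply: (@increments_bound D _ (M + M') T) => //.
  - by move=> a b c; rewrite Rplus_comm; exact: opnorm_sub_tri.
  - by rewrite /D subrr opnorm0; lra.
  move=> s h s0 [h0 h1] hT.
  set P := (V A h * V C h)%ring.
  have -> : D s (s + h) = opnorm (V S (- s) * V S (- h) * (V A s * P - V S h * V A s) * V C s)%ring.
    congr opnorm; rewrite /G; have -> : - (s + h) = - s + - h by ring.
    rewrite VD (VD A) (Rplus_comm s h) (VD C) mulrBr mulrBl; congr (_ - _)%ring.
      by rewrite /P !mulrA.
    by rewrite !mulrA -(mulrA (V S (- s)) (V S (- h)) (V S h)) V_inv mulr1.
  apply: Rle_trans (opnorm_mulr_le1 _ (opnorm_V _ hC)) _.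
  apply: Rle_trans (opnorm_mul_le1 _ _) _.
    by apply: Rle_trans (opnorm_mul_le1 _ (opnorm_V _ hS)) (opnorm_V _ hS).
  have -> : (V A s * P - V S h * V A s = V A s * (P - (1 + iR h *: S))
      - (V S h - (1 + iR h *: S)) * V A s + iR h *: (V A s * C - C * V A s))%ring.
    have cA : (V A s * A = A * V A s)%ring by apply/esym/V_intertwine.
    have -> : (V A s * (P - (1 + iR h *: S))
        = V A s * P - (V A s + iR h *: (A * V A s + V A s * C)))%ring.
      by rewrite mulrBr mulrDr mulr1 opscaleAr /S mulrDr cA.
    have -> : ((V S h - (1 + iR h *: S)) * V A s
        = V S h * V A s - (V A s + iR h *: (A * V A s + C * V A s)))%ring.
      by rewrite mulrBl mulrDl mul1r opscaleAl /S mulrDl.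
    move: (V A s * P)%ring => X; move: (V S h * V A s)%ring => Y.
    move: (A * V A s)%ring => Z; move: (V A s * C)%ring => W; move: (C * V A s)%ring => W'.
    by move: (V A s) => V'; oplin.
  have := hM' h; rewrite Rabs_pos_eq // => /(_ h1) h2.
  have h3 := hM h (conj h0 h1).
  have h4 := Rle_trans _ _ _ (opnorm_mul_le1 _ (opnorm_V s hA)) h3.
  have h5 := Rle_trans _ _ _ (opnorm_mulr_le1 _ (opnorm_V s hA)) h2.
  have h6 : opnorm (iR h *: (V A s * C - C * V A s))%ring <= h * e.
    apply: Rle_trans (opnormZ_le _ _) _; rewrite Cnorm_iR Rabs_pos_eq //.
    by apply: Rmult_le_compat_l => //; apply: he; lra.
  by apply: Rle_trans (opnormD_le (opnormB_le h4 h5) h6) _; lra.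
rewrite /D /G Ropp_0 !V0 !mulr1.
have -> : (V S (- T) * V A T * V C T - 1 = V S (- T) * (V A T * V C T - V S T))%ring.
  by rewrite mulrBr V_inv mulrA.
move=> h; rewrite opnorm_sub.
have -> : (V A T * V C T - V S T = V S T * (V S (- T) * (V A T * V C T - V S T)))%ring.
  by rewrite mulrA V_invr mul1r.
by apply: Rle_trans (opnorm_mul_le1 _ (opnorm_V _ hS)) h.
Qed.

Lemma opnorm_cst c : opnorm (cst c : op B) <= Cnorm c.
Proof.
apply: Rle_trans (opnormZ_le _ _) _.
by have := opnorm1 B; have := Cnorm_ge0 c; nra.
Qed.
Lemma cstM c c' : (cst c * cst c' = cst (c * c') :> op B)%ring.
Proof. by rewrite mul_cst /cst scalerA. Qed.
Lemma cst1 : cst 1%ring = 1%ring :> op B.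
Proof. by rewrite /cst scale1r. Qed.

(** This links the exponential series to [cos] and [sin]: [exp(-it) V 1 t] has zero derivative, so
    it keeps its value [1] at [t = 0]. Negative times follow by taking adjoints. *)
Lemma V_one s : V (1%ring : op B) s = cst (cis s).
Proof.
have h1 : sa (1%ring : op B) by exact: adj1.
have [M [M0 hM]] := V_taylor (1%ring : op B).
have W t : 0 <= t -> V (1%ring : op B) t = cst (cis t).
  move=> t0; pose F t := (cst (cis (- t)) * V 1 t : op B)%ring.
  pose D s t := opnorm (F t - F s)%ring.
  have : D 0 t <= 0 * t.
    apply: (@increments_bound D _ (M + 3) t) => //.
    - by move=> a b c; rewrite Rplus_comm; exact: opnorm_sub_tri.
    - by rewrite /D subrr opnorm0; lra.
    move=> x h x0 [h0 h1'] _.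
    have -> : D x (x + h) = opnorm (cst (cis (- x)) * cst (cis (- h)) * (V (1 : op B) h - cst (cis h)) * V (1 : op B) x)%ring.
      congr opnorm; rewrite /F; have -> : - (x + h) = - x + - h by ring.
      rewrite cisD (Rplus_comm x h) VD mulrBr mulrBl -cstM; congr (_ - _)%ring; first by rewrite !mulrA.
      by rewrite -(mulrA _ (cst (cis (- h))) (cst (cis h))) (cstM (cis (- h))) cisN cst1 mulr1.
    apply: Rle_trans (opnorm_mulr_le1 _ (opnorm_V _ h1)) _.
    apply: Rle_trans (opnorm_mul_le1 _ _) _.
      by rewrite cstM; apply: Rle_trans (opnorm_cst _) _; rewrite CnormM !Cnorm_cis; lra.
    have -> : (V (1 : op B) h - cst (cis h) = (V (1 : op B) h - (1 + iR h *: (1 : op B))) - cst (cis h - (1 + iR h)) :> op B)%ring.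
      by rewrite /cst; move: (V 1%ring h) => X; oplin.
    have := hM h; rewrite Rabs_pos_eq // => /(_ h1') h2.
    by apply: Rle_trans (opnormB_le h2 (Rle_trans _ _ _ (opnorm_cst _) (cis_taylor h))) _; lra.
  rewrite Rmult_0_l /D => /opnorm_eq0 /eqP; rewrite subr_eq0 => /eqP.
  rewrite /F Ropp_0 V0 cis0 cst1 mulr1 => e.
  have : (cst (cis t) * (cst (cis (- t)) * V 1 t) = cst (cis t) :> op B)%ring by rewrite e mulr1.
  by rewrite mulrA cstM mulrC cisN cst1 mul1r.
case: (Rle_lt_dec 0 s) => s0; first exact: W.
have e : V (1%ring : op B) (- s) = adj (cst (cis s)) by rewrite W ?adj_cst ?Cconj_cis //; lra.
by rewrite -(adjK (cst _)) -e V_adj // Ropp_involutive.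
Qed.

Lemma V_cst q s : V (cst (RC q) : op B) s = cst (cis (q * s)).
Proof.
rewrite -V_one /V /cst scalerA; congr (mexp (_ *: _)%ring); apply: CplxP => /=; ring.
Qed.

Lemma V_shift H q s : V H s = (V (H - cst (RC q)) s * cst (cis (q * s)))%ring.
Proof.
rewrite -V_cst -V_sum ?subrK //.
by rewrite mul_cst mul_cstr.
Qed.

(** Splitting off the phase leaves the group of [H - q], to which [V_sub1_nrm] applies; the error
    involves the defect [e] of the eigenvalue equation and no norm of [H]. *)
Lemma V_eig psi H q s e : sa H -> nrm psi (H - cst (RC q))%ring <= e -> 0 <= s ->
  nrm psi (V H s - cst (cis (q * s)))%ring <= e * s.
Proof.
move=> hH he s0; rewrite (V_shift H q).
set K := (H - cst (RC q))%ring in he *.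
have hK : sa K by apply: saB => //; exact: sa_cst.
have -> : (V K s * cst (cis (q * s)) - cst (cis (q * s)) = cis (q * s) *: (V K s - 1))%ring.
  by rewrite mul_cstr scalerBr.
rewrite nrmZ Cnorm_cis Rmult_1_l; apply: Rle_trans (V_sub1_nrm _ hK s0) _.
by apply: Rmult_le_compat_r.
Qed.
Lemma V_eigN psi H q s e : sa H -> nrm psi (H - cst (RC q))%ring <= e -> 0 <= s ->
  nrm psi (V H (- s) - cst (cis (- (q * s))))%ring <= e * s.
Proof.
move=> hH he s0; rewrite -V_opp.
have -> : - (q * s) = - q * s by ring.
apply: V_eig => //; first exact: saN.
rewrite -nrmN; suff -> : (- (- H - cst (RC (- q))) = H - cst (RC q))%ring by [].
rewrite /cst; oplin.
Qed.

End ProductFormulas.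

(** * Integer spectrum *)

Section CayleyHamilton.
Variable B : finType.
Local Notation CC := (complex.complex R).

(** Transport to matrices over the closed field [complex R], where the characteristic polynomial
    splits and the Cayley-Hamilton theorem is stated. *)
Definition toC (a : Cplx) : CC := complex.Complex (Re a) (Im a).
Definition ofC (a : CC) : Cplx := mkC (complex.Re a) (complex.Im a).

Lemma toCM (a b : Cplx) : toC (a * b)%ring = (toC a * toC b)%ring. Proof. by []. Qed.
Lemma ofCK (a : CC) : toC (ofC a) = a. Proof. by case: a. Qed.
Lemma toC_sum I r (P : pred I) (F : I -> Cplx) :
  toC (\sum_(i <- r | P i) F i)%ring = (\sum_(i <- r | P i) toC (F i))%ring.
Proof. by apply: big_morph. Qed.

Definition mx_of (A : op B) : 'M[CC]_#|B| := (\matrix_(i, j) toC (A (enum_val i) (enum_val j)))%ring.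

Lemma mx_ofM A A' : mx_of (A * A')%ring = (mx_of A *m mx_of A')%ring.
Proof.
apply/matrixP => i j; rewrite !mxE.
rewrite -[(A * A')%ring]/(opmul A A') opmulEij toC_sum.
rewrite (reindex (@enum_val B B)) /=; last first.
  by exists (@enum_rank B) => x _; [exact: enum_valK | exact: enum_rankK].
by apply: eq_bigr => k _; rewrite !mxE toCM.
Qed.
Lemma mx_of_inj A A' : mx_of A = mx_of A' -> A = A'.
Proof.
move=> /matrixP h; apply: opP => i j; have := h (enum_rank i) (enum_rank j).
by rewrite !mxE !enum_rankK => -[h1 h2]; exact: CplxP.
Qed.
Lemma mx_of_sub_cst (A : op B) (l : CC) : mx_of (A - cst (ofC l))%ring = (mx_of A - l%:M)%ring.
Proof.
apply/matrixP => i j; rewrite !mxE -[l in RHS]ofCK.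
rewrite -[(A - _)%ring (enum_val i) (enum_val j)]/((A (enum_val i) (enum_val j) - cst (ofC l) (enum_val i) (enum_val j))%ring).
have -> : cst (ofC l) (enum_val i) (enum_val j) = (ofC l *+ (i == j))%ring.
  rewrite -[LHS]/(ofC l * opid (enum_val i) (enum_val j))%ring /opid (eqtype.inj_eq enum_val_inj).
  by case: eqP => _; [exact: mulr1 | exact: mulr0].
by case: (i == j); rewrite ?mulr1n ?mulr0n.
Qed.

Lemma annihilating_product (A : op B) :
  exists ls : seq Cplx, (\prod_(l <- ls) (A - cst l) = 0)%ring.
Proof.
(* [horner_mx] works with matrices of size [n.+1]. For empty [B] all operators are equal and the
   empty product will do. *)
case E : #|B| => [|n].
  exists [::]; apply: opP => i; have := card0_eq E i; by [].
have [ls hls] : exists ls : seq CC, (\prod_(l <- ls) (mx_of A - l%:M) = 0)%ring.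
  move: (mx_of A); rewrite E => M.
  have [rs hrs] := closed_field_poly_normal (char_poly M).
  exists rs; have := Cayley_Hamilton M; rewrite hrs (monicP (char_poly_monic M)) scale1r.
  rewrite rmorph_prod /= => <-; apply: eq_bigr => l _.
  by rewrite rmorphB /= horner_mx_X horner_mx_C.
exists (map ofC ls); apply: mx_of_inj.
have hp : mx_of (\prod_(l <- ls) (A - cst (ofC l)))%ring = (\prod_(l <- ls) (mx_of A - l%:M))%ring.
  elim: ls {hls} => [|l ls IH]; last by rewrite !big_cons mx_ofM IH mx_of_sub_cst.
  rewrite !big_nil; apply/matrixP => i j; rewrite !mxE.
  rewrite -[(1%ring : op B) (enum_val i) (enum_val j)]/(opid (enum_val i) (enum_val j)) /opid (eqtype.inj_eq enum_val_inj).
  by case: eqP.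
by rewrite big_map hp hls; apply/matrixP => i j; rewrite !mxE.
Qed.

End CayleyHamilton.

Lemma cis_2PI_Z z : cis (IZR z * (2 * PI)) = 1%ring.
Proof.
have hc x : cis (x + 2 * PI) = cis x.
  by rewrite cisD; apply: CplxP; rewrite /= cos_2PI sin_2PI; ring.
have hn n : cis (INR n * (2 * PI)) = 1%ring.
  elim: n => [|n IH]; first by rewrite Rmult_0_l cis0.
  by rewrite S_INR Rmult_plus_distr_r Rmult_1_l hc.
case: (Z_le_dec 0 z) => z0; first by rewrite -(Z2Nat.id z z0) -INR_IZR_INZ.
rewrite -(Z.opp_involutive z) opp_IZR -(Z2Nat.id (- z)); last lia.
by rewrite -INR_IZR_INZ Ropp_mult_distr_l_reverse -Cconj_cis hn; apply: CplxP => /=; ring.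
Qed.

Section Integrality.
Variable B : finType.
Implicit Types A : op B.

Lemma adj_mul_eq0 (Y : op B) : (adj Y * Y = 0)%ring -> Y = 0%ring.
Proof.
move=> h; apply: opnorm_eq0; apply: opnorm_le => v _; rewrite -/(nrm v Y).
have := nrm_sqr v Y; rewrite h.
have -> : expect v (0%ring : op B) = 0%ring by rewrite -(scale0r (0%ring : op B)) expectZ mul0r.
by have := nrm_ge0 v Y => /=; nra.
Qed.

(** [X] plays the part of a family of eigenvectors, its columns. It intertwines [0] with [H - q], so
    the group of [H - q] fixes it. *)
Lemma V_eigop (H X : op B) q s : (H * X = RC q *: X)%ring -> (V H s * X = cis (q * s) *: X)%ring.
Proof.
move=> h; rewrite (V_shift H q) mul_cstr opscaleAl; congr (_ *: _)%ring.
set K := (H - cst (RC q))%ring.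
have K0 : (X * 0 = K * X)%ring by rewrite mulr0 mulrBl mul_cst h subrr.
by have := V_intertwine s K0; rewrite V_zero mulr1 => /esym.
Qed.

Lemma V_integral_spectrum A : sa A -> spec_in_Z A -> V A (2 * PI) = 1%ring.
Proof.
move=> hA hZ; set E := V A (2 * PI); pose D := (E - 1)%ring.
have EA : (E * A = A * E)%ring by apply/esym/V_intertwine.
have DA : (D * A = A * D)%ring by rewrite mulrBl mulrBr EA mul1r mulr1.
have kernel Y : (D * Y = 0)%ring -> (adj D * Y = 0)%ring.
  rewrite /D mulrBl mul1r => /eqP; rewrite subr_eq0 => /eqP e.
  by rewrite adjB adj1 mulrBl mul1r -{1}e mulrA (V_isom _ hA) mul1r subrr.
have step P l : (P * A = A * P)%ring -> ((A - cst l) * (P * D) = 0)%ring -> (P * D = 0)%ring.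
  move=> PA h; set Y := (P * D)%ring in h *.
  have AY : (A * Y = l *: Y)%ring.
    by apply/eqP; rewrite -subr_eq0 -mul_cst -mulrBl h.
  have [//|Y0] := pselect (Y = 0%ring).
  have [z lz] : exists z, l = RC (IZR z).
    have [j hj] : exists j, exists i, Y i j <> C0.
      apply: contrapT => hn; apply: Y0; apply: opP => i j; apply: contrapT => hij.
      by apply: hn; exists j, i.
    apply: (hZ l (fun i => Y i j) hj) => i.
    exact: (congr1 (fun Z : op B => Z i j) AY).
  rewrite lz in AY; have := V_eigop (2 * PI) AY.
  rewrite cis_2PI_Z scale1r => EY; apply: adj_mul_eq0.
  have /kernel h2 : (D * Y = 0)%ring by rewrite mulrBl EY mul1r subrr.
  have PD : (P * D = D * P)%ring by rewrite /D mulrBr mulrBl mulr1 mul1r (V_intertwine _ PA).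
  by rewrite {1}/Y PD adjM -mulrA h2 mulr0.
have main ls P : (P * A = A * P)%ring -> ((\prod_(l <- ls) (A - cst l)) * (P * D) = 0)%ring -> (P * D = 0)%ring.
  elim: ls => [|l ls IH] PA; first by rewrite big_nil mul1r.
  rewrite big_cons -mulrA [in X in (_ * X)%ring]mulrA => h; apply: IH => //; rewrite mulrA.
  apply: step h.
  suff e : ((\prod_(j <- ls) (A - cst j)) * A = A * \prod_(j <- ls) (A - cst j))%ring.
    by rewrite -mulrA PA mulrA e -mulrA.
  elim: ls => [|j ls IH]; first by rewrite !big_nil mul1r mulr1.
  by rewrite !big_cons -mulrA IH !mulrA; congr (_ * _)%ring; rewrite mulrBl mulrBr mul_cst mul_cstr.
have [ls hls] := annihilating_product A.
have := main ls 1%ring; rewrite mulr1 !mul1r hls mul0r => /(_ erefl erefl) /eqP.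
by rewrite subr_eq0 => /eqP.
Qed.

End Integrality.

(** * Approximate eigenvectors *)

Section States.
Variable B : finType.
Variable psi : vec B.
Hypothesis psi1 : vnorm psi = 1.
Implicit Types (A X Y Z W : op B).
Local Notation w := (expect psi).
Local Notation n := (nrm psi).

Lemma psi_le1 : vnorm psi <= 1. Proof. lra. Qed.
Lemma expect_mul_le X Y x y : n (adj X) <= x -> n Y <= y -> Cnorm (w (X * Y)%ring) <= x * y.
Proof.
move=> hx hy; rewrite -{1}(adjK X); apply: Rle_trans (expect_cauchy_schwarz _ _ _) _.
by apply: Rmult_le_compat => //; exact: nrm_ge0.
Qed.
Lemma nrm_mul_le X Y x y : opnorm X <= x -> n Y <= y -> n (X * Y)%ring <= x * y.
Proof.
move=> hx hy; apply: Rle_trans (nrm_mul _ _ _) _.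
by apply: Rmult_le_compat => //; [exact: opnorm_ge0 | exact: nrm_ge0].
Qed.
Lemma expect_opnorm_le X x : opnorm X <= x -> Cnorm (w X) <= x.
Proof. by move=> h; apply: Rle_trans (expect_le_opnorm _ psi_le1) h. Qed.
Lemma nrm_opnorm_le X x : opnorm X <= x -> n X <= x.
Proof. by move=> h; apply: Rle_trans (nrm_le_opnorm _ psi_le1) h. Qed.

(** The hypothesis gives [|<W>| >= 1 - e], so the variance [1 - |<W>|^2] is at most [2 e]. Passing
    from variance to norm costs the square root that appears in the final estimate. *)
Lemma approx_eig_of_expect W c e : isom W -> Cnorm c <= 1 -> Cnorm (w W * c - 1)%ring <= e ->
  n (W - cst (w W))%ring <= sqrt (2 * e).
Proof.
move=> hW hc he.
have nW : n W = 1 by rewrite -[W]mulr1 nrm_isom // nrm1.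
have h1 : 1 - e <= Cnorm (w W).
  have := CnormB (w W * c)%ring (w W * c - 1)%ring; rewrite opprB addrCA subrr addr0 Cnorm1 CnormM.
  by have := Cnorm_ge0 (w W); nra.
have h2 : Cnorm (w W) <= 1 by rewrite -nW; exact: expect_le_nrm psi_le1.
have := nrm_sub_expect W psi1; rewrite nW => h3.
have := nrm_ge0 psi (W - cst (w W))%ring; set y := n _ in h3 * => y0.
rewrite -(sqrt_square y) //; apply: sqrt_le_1_alt; rewrite h3.
by have := Cnorm_ge0 (w W); nra.
Qed.

(** On a joint approximate eigenvector of [U] and [adj W] the eigenvalues commute, so [U adj W] and
    [adj W U] nearly agree there. *)
Lemma commutator_expect U W u c k e : isom U -> isom W -> isom (adj W) ->
  Cnorm u <= 1 -> Cnorm c <= 1 ->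
  n (U - cst u)%ring <= e -> n (adj W - cst c)%ring <= k ->
  Cnorm (w (adj U * W * U * adj W) - 1)%ring <= 2 * k + 2 * e.
Proof.
move=> hU hW hW' hu hc he hk; rewrite /isom adjK in hW'.
(* The commutator of [U] with [adj W], written so that each term acts on [psi] through one of the
   two small defects. *)
set X := (U * (adj W - cst c) - adj W * (U - cst u) + c *: (U - cst u) - u *: (adj W - cst c))%ring.
have hX : n X <= 2 * k + 2 * e.
  have h1 := nrm_mul_le (opnorm_isom hU) hk.
  have h2 : n (adj W * (U - cst u))%ring <= 1 * e.
    by apply: nrm_mul_le he; rewrite opnorm_adj; exact: opnorm_isom.
  have h3 : n (c *: (U - cst u))%ring <= 1 * e.
    by rewrite nrmZ; apply: Rmult_le_compat => //; [exact: Cnorm_ge0 | exact: nrm_ge0].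
  have h4 : n (u *: (adj W - cst c))%ring <= 1 * k.
    by rewrite nrmZ; apply: Rmult_le_compat => //; [exact: Cnorm_ge0 | exact: nrm_ge0].
  rewrite -nrmN in h2; rewrite -nrmN in h4.
  by apply: Rle_trans (nrmD_le (nrmD_le (nrmD_le h1 h2) h3) h4) _; lra.
have EX : X = (U * adj W - adj W * U)%ring.
  rewrite /X mulrBr mulrBr !mul_cstr.
  by move: (U * adj W)%ring => P; move: (adj W * U)%ring => Q; move: (adj W) => W'; rewrite /cst; oplin.
have -> : (w (adj U * W * U * adj W) - 1)%ring = w (adj (adj W * U) * X)%ring.
  have e1 : w (1%ring : op B) = 1%ring by rewrite -(cst1 B) expect_cst.
  rewrite -{1}e1 -expectB; congr expect.
  by rewrite EX adjM adjK mulrBr !mulrA -(mulrA (adj U) W (adj W)) hW' mulr1 hU.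
apply: Rle_trans (expect_cauchy_schwarz _ _ _) _.
suff -> : n (adj W * U)%ring = 1 by lra.
rewrite nrm_isom; last by rewrite /isom adjK.
by rewrite -[U]mulr1 nrm_isom // nrm1.
Qed.

Lemma conj_expect_approx Y X c a e : isom Y -> Cnorm c = 1 -> opnorm X <= a ->
  n (Y - cst c)%ring <= e -> Cnorm (w (adj Y * X * Y) - w X)%ring <= 2 * e * a.
Proof.
move=> hY hc hX he.
have E : (adj Y * X * Y - X = adj Y * (X * (Y - cst c)) + adj (Y - cst c) * (c *: X))%ring.
  rewrite mulrBr mulrBr adjB adj_cst mulrBl mul_cstr mul_cst !opscaleAr scalerA.
  have -> : (Cconj c * c)%ring = 1%ring.
    have := Cnorm_sqr c; rewrite hc => h; apply: CplxP => /=; lra.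
  by rewrite scale1r addrA subrK mulrA.
rewrite -expectB E expectD.
have nY : n Y <= 1 by apply: nrm_opnorm_le; exact: opnorm_isom.
have h1 : Cnorm (w (adj Y * (X * (Y - cst c)))%ring) <= 1 * (a * e).
  by apply: expect_mul_le; [rewrite adjK | exact: nrm_mul_le].
have h2 : Cnorm (w (adj (Y - cst c) * (c *: X))%ring) <= e * a.
  by apply: expect_mul_le; [rewrite adjK | rewrite nrmZ hc Rmult_1_l; exact: nrm_opnorm_le].
by apply: Rle_trans (CnormD_le h1 h2) _; lra.
Qed.

(** Unlike in [conj_expect_approx], the approximate eigenvalue [<U>] need not have modulus one. Its
    defect [1 - |<U>|^2] is the square of a number that is at most one and at most [e], hence at
    most [e]; this is the third [e] in the bound. *)
Lemma conj_expect_unitary U X a e : isom U -> opnorm X <= a -> n (U - cst (w U))%ring <= e ->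
  Cnorm (w (adj U * X * U) - w X)%ring <= 3 * e * a.
Proof.
move=> hU hX he; set u := w U in he *.
have nU : n U = 1 by rewrite -[U]mulr1 nrm_isom // nrm1.
have u1 : Cnorm u <= 1 by rewrite -nU; exact: expect_le_nrm psi_le1.
have a0 : 0 <= a by apply: Rle_trans (opnorm_ge0 X) hX.
have h3 := nrm_sub_expect U psi1; rewrite nU -/u in h3.
have e0 := nrm_ge0 psi (U - cst u)%ring.
have hu : 1 - Cnorm u * Cnorm u <= e by have := Cnorm_ge0 u; nra.
have E : (adj U * X * U - X = adj U * (X * (U - cst u)) + adj (U - cst u) * (u *: X)
    - (RC (1 - Cnorm u * Cnorm u)) *: X)%ring.
  have -> : (adj U * (X * (U - cst u)) = adj U * X * U - u *: (adj U * X))%ring.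
    by rewrite !mulrBr mul_cstr opscaleAr !mulrA.
  have -> : (adj (U - cst u) * (u *: X) = u *: (adj U * X) - (RC (Cnorm u * Cnorm u)) *: X)%ring.
    rewrite adjB adj_cst mulrBl opscaleAr mul_cst scalerA; congr (_ - _ *: _)%ring.
    by rewrite Cnorm_sqr; apply: CplxP => /=; ring.
  by move: (adj U * X * U)%ring => P; move: (adj U * X)%ring => Q; oplin.
rewrite -expectB E expectB expectD.
have h1 : Cnorm (w (adj U * (X * (U - cst u)))%ring) <= 1 * (a * e).
  by apply: expect_mul_le; [rewrite adjK; lra | exact: nrm_mul_le].
have h2 : Cnorm (w (adj (U - cst u) * (u *: X))%ring) <= e * a.
  apply: expect_mul_le; first by rewrite adjK.
  rewrite nrmZ; have := nrm_opnorm_le hX; have := nrm_ge0 psi X; have := Cnorm_ge0 u; nra.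
have h4 : Cnorm (w (RC (1 - Cnorm u * Cnorm u) *: X)%ring) <= e * a.
  rewrite expectZ CnormM Cnorm_RC; have := expect_opnorm_le hX; have := Cnorm_ge0 (w X).
  have := Cnorm_ge0 u => ? ? ?; rewrite Rabs_pos_eq; last nra.
  by apply: Rmult_le_compat => //; nra.
by apply: Rle_trans (CnormB_le (CnormD_le h1 h2) h4) _; lra.
Qed.

End States.

(** * The estimate at fixed size *)

Lemma cis_lipschitz x y : Cnorm (cis x - cis y)%ring <= 2 * Rabs (x - y).
Proof.
have -> : (cis x - cis y = cis y * (cis (x - y) - 1))%ring.
  by rewrite mulrBr mulr1 -cisD; congr (cis _ - _)%ring; ring.
rewrite CnormM Cnorm_cis Rmult_1_l; move: (x - y) => z.
have a0 := Rabs_pos z; apply: Cnorm_le; first lra.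
have hz : Rabs z * Rabs z = z * z by rewrite -Rabs_mult Rabs_pos_eq; nra.
have := cos_taylor z; have := sin2_cos2 z; rewrite /Rsqr => h1 h2.
have := Rle_abs (- (cos z - 1)); rewrite Rabs_Ropp => h3 /=.
by nra.
Qed.

Section Core.
Variables (B : finType) (psi : vec B) (U : op B).
Hypotheses (psi1 : vnorm psi = 1) (U1 : (adj U * U = 1)%ring) (U2 : (U * adj U = 1)%ring).
Implicit Types (H G X Y Z W : op B).
(** Abstract supports: [L1] for [S_-], [L2] for [S_+], [L0] for the sites off both strips. The
    charge is split accordingly as [q1 + q0 + q2]; [t1], [t2] are [T_-], [T_+]; [k1], [k2] are
    [K_-], [K_+]; and [r1], [r2] are local approximations of their conjugates by [U]. All errors are
    collected in [e], the norm bounds in [a]. *)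
Variables L1 L0 L2 : op B -> Prop.
Hypothesis L1D : forall X Y, L1 X -> L1 Y -> L1 (X + Y)%ring.
Hypothesis L1B : forall X Y, L1 X -> L1 Y -> L1 (X - Y)%ring.
Hypothesis L2D : forall X Y, L2 X -> L2 Y -> L2 (X + Y)%ring.
Hypothesis L2B : forall X Y, L2 X -> L2 Y -> L2 (X - Y)%ring.
Hypothesis C12 : forall X Y, L1 X -> L2 Y -> (X * Y = Y * X)%ring.
Hypothesis C10 : forall X Y, L1 X -> L0 Y -> (X * Y = Y * X)%ring.
Hypothesis C20 : forall X Y, L2 X -> L0 Y -> (X * Y = Y * X)%ring.
Variables q1 q0 q2 t1 t2 k1 k2 r1 r2 : op B.
Hypotheses (sq1 : sa q1) (sq0 : sa q0) (sq2 : sa q2) (st1 : sa t1) (st2 : sa t2)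
  (sk1 : sa k1) (sk2 : sa k2) (sr1 : sa r1) (sr2 : sa r2).
Hypotheses (lq1 : L1 q1) (lt1 : L1 t1) (lk1 : L1 k1) (lr1 : L1 r1) (lq0 : L0 q0)
  (lq2 : L2 q2) (lt2 : L2 t2) (lk2 : L2 k2) (lr2 : L2 r2).
Variables (a e : R).
Hypothesis e0 : 0 <= e.
Local Notation w := (expect psi).
Local Notation n := (nrm psi).
Let Q : op B := (q1 + q0 + q2)%ring.
Let Qb : op B := (Q - k1 - k2)%ring.
Hypothesis hT : opnorm (adj U * Q * U - Q - t1 - t2)%ring <= e.
Hypothesis hU : n (U - cst (w U))%ring <= e.
Hypothesis hQ : n (Qb - cst (w Qb))%ring <= e.
Hypothesis hR1 : opnorm (adj U * k1 * U - r1)%ring <= e.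
Hypothesis hR2 : opnorm (adj U * k2 * U - r2)%ring <= e.
Hypothesis hE : opnorm (V (Q + t1)%ring (2 * PI) - 1)%ring <= e.
Hypotheses (z1 : V q1 (2 * PI) = 1%ring) (z0 : V q0 (2 * PI) = 1%ring)
  (z2 : V q2 (2 * PI) = 1%ring).
Hypotheses (na1 : opnorm t1 <= a) (na2 : opnorm k1 <= a) (na3 : opnorm r1 <= a).
(** Clustering and almost locality are only asked for exponentials: their norms are at most one,
    whereas their generators contain charges without a uniform bound. *)
Hypothesis Hcl : forall H H' G G' s t, L1 H -> L1 H' -> L2 G -> L2 G' ->
  sa H -> sa H' -> sa G -> sa G' ->
  Cnorm (w ((V H s * V H' t) * (V G s * V G' t)) - w (V H s * V H' t) * w (V G s * V G' t))%ring <= e.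
Hypothesis Hlc : forall H s, L1 H -> sa H ->
  opnorm ((adj U * V H s * U) * t2 - t2 * (adj U * V H s * U))%ring <= e.

(** [A1] and [B1] are the strip versions of [Q + T_- - adj U K_- U] and [Q - K_-]. Dropping
    [q0 + q2] from both does not change [Zm], since these commute with everything in the strip and
    cancel. *)
Let A1 : op B := (q1 + t1 - r1)%ring.
Let B1 : op B := (q1 - k1)%ring.
Let A2 : op B := (q2 + t2 - r2)%ring.
Let B2 : op B := (q2 - k2)%ring.

Let lA1 : L1 A1. Proof. by apply: L1B => //; apply: L1D. Qed.
Let lB1 : L1 B1. Proof. exact: L1B. Qed.
Let lA2 : L2 A2. Proof. by apply: L2B => //; apply: L2D. Qed.
Let lB2 : L2 B2. Proof. exact: L2B. Qed.
Let sA1 : sa A1. Proof. by apply: saB => //; apply: saD. Qed.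
Let sB1 : sa B1. Proof. exact: saB. Qed.
Let sA2 : sa A2. Proof. by apply: saB => //; apply: saD. Qed.
Let sB2 : sa B2. Proof. exact: saB. Qed.
Let sQ : sa Q. Proof. by apply: saD => //; apply: saD. Qed.
Let sQb : sa Qb. Proof. by apply: saB => //; apply: saB. Qed.

Let V3 (X0 X1 X2 : op B) s : L1 X1 -> L0 X0 -> L2 X2 ->
  V (X1 + X2 + X0)%ring s = (V X1 s * V X2 s * V X0 s)%ring.
Proof.
move=> h1 h0 h2; rewrite V_sum; last by rewrite mulrDl mulrDr (C10 h1 h0) (C20 h2 h0).
by rewrite V_sum // C12.
Qed.

Let QbE : Qb = (B1 + B2 + q0)%ring.
Proof. rewrite /Qb /B1 /B2 /Q; oplin. Qed.

Definition Zm s := (V A1 s * V B1 (- s))%ring.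
Definition Zp s := (V A2 s * V B2 (- s))%ring.
Let At : op B := (A1 + A2 + q0)%ring.

(** Factors of different strips commute, and [V q0 s] cancels against [V q0 (- s)]. *)
Let ZZ s : (Zm s * Zp s = V At s * V Qb (- s))%ring.
Proof.
rewrite QbE /At (V3 s lA1 lq0 lA2) (V3 (- s) lB1 lq0 lB2) /Zm /Zp.
have c1 : (V B1 (- s) * V A2 s = V A2 s * V B1 (- s))%ring by apply: V_comm; exact: C12.
have c2 : (V B1 (- s) * V q0 s = V q0 s * V B1 (- s))%ring by apply: V_comm; exact: C10.
have c3 : (V B2 (- s) * V q0 s = V q0 s * V B2 (- s))%ring by apply: V_comm; exact: C20.
rewrite -(mulrA (V A1 s)) (mulrA (V B1 (- s))) c1 -!mulrA.
rewrite (mulrA (V q0 s)) -c2 -!mulrA (mulrA (V q0 s) (V B2 (- s))) -c3 -!mulrA.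
by rewrite V_invr mulr1.
Qed.

Let qv := Re (w Qb).
Let hq : n (Qb - cst (RC qv))%ring <= e.
Proof. by rewrite /qv -expect_selfadj //; apply/selfadjP. Qed.

Let nU : n U = 1. Proof. by rewrite -[U]mulr1 nrm_isom // nrm1. Qed.
Let u_le1 : Cnorm (w U) <= 1.
Proof. by rewrite -nU; apply: expect_le_nrm; lra. Qed.

Let V_isom' H s : sa H -> isom (adj (V H s)).
Proof. by move=> h; rewrite V_adj //; exact: V_isom. Qed.

(** [At] differs from [adj U * Qb * U] by three errors, from [r1], [r2] and [T], which gives
    [3 e s]; the commutator of [U] with the group of [Qb] on [psi] gives [2 e s + 2 e]. *)
Let cZZ s : 0 <= s -> Cnorm (w (Zm s * Zp s) - 1)%ring <= (5 * s + 2) * e.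
Proof.
move=> s0; rewrite ZZ.
have hA : opnorm (At - adj U * Qb * U)%ring <= e + e + e.
  have -> : (At - adj U * Qb * U = (adj U * k1 * U - r1) + (adj U * k2 * U - r2)
      - (adj U * Q * U - Q - t1 - t2))%ring.
    have -> : (adj U * Qb * U = adj U * Q * U - adj U * k1 * U - adj U * k2 * U)%ring.
      by rewrite /Qb !mulrBr !mulrBl.
    move: (adj U * Q * U)%ring => X; move: (adj U * k1 * U)%ring => Y.
    by move: (adj U * k2 * U)%ring => Z; rewrite /At /A1 /A2 /Q; oplin.
  exact: opnormB_le (opnormD_le hR1 hR2) hT.
have sAt : sa At by rewrite /At; apply: saD => //; exact: saD.
have h1 := V_duhamel sAt (sa_conj U sQb) s0; rewrite -V_conj // in h1.
have h2 : Cnorm (w (adj U * V Qb s * U * adj (V Qb s)) - 1)%ring <= 2 * (e * s) + 2 * e.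
  apply: (commutator_expect psi1 (u := w U) (c := cis (- (qv * s)))) => //; try exact: V_isom.
  - exact: V_isom'.
  - by rewrite Cnorm_cis; lra.
  - by rewrite V_adj //; exact: V_eigN.
rewrite V_adj // in h2.
have h3 : Cnorm (w (V At s * V Qb (- s)) - w (adj U * V Qb s * U * V Qb (- s)))%ring <= (e + e + e) * s.
  rewrite -expectB -mulrBl; apply: expect_opnorm_le => //.
  apply: Rle_trans (opnorm_mulr_le1 _ (opnorm_V _ sQb)) _.
  by apply: Rle_trans h1 _; apply: Rmult_le_compat_r.
by apply: Rle_trans (Cnorm_sub_tri _ _ _) _; apply: Rle_trans (Rplus_le_compat _ _ _ _ h3 h2) _; lra.
Qed.

Let unitV2 (H H' : op B) s t : sa H -> sa H' -> isom (V H s * V H' t)%ring.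
Proof.
by move=> h h'; rewrite /isom adjM -mulrA (mulrA (adj (V H s))) (V_isom s h) mul1r V_isom.
Qed.
Let unitV2' (H H' : op B) s t : sa H -> sa H' -> isom (adj (V H s * V H' t))%ring.
Proof. by move=> h h'; rewrite adjM !V_adj //; exact: unitV2. Qed.
Let expectV2_le1 (H H' : op B) s t : sa H -> sa H' -> Cnorm (w (V H s * V H' t)%ring) <= 1.
Proof. by move=> h h'; apply: expect_opnorm_le => //; apply/opnorm_isom/unitV2. Qed.

(* Clustering splits the expectation of the product, and a product of two numbers of
   modulus at most one can only be close to a phase if both are. *)
Let split_eig (H H' G G' : op B) s t c x : L1 H -> L1 H' -> L2 G -> L2 G' ->
  sa H -> sa H' -> sa G -> sa G' -> Cnorm c = 1 ->
  Cnorm (w ((V H s * V H' t) * (V G s * V G' t)) - c)%ring <= x ->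
  n (adj (V H s * V H' t) - cst (Cconj (w (V H s * V H' t))))%ring <= sqrt (2 * (x + e)).
Proof.
move=> l1 l1' l2 l2' s1 s1' s2 s2' hc hx.
set Z := (V H s * V H' t)%ring in hx *; set Y := (V G s * V G' t)%ring in hx *.
have hcl : Cnorm (w (Z * Y) - w Z * w Y)%ring <= e by exact: Hcl.
have h1 : Cnorm (w Z * w Y - c)%ring <= x + e.
  rewrite Rplus_comm; apply: Rle_trans (Cnorm_sub_tri _ (w (Z * Y))%ring _) _.
  by apply: Rplus_le_compat; [rewrite Cnorm_sub | exact: hx].
have cc : (c * Cconj c)%ring = 1%ring.
  by have := Cnorm_sqr c; rewrite hc => h; apply: CplxP => /=; lra.
rewrite -expect_adj; apply: (approx_eig_of_expect psi1 (c := Cconj (w Y) * c)%ring).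
- exact: unitV2'.
- by rewrite CnormM Cnorm_conj hc Rmult_1_r; exact: expectV2_le1.
rewrite expect_adj mulrA -CconjM.
have -> : (Cconj (w Z * w Y) * c - 1 = Cconj (w Z * w Y - c) * c)%ring.
  have -> : (Cconj (w Z * w Y - c) = Cconj (w Z * w Y) - Cconj c)%ring by apply: CplxP => /=; ring.
  by rewrite mulrBl [(Cconj c * c)%ring]mulrC cc.
by rewrite CnormM Cnorm_conj hc Rmult_1_r.
Qed.

(** With [2 PI <= 8] the bound of [cZZ] is at most [42 e]; adding the clustering error and doubling,
    as [split_eig] does, gives [86 e]. *)
Let kap := sqrt (86 * e).
Let kap0 : 0 <= kap. Proof. exact: sqrt_pos. Qed.
Let PI4 : PI <= 4. Proof. exact: PI_4. Qed.
Let PI0 : 0 < PI. Proof. exact: PI_RGT_0. Qed.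

Let Zm_eig s : 0 <= s <= 2 * PI -> n (adj (Zm s) - cst (Cconj (w (Zm s))))%ring <= kap.
Proof.
move=> [s0 s1]; apply: Rle_trans (split_eig lA1 lB1 lA2 lB2 _ _ _ _ Cnorm1 (cZZ s0)) _ => //.
by apply: sqrt_le_1_alt; nra.
Qed.

(** The charge cancels in this difference, which is [t1 - r1 + k1]: up to the factor [i], it is the
    generator seen in the derivative of [Zm], and it is bounded although [A1] and [B1] are not. *)
Let X1 : op B := (A1 - B1)%ring.
Let lX1 : L1 X1. Proof. exact: L1B. Qed.
Let sX1 : sa X1. Proof. exact: saB. Qed.
Let nX1 : opnorm X1 <= 3 * a.
Proof.
have -> : X1 = (t1 - r1 + k1)%ring by rewrite /X1 /A1 /B1; oplin.
by apply: Rle_trans (opnormD_le (opnormB_le na1 na3) na2) _; lra.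
Qed.
Let a0 : 0 <= a. Proof. by apply: Rle_trans (opnorm_ge0 t1) na1. Qed.
Let tau := Re (w X1).
Let tauE : w X1 = RC tau. Proof. by apply: expect_selfadj; apply/selfadjP. Qed.

(** The operator is [Zm s * Y] with [Y] a conjugate of [X1]. As [psi] is an approximate eigenvector
    of [adj (Zm s)], the expectation splits at the cost of [kap], and [<Y>] is close to [tau]; the
    summand [16 e] is [2 e s] with [s <= 8]. *)
Let dZ s : 0 <= s <= 2 * PI ->
  Cnorm (w (V A1 s * X1 * V B1 (- s)) - w (Zm s) * RC tau)%ring <= (kap + 16 * e) * (3 * a).
Proof.
move=> hs; have [s0 s1] := hs.
set Y := (V B1 s * X1 * V B1 (- s))%ring.
have -> : (V A1 s * X1 * V B1 (- s) = Zm s * Y)%ring.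
  by rewrite /Y /Zm !mulrA -(mulrA _ (V B1 (- s)) (V B1 s)) V_inv mulr1.
have hY : opnorm Y <= 3 * a.
  apply: Rle_trans (opnorm_mulr_le1 _ (opnorm_V _ sB1)) _.
  exact: Rle_trans (opnorm_mul_le1 _ (opnorm_V _ sB1)) nX1.
have h1 : Cnorm (w (Zm s * Y) - w (Zm s) * w Y)%ring <= kap * (3 * a).
  rewrite -expectZ -mul_cst -expectB -mulrBl; apply: expect_mul_le.
    by rewrite adjB adj_cst; exact: Zm_eig.
  exact: nrm_opnorm_le.
(* Since [B2 + q0] commutes with [B1] and [X1], conjugation by the group of [B1] is conjugation by
   that of [Qb], of which [psi] is an approximate eigenvector. *)
have YE : Y = (adj (V Qb (- s)) * X1 * V Qb (- s))%ring.
  rewrite V_adj // Ropp_involutive.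
  have -> : Qb = (B1 + (B2 + q0))%ring by rewrite QbE; exact: (esym (addrA B1 B2 q0)).
  have cG Z : L1 Z -> (Z * (B2 + q0) = (B2 + q0) * Z)%ring.
    by move=> lZ; rewrite mulrDr mulrDl (C12 lZ lB2) (C10 lZ lq0).
  set G := (B2 + q0)%ring in cG *.
  rewrite (V_sum s (cG _ lB1)) (V_sum (- s) (cG _ lB1)) (V_comm (- s) (- s) (cG _ lB1)).
  rewrite !mulrA -(mulrA (V B1 s * V G s)%ring X1 (V G (- s))) (V_intertwine (- s) (cG _ lX1)).
  by rewrite !mulrA -(mulrA (V B1 s) (V G s) (V G (- s))) V_invr mulr1.
have h2 : Cnorm (w Y - RC tau)%ring <= 2 * (e * s) * (3 * a).
  rewrite -tauE YE; apply: (conj_expect_approx psi1 (c := cis (- (qv * s)))) => //.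
  - exact: V_isom.
  - exact: Cnorm_cis.
  - exact: V_eigN.
have h3 : Cnorm (w (Zm s) * w Y - w (Zm s) * RC tau)%ring <= 2 * (e * s) * (3 * a).
  rewrite -mulrBr CnormM -[X in _ <= X]Rmult_1_l.
  by apply: Rmult_le_compat => //; [exact: Cnorm_ge0 | exact: Cnorm_ge0 | exact: expectV2_le1].
apply: Rle_trans (Cnorm_sub_tri _ _ _) _; apply: Rle_trans (Rplus_le_compat _ _ _ _ h1 h3) _.
have : e * s <= e * 8 by apply: Rmult_le_compat_l; lra.
by move=> es; nra.
Qed.

Let z_phase : Cnorm (w (Zm (2 * PI)) - cis (tau * (2 * PI)))%ring <= (kap + 16 * e) * (3 * a) * (2 * PI).
Proof.
set K := (kap + 16 * e) * (3 * a).
have sB1' := saN sB1.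
have [M [M0 hM]] := V_prod_taylor sA1 sB1'.
(* Removing the expected phase [tau s] turns [z' = i tau z] into a small derivative for [f]. *)
pose f s := (w (Zm s) * cis (- (tau * s)))%ring.
pose D s t := Cnorm (f t - f s)%ring.
have : D 0 (2 * PI) <= K * (2 * PI).
  apply: (@increments_bound D _ (M + 3 * (tau * tau)) (2 * PI)).
  - by move=> x y z; rewrite Rplus_comm; exact: Cnorm_sub_tri.
  - by rewrite /D subrr Cnorm0; lra.
  - by lra.
  move=> s h s0 [h0 h1] hs.
  have hss : 0 <= s <= 2 * PI by lra.
  set z := w (Zm s).
  have -> : D s (s + h) = Cnorm (w (Zm (s + h)) - z * cis (tau * h))%ring.
    rewrite /D /f -/z.
    have -> : (w (Zm (s + h)) * cis (- (tau * (s + h))) - z * cis (- (tau * s))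
        = (w (Zm (s + h)) - z * cis (tau * h)) * cis (- (tau * (s + h))))%ring.
      rewrite mulrBl -mulrA -cisD; congr (_ - _ * cis _)%ring; ring.
    by rewrite CnormM Cnorm_cis Rmult_1_r.
  set P := (V A1 h * V (- B1) h - (1 + iR h *: (A1 - B1)))%ring.
  have ZE : Zm (s + h) = (V A1 s * P * V B1 (- s) + Zm s + iR h *: (V A1 s * X1 * V B1 (- s)))%ring.
    rewrite /Zm; have -> : - (s + h) = - h + - s by ring.
    rewrite !VD /P V_opp /X1.
    set T := (A1 - B1)%ring.
    have -> : (V A1 s * (V A1 h * V B1 (- h) - (1 + iR h *: T)) * V B1 (- s)
      = V A1 s * V A1 h * (V B1 (- h) * V B1 (- s))
        - (V A1 s * V B1 (- s) + iR h *: (V A1 s * T * V B1 (- s))))%ring.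
      by rewrite mulrBr mulrBl mulrDr mulr1 mulrDl opscaleAr opscaleAl !mulrA.
    move: (V A1 s * V A1 h * (V B1 (- h) * V B1 (- s)))%ring => R1.
    by move: (V A1 s * V B1 (- s))%ring => R2; move: (V A1 s * T * V B1 (- s))%ring => R3; oplin.
  have -> : (w (Zm (s + h)) - z * cis (tau * h) = w (V A1 s * P * V B1 (- s))
      + iR h * (w (V A1 s * X1 * V B1 (- s)) - z * RC tau)
      - z * (cis (tau * h) - (1 + iR (tau * h))))%ring.
    rewrite ZE !expectD expectZ -/z.
    by apply: CplxP => /=; ring.
  have b1 : Cnorm (w (V A1 s * P * V B1 (- s))%ring) <= M * (h * h).
    apply: expect_opnorm_le => //.
    apply: Rle_trans (opnorm_mulr_le1 _ (opnorm_V _ sB1)) _.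
    exact: Rle_trans (opnorm_mul_le1 _ (opnorm_V _ sA1)) (hM h (conj h0 h1)).
  have b2 : Cnorm (iR h * (w (V A1 s * X1 * V B1 (- s)) - z * RC tau))%ring <= h * K.
    rewrite CnormM Cnorm_iR Rabs_pos_eq //; apply: Rmult_le_compat_l => //; exact: dZ.
  have b3 : Cnorm (z * (cis (tau * h) - (1 + iR (tau * h))))%ring <= 3 * (tau * h * (tau * h)).
    rewrite CnormM; have := expectV2_le1 s (- s) sA1 sB1; rewrite -/(Zm s) -/z.
    have := cis_taylor (tau * h); have := Cnorm_ge0 z.
    by have := Cnorm_ge0 (cis (tau * h) - (1 + iR (tau * h)))%ring; nra.
  by apply: Rle_trans (CnormB_le (CnormD_le b1 b2) b3) _; right; ring.
have f0 : f 0 = 1%ring.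
  rewrite /f /Zm Ropp_0 !V0 mulr1 Rmult_0_r Ropp_0 cis0 mulr1.
  by rewrite -(cst1 B) expect_cst.
rewrite /D f0 /f; set zz := w _.
have -> : (zz * cis (- (tau * (2 * PI))) - 1 = (zz - cis (tau * (2 * PI))) * cis (- (tau * (2 * PI))))%ring.
  by rewrite mulrBl [(cis (tau * _) * _)%ring]mulrC cisN.
by rewrite CnormM Cnorm_cis Rmult_1_r.
Qed.

(** Chosen so that [Q + t1] is close to [adj U * q1 * U + Bp] and [A1 + q2 + q0] is close to
    [adj U * B1 * U + Bp]. *)
Let Bp : op B := (adj U * (q0 + q2) * U - t2)%ring.
Let sBp : sa Bp. Proof. by apply: saB => //; apply: sa_conj; exact: saD. Qed.

(** The group of [adj U * H * U] commutes exactly with [adj U * (q0 + q2) * U], so only its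
    commutator with [t2] remains, and [Hlc] makes it small. This is what [V_bch] asks for. *)
Let bch_conj H : L1 H -> sa H ->
  opnorm (V (adj U * H * U + Bp)%ring (2 * PI) - (adj U * V H (2 * PI) * U) * V Bp (2 * PI))%ring <= 8 * e.
Proof.
move=> lH sH; rewrite V_conj //.
have h : forall s, 0 <= s <= 2 * PI ->
    opnorm (V (adj U * H * U) s * Bp - Bp * V (adj U * H * U) s)%ring <= e.
  move=> s _; rewrite -V_conj //; set W := (adj U * V H s * U)%ring.
  have -> : (W * Bp - Bp * W = - (W * t2 - t2 * W))%ring.
    have cW : (W * (adj U * (q0 + q2) * U) = adj U * (q0 + q2) * U * W)%ring.
      have c : (V H s * (q0 + q2) = (q0 + q2) * V H s)%ring.
        by apply/esym; apply: V_intertwine; rewrite mulrDr mulrDl (C10 lH lq0) (C12 lH lq2).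
      rewrite /W -!mulrA (mulrA U) U2 mul1r (mulrA U (adj U)) U2 mul1r.
      by rewrite (mulrA (V H s)) c !mulrA.
    have -> : (W * Bp = adj U * (q0 + q2) * U * W - W * t2)%ring by rewrite /Bp mulrBr cW.
    have -> : (Bp * W = adj U * (q0 + q2) * U * W - t2 * W)%ring by rewrite /Bp mulrBl.
    move: (adj U * (q0 + q2) * U * W)%ring => Y1; move: (W * t2)%ring => Y2.
    by move: (t2 * W)%ring => Y3; oplin.
  by rewrite opnormN; exact: Hlc.
have p0 : 0 <= 2 * PI by lra.
apply: Rle_trans (V_bch (sa_conj U sH) sBp p0 h) _; nra.
Qed.

Let V_pert (H H' : op B) x : sa H -> sa H' -> opnorm (H - H')%ring <= x ->
  opnorm (V H (2 * PI) - V H' (2 * PI))%ring <= 8 * x.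
Proof.
move=> sH sH' hx; have p0 : 0 <= 2 * PI by lra.
apply: Rle_trans (V_duhamel sH sH' p0) _; have := opnorm_ge0 (H - H')%ring; nra.
Qed.

(** [bch_conj] with [H = q1], whose exponential at [2 PI] is [1], compares [V Bp] with the
    exponential of [Q + t1], which is almost [1] by assumption: [8 e + 8 e + e]. *)
Let VBp : opnorm (V Bp (2 * PI) - 1)%ring <= 17 * e.
Proof.
have h1 := bch_conj lq1 sq1; rewrite z1 mulr1 U1 mul1r in h1.
have h2 : opnorm (V (adj U * q1 * U + Bp) (2 * PI) - V (Q + t1) (2 * PI))%ring <= 8 * e.
  apply: V_pert; [by apply: saD => //; exact: sa_conj | exact: saD |].
  suff -> : (adj U * q1 * U + Bp - (Q + t1) = adj U * Q * U - Q - t1 - t2)%ring by [].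
  have -> : (adj U * Q * U = adj U * q1 * U + adj U * (q0 + q2) * U)%ring.
    by rewrite -mulrDl -mulrDr /Q addrA.
  rewrite /Bp; move: (adj U * q1 * U)%ring => Y; move: (adj U * (q0 + q2) * U)%ring => Z; oplin.
apply: Rle_trans (opnorm_sub_tri _ (V (adj U * q1 * U + Bp) (2 * PI))%ring _) _.
rewrite [X in X + _]opnorm_sub.
have h3 := Rle_trans _ _ _ (opnorm_sub_tri _ _ _) (Rplus_le_compat _ _ _ _ h2 hE).
by apply: Rle_trans (Rplus_le_compat _ _ _ _ h1 h3) _; lra.
Qed.

(** [bch_conj] with [H = B1], after adding the integral charges [q2] and [q0] to [A1], which is free
    at [2 PI]; then [V Bp] is removed by [VBp]: [16 e + 8 e + 17 e]. *)
Let VA1 : opnorm (V A1 (2 * PI) - adj U * V B1 (2 * PI) * U)%ring <= 41 * e.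
Proof.
have h1 := bch_conj lB1 sB1.
have h2 : opnorm (V A1 (2 * PI) - V (adj U * B1 * U + Bp) (2 * PI))%ring <= 8 * (e + e).
  have -> : V A1 (2 * PI) = V (A1 + q2 + q0)%ring (2 * PI) by rewrite (V3 _ lA1 lq0 lq2) z2 z0 !mulr1.
  apply: V_pert; first by apply: saD => //; exact: saD.
    by apply: saD => //; exact: sa_conj.
  have -> : (A1 + q2 + q0 - (adj U * B1 * U + Bp)
      = (adj U * k1 * U - r1) - (adj U * Q * U - Q - t1 - t2))%ring.
    have -> : (adj U * Q * U = adj U * q1 * U + adj U * (q0 + q2) * U)%ring.
      by rewrite -mulrDl -mulrDr /Q addrA.
    have -> : (adj U * B1 * U = adj U * q1 * U - adj U * k1 * U)%ring.
      by rewrite -mulrBl -mulrBr.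
    rewrite /Bp /A1 /Q; move: (adj U * q1 * U)%ring => Y; move: (adj U * (q0 + q2) * U)%ring => Z.
    by move: (adj U * k1 * U)%ring => Y'; oplin.
  exact: opnormB_le hR1 hT.
set W := (adj U * V B1 (2 * PI) * U)%ring in h1 *.
have nW : opnorm W <= 1.
  apply: Rle_trans (opnorm_mulr_le1 _ (opnorm_isom U1)) _.
  apply: Rle_trans (opnorm_mul_le1 _ _) (opnorm_V _ sB1).
  by rewrite opnorm_adj; exact: opnorm_isom.
have h3 : opnorm (W * V Bp (2 * PI) - W)%ring <= 17 * e.
  have -> : (W * V Bp (2 * PI) - W = W * (V Bp (2 * PI) - 1))%ring by rewrite mulrBr mulr1.
  exact: Rle_trans (opnorm_mul_le1 _ nW) VBp.
have h4 := Rle_trans _ _ _ (opnorm_sub_tri _ _ _) (Rplus_le_compat _ _ _ _ h1 h3).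
apply: Rle_trans (opnorm_sub_tri _ _ _) _.
by apply: Rle_trans (Rplus_le_compat _ _ _ _ h2 h4) _; lra.
Qed.

Let W_eig : n (adj (V B1 (2 * PI)) - cst (Cconj (w (V B1 (2 * PI)))))%ring <= kap.
Proof.
have p0 : 0 <= 2 * PI by lra.
(* The factors at time [0] equal [1] and only bring the product into the shape of [split_eig]. At
   [2 PI] the charge [q0] disappears, so the product is the exponential of [Qb]. *)
have h : Cnorm (w ((V B1 (2 * PI) * V B1 0) * (V B2 (2 * PI) * V B2 0)) - cis (qv * (2 * PI)))%ring <= e * (2 * PI).
  rewrite !V0 !mulr1.
  have -> : (V B1 (2 * PI) * V B2 (2 * PI) = V Qb (2 * PI))%ring by rewrite QbE (V3 _ lB1 lq0 lB2) z0 mulr1.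
  rewrite -{1}(expect_cst (cis (qv * (2 * PI))) psi1) -expectB.
  apply: Rle_trans (expect_le_nrm _ _) _; first lra.
  exact: V_eig.
have := split_eig lB1 lB1 lB2 lB2 sB1 sB1 sB2 sB2 (Cnorm_cis _) h.
rewrite !V0 !mulr1 => h'; apply: Rle_trans h' _; apply: sqrt_le_1_alt; nra.
Qed.

Let z_one : Cnorm (w (Zm (2 * PI)) - 1)%ring <= 43 * e + 2 * kap.
Proof.
have h1 : Cnorm (w (Zm (2 * PI)) - w (adj U * V B1 (2 * PI) * U * adj (V B1 (2 * PI))))%ring <= 41 * e.
  rewrite V_adj // /Zm -expectB -mulrBl; apply: expect_opnorm_le => //.
  exact: Rle_trans (opnorm_mulr_le1 _ (opnorm_V _ sB1)) VA1.
have h2 : Cnorm (w (adj U * V B1 (2 * PI) * U * adj (V B1 (2 * PI))) - 1)%ring <= 2 * kap + 2 * e.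
  apply: (commutator_expect psi1 (u := w U) (c := Cconj (w (V B1 (2 * PI))))) => //.
  - exact: V_isom.
  - exact: V_isom'.
  - by rewrite Cnorm_conj; apply: expect_opnorm_le => //; exact: opnorm_V.
apply: Rle_trans (Cnorm_sub_tri _ _ _) _.
by apply: Rle_trans (Rplus_le_compat _ _ _ _ h1 h2) _; lra.
Qed.

(** The difference is [<k1 - r1>]; [r1] is close to [adj U * k1 * U], whose expectation is that of
    [k1] because [psi] is almost an eigenvector of [U]. *)
Let tau_t : Rabs (tau - Re (w t1)) <= 3 * e * a + e.
Proof.
have -> : tau - Re (w t1) = Re (w (k1 - r1))%ring.
  rewrite /tau; have -> : X1 = (t1 + (k1 - r1))%ring by rewrite /X1 /A1 /B1; oplin.
  by rewrite expectD /=; ring.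
apply: Rle_trans (Re_le_Cnorm _) _.
have -> : (k1 - r1 = - (adj U * k1 * U - k1) + (adj U * k1 * U - r1))%ring.
  by move: (adj U * k1 * U)%ring => Y; oplin.
rewrite expectD expectN; apply: CnormD_le; last exact: expect_opnorm_le.
by rewrite CnormN expectB; exact: conj_expect_unitary.
Qed.

Lemma core_estimate :
  Cnorm (cis (2 * PI * Re (w t1)) - 1)%ring <= 500 * (1 + a) * (e + sqrt e).
Proof.
set t := Re (w t1).
have h1 : Cnorm (cis (2 * PI * t) - cis (tau * (2 * PI)))%ring <= 16 * (3 * e * a + e).
  apply: Rle_trans (cis_lipschitz _ _) _.
  have -> : 2 * PI * t - tau * (2 * PI) = - (2 * PI) * (tau - t) by ring.
  rewrite Rabs_mult Rabs_Ropp Rabs_pos_eq; last lra.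
  by have := tau_t; rewrite -/t; have := Rabs_pos (tau - t); nra.
have h2 := z_phase; rewrite Cnorm_sub in h2.
have h3 := z_one.
have s0 := sqrt_pos e.
have hk : kap <= 10 * sqrt e.
  rewrite /kap sqrt_mult_alt; last lra.
  apply: Rmult_le_compat_r => //; rewrite -(sqrt_square 10); last lra.
  by apply: sqrt_le_1_alt; lra.
have h4 := Rle_trans _ _ _ (Cnorm_sub_tri _ _ _) (Rplus_le_compat _ _ _ _ h2 h3).
apply: Rle_trans (Cnorm_sub_tri _ _ _) _.
apply: Rle_trans (Rplus_le_compat _ _ _ _ h1 h4) _.
(* The total is at most [432 a e + 240 a sqrt e + 59 e + 20 sqrt e], which explains the constant
   500. *)
have h5 : (kap + 16 * e) * (3 * a) * (2 * PI) <= (10 * sqrt e + 16 * e) * (3 * a) * 8.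
  apply: Rmult_le_compat; try lra.
    by apply: Rmult_le_pos; lra.
  by apply: Rmult_le_compat_r; lra.
have : 0 <= a * e by nra. have : 0 <= a * sqrt e by nra.
by nra.
Qed.

End Core.

(** * Locality *)

Section SpinLocality.
Variables d n L : nat.
Local Notation conf := {ffun site d L -> 'I_n}.
Implicit Types (X Y : {set site d L}) (A : op conf).

Lemma spin_loc_diag X A (s t : conf) : spin_loc X A -> A s t <> C0 ->
  forall y, y \notin X -> s y = t y.
Proof.
move=> [h _] hA y hy; apply: contrapT => hn; apply: hA; apply: h; by exists y.
Qed.

Definition patch X (s t : conf) : conf := [ffun y => if y \in X then s y else t y].

Lemma patch_in X s t y : y \in X -> patch X s t y = s y.
Proof. by rewrite ffunE => ->. Qed.
Lemma patch_out X s t y : y \notin X -> patch X s t y = t y.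
Proof. by rewrite ffunE => /negbTE ->. Qed.

Lemma spin_loc_id X : spin_loc X (1%ring : op conf).
Proof.
split=> [s t [y [_ hy]]|s t s' t' h1 h2]; rewrite -[1%ring]/(opid (B := _)) /opid.
  by case: eqP => // e; case: hy; rewrite e.
have -> // : (s == t) = (s' == t').
apply/eqP/eqP => e; apply/ffunP => y; case: (boolP (y \in X)) => hy.
- by have [<- <-] := h2 y hy; rewrite e.
- by have [_ ->] := h1 y hy.
- by have [-> ->] := h2 y hy; rewrite e.
- by have [-> _] := h1 y hy.
Qed.
Lemma spin_locD X A A' : spin_loc X A -> spin_loc X A' -> spin_loc X (A + A')%ring.
Proof.
move=> [h1 h2] [h1' h2']; split=> [s t hst|s t s' t' e1 e2].
  by rewrite -[(A + A')%ring s t]/(A s t + A' s t)%ring h1 // h1' //; exact: addr0.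
by rewrite -[LHS]/(A s t + A' s t)%ring (h2 _ _ _ _ e1 e2) (h2' _ _ _ _ e1 e2).
Qed.
Lemma spin_locZ X c A : spin_loc X A -> spin_loc X (c *: A)%ring.
Proof.
move=> [h1 h2]; split=> [s t hst|s t s' t' e1 e2].
  by rewrite -[(c *: A)%ring s t]/(c * A s t)%ring h1 //; exact: mulr0.
by rewrite -[LHS]/(c * A s t)%ring (h2 _ _ _ _ e1 e2).
Qed.
Lemma spin_loc_adj X A : spin_loc X A -> spin_loc X (adj A).
Proof.
move=> [h1 h2]; split=> [s t [y [hy hst]]|s t s' t' e1 e2]; rewrite /adj.
  by rewrite h1; [apply: CplxP => /=; ring | exists y; split=> // e; apply: hst].
rewrite (h2 t s t' s') // => y hy; first by have [-> ->] := e1 y hy.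
by have [-> ->] := e2 y hy.
Qed.
Lemma spin_loc_mono X Y A : X \subset Y -> spin_loc X A -> spin_loc Y A.
Proof.
move=> /subsetP XY [h1 h2]; have out y : y \notin Y -> y \notin X by apply: contra => /XY.
split=> [s t [y [hy hst]]|s t s' t' e1 e2]; first by apply: h1; exists y; split=> //; exact: out.
(* If [s] and [t] differ somewhere in [Y] off [X], so do [s'] and [t'], and both entries vanish;
   otherwise the rule for [X] applies. *)
have [[y [hy [hyX hst]]]|hn] := pselect (exists y, y \in Y /\ y \notin X /\ s y <> t y).
  rewrite h1; last by exists y.
  by rewrite h1 //; exists y; split=> //; have [<- <-] := e2 y hy.
have eqst y : y \notin X -> s y = t y /\ s' y = t' y.
  move=> hy; case: (boolP (y \in Y)) => hyY; last exact: e1.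
  have e : s y = t y by apply: contrapT => ne; apply: hn; exists y.
  by have [<- <-] := e2 y hyY.
by apply: h2 => // y /XY; exact: e2.
Qed.

(** Only intermediate configurations agreeing with the outer one off [X] contribute, so the sum runs
    over configurations on [X]; replacing their part off [X] from [s] to [s'] is a bijection that
    keeps the entries. *)
Lemma spin_locM X A A' : spin_loc X A -> spin_loc X A' -> spin_loc X (A * A')%ring.
Proof.
move=> hA hA'; have [h1 h2] := hA; have [h1' h2'] := hA'.
split=> [s t [y [hy hst]]|s t s' t' e1 e2].
  rewrite -[(A * A')%ring]/(opmul A A') opmulEij big1 // => u _.
  have [e|ne] := pselect (s y = u y); last by rewrite h1 ?mul0r //; exists y.
  by rewrite (h1' u t) ?mulr0 //; exists y; split=> //; rewrite -e.
rewrite -[(A * A')%ring]/(opmul A A') !opmulEij.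
have restrict (a b : conf) : (\sum_k A a k * A' k b = \sum_(k | patch X k a == k) A a k * A' k b)%ring.
  rewrite [RHS]big_mkcond; apply: eq_bigr => k _; case: eqP => // hk.
  suff -> : A a k = 0%ring by rewrite mul0r.
  apply: contrapT => ne; apply: hk; apply/ffunP => y; case: (boolP (y \in X)) => hy.
    by rewrite patch_in.
  by rewrite patch_out //; exact: (spin_loc_diag hA ne).
rewrite !restrict.
rewrite (reindex_onto (fun k => patch X k s) (fun k => patch X k s')) /=; last first.
  move=> k /eqP {2}<-; apply/ffunP => y; case: (boolP (y \in X)) => hy.
    by rewrite !patch_in.
  by rewrite !patch_out.
have hc k : patch X (patch X k s) s' = patch X k s'.
  by apply/ffunP => y; rewrite !ffunE; case: (y \in X).
apply: eq_big => k.
  rewrite hc; have -> // : patch X (patch X k s) s == patch X k s.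
  by apply/eqP/ffunP => y; rewrite !ffunE; case: (y \in X).
rewrite hc => /andP[_ /eqP hk]; congr (_ * _)%ring.
  apply: h2 => y hy; first by rewrite -{2}hk !patch_out.
  by rewrite patch_in //; have [-> _] := e2 y hy.
apply: h2' => y hy.
  by rewrite -{2}hk !patch_out //; exact: e1.
by rewrite patch_in //; have [_ ->] := e2 y hy.
Qed.

(** Each product has a single possibly non-zero term: for [A * A'] the intermediate configuration is
    [t] on [X] and [s] elsewhere, and symmetrically with [Y] for [A' * A]. Locality identifies the
    factors. *)
Lemma spin_loc_comm X Y A A' : [disjoint X & Y] -> spin_loc X A -> spin_loc Y A' ->
  (A * A' = A' * A)%ring.
Proof.
move=> dXY hA hA'; apply: opP => s t.
have XnY y : y \in X -> y \notin Y by move=> h; rewrite (disjointFr dXY h).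
have YnX y : y \in Y -> y \notin X by move=> h; rewrite (disjointFl dXY h).
rewrite -[(A * A')%ring]/(opmul A A') -[(A' * A)%ring]/(opmul A' A) !opmulEij.
have one (Z : {set site d L}) (a b : conf) (M N : op conf) : spin_loc Z M -> (forall k, N k b <> C0 -> forall y, y \in Z -> k y = b y) ->
   (\sum_k M a k * N k b = M a (patch Z b a) * N (patch Z b a) b)%ring.
  move=> hM hN; rewrite (bigD1 (patch Z b a)) //= big1 ?addr0 // => k /eqP hk.
  have [->|nM] := pselect (M a k = 0%ring); first by rewrite mul0r.
  have [->|nN] := pselect (N k b = 0%ring); first by rewrite mulr0.
  case: hk; apply/ffunP => y; case: (boolP (y \in Z)) => hy.
    by rewrite patch_in //; exact: hN.
  by rewrite patch_out //; rewrite (spin_loc_diag hM nM).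
rewrite (one X) //; last by move=> k nk y /XnY hy; exact: (spin_loc_diag hA' nk).
rewrite (one Y) //; last by move=> k nk y /YnX hy; exact: (spin_loc_diag hA nk).
have [[y [hX [hY hst]]]|hn] := pselect (exists y, y \notin X /\ y \notin Y /\ s y <> t y).
  have [h1 _] := hA; have [h1' _] := hA'.
  rewrite (h1' (patch X t s) t); last by exists y; rewrite patch_out.
  by rewrite (h1 (patch Y t s) t) ?mulr0 //; exists y; rewrite patch_out.
have eq y : y \notin X -> y \notin Y -> s y = t y.
  by move=> hX hY; apply: contrapT => ne; apply: hn; exists y.
rewrite mulrC; congr (_ * _)%ring.
  have [_ h2'] := hA'; apply: h2' => y hy.
    case: (boolP (y \in X)) => hX; first by rewrite patch_in // patch_out.
    by rewrite !patch_out //; split=> //; exact: eq.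
  by rewrite patch_out ?YnX // patch_in.
have [_ h2] := hA; apply: h2 => y hy.
  case: (boolP (y \in Y)) => hY; first by rewrite patch_out // patch_in.
  by rewrite !patch_out //; split=> //; exact: eq.
by rewrite (patch_out t s (XnY _ hy)) (patch_in t s hy).
Qed.

End SpinLocality.

(** * Weighted partial maps of the basis, a common form for fermion operators and parity *)

Section PartialMaps.
Variable B : finType.

(* [|j> |-> g j |f j>] on the basis vectors with [b j], and [0] on the others *)
Definition pop (b : pred B) (f : B -> B) (g : B -> Cplx) : op B :=
  fun i j => if b j && (i == f j) then g j else C0.

Lemma pop_mul b f g b' f' g' : (pop b f g * pop b' f' g' =
  pop (fun j => b' j && b (f' j)) (f \o f') (fun j => g (f' j) * g' j))%ring.
Proof.
apply: opP => i j; rewrite -[(_ * _)%ring]/(opmul _ _) opmulEij /pop /=.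
case hb: (b' j) => /=; last by rewrite big1 // => k _; rewrite mulr0.
rewrite (bigD1 (f' j)) //= eqxx big1 ?addr0; last by move=> k /negbTE ->; rewrite mulr0.
by case: ifP => //; rewrite mul0r.
Qed.

Lemma pop_opp (b b' : pred B) f g f' g' : b =1 b' ->
  (forall j, b j -> f j = f' j /\ g j = (- g' j)%ring) -> pop b f g = (- pop b' f' g')%ring.
Proof.
move=> hb h; apply: opP => i j; rewrite -[RHS]/(- pop b' f' g' i j)%ring /pop -hb.
case hj: (b j) => /=; last by rewrite oppr0.
by have [-> ->] := h j hj; case: ifP => //; rewrite oppr0.
Qed.
End PartialMaps.

(** * Anticommutation relations, parity, and commutation of even operators *)

Section FermionLocality.
Variables d n L : nat.
Local Notation mode := (site d L * 'I_n)%type.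
Local Notation F := (fock d n L).
Implicit Types (m : mode) (S : F) (X Y : {set site d L}) (A : op F).
Local Notation P := (@parity d n L : op F).

Definition before m m' := ltn (enum_rank m) (enum_rank m').
Definition jw m S : Cplx := RC ((-1) ^ #|[set j in S | before j m]|).
Definition swap_sign m m' : Cplx := if before m m' then (-1)%ring else 1%ring.

(** Of two distinct modes exactly one precedes the other; this is where the minus sign of the
    anticommutation relations comes from. *)
Lemma swap_signN m m' : m != m' -> swap_sign m m' = (- swap_sign m' m)%ring.
Proof.
rewrite -(eqtype.inj_eq (@enum_rank_inj _)) -val_eqE /swap_sign /before /=.
by case: ltngtP => //= _ _; rewrite opprK.
Qed.

Lemma jwU m m' S : m' \notin S -> jw m (m' |: S) = (swap_sign m' m * jw m S)%ring.
Proof.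
move=> hS; rewrite /jw /swap_sign; case hb: (before m' m).
  have -> : [set j in m' |: S | before j m] = m' |: [set j in S | before j m].
    by apply/setP => j; rewrite !inE; case: (j =P m') => [->|_] //=; rewrite hb.
  by rewrite cardsU1 inE (negbTE hS) add1n; apply: CplxP => /=; ring.
have -> : [set j in m' |: S | before j m] = [set j in S | before j m].
  by apply/setP => j; rewrite !inE; case: (j =P m') => [->|_] //=; rewrite hb (negbTE hS).
by rewrite mul1r.
Qed.
Lemma jwD m m' S : m' \in S -> jw m (S :\ m') = (swap_sign m' m * jw m S)%ring.
Proof.
move=> hS; have := @jwU m m' (S :\ m'); rewrite setD11 setD1K // => /(_ isT) ->.
rewrite mulrA /swap_sign; case: ifP => _; last by rewrite !mul1r.
by rewrite mulrNN !mul1r.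
Qed.
Lemma jw_self m S : m \in S -> jw m (S :\ m) = jw m S.
Proof. by move=> h; rewrite jwD // /swap_sign /before /= ltnn mul1r. Qed.

Lemma copE m : cop m = pop (fun S => m \in S) (fun S => S :\ m) (jw m) :> op F.
Proof. by []. Qed.
Lemma adj_copE m : adj (cop m) = pop (fun S => m \notin S) (fun S => m |: S) (jw m) :> op F.
Proof.
apply: opP => S' S; rewrite /adj copE /pop.
have -> : (m \notin S) && (S' == m |: S) = (m \in S') && (S == S' :\ m).
  apply/andP/andP => -[h1 /eqP h2]; split.
  - by rewrite h2 setU11.
  - by rewrite h2 setU1K.
  - by rewrite h2 setD11.
  - by rewrite h2 setD1K.
case: andP => [[h1 /eqP ->]|_]; last by apply: CplxP => /=; ring.
by rewrite jw_self //; apply: CplxP => //=; ring.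
Qed.

Lemma cop_anti m m' : m != m' -> (cop m * cop m' = - (cop m' * cop m) :> op F)%ring.
Proof.
move=> hm; rewrite !copE !pop_mul; apply: pop_opp => S.
  by rewrite !inE hm eq_sym hm andbC.
rewrite !inE => /andP[h' /andP[_ h]]; split.
  by apply/setP => j; rewrite !inE andbCA.
rewrite (jwD m h') (jwD m' h) swap_signN 1?eq_sym //.
by rewrite mulNr mulrAC mulNr; congr (- _)%ring; rewrite mulrC -mulrA mulrCA [RHS]mulrC mulrA mulrC.
Qed.
Lemma cop_adj_anti m m' : m != m' -> (cop m * adj (cop m') = - (adj (cop m') * cop m) :> op F)%ring.
Proof.
move=> hm; rewrite !adj_copE !copE !pop_mul; apply: pop_opp => S.
  by rewrite !inE (negbTE hm) eq_sym hm /= andbC.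
rewrite !inE (negbTE hm) /= => /andP[h' h]; split.
  by apply/setP => j; rewrite !inE; case: (j =P m') => [->|_] //=; rewrite eq_sym hm.
rewrite (jwU m h') (jwD m' h) swap_signN 1?eq_sym //.
by rewrite mulNr mulrAC mulNr; congr (- _)%ring; rewrite mulrC -mulrA mulrCA [RHS]mulrC mulrA mulrC.
Qed.

Lemma parityE : P = pop xpredT (fun S => S) (fun S => RC ((-1) ^ #|S|)).
Proof. by []. Qed.
Lemma parity2 : (P * P = 1)%ring.
Proof.
rewrite parityE pop_mul; apply: opP => i j; rewrite /pop /=.
rewrite -[RHS]/(opid i j) /opid; case: eqP => // _.
have h k : (-1) ^ k * (-1) ^ k = 1.
  rewrite -Rpow_mult_distr; have -> : -1 * -1 = 1 by ring.
  exact: pow1.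
by apply: CplxP; rewrite /= ?h; ring.
Qed.
Lemma adj_parity : adj P = P.
Proof.
apply: opP => i j; rewrite /adj /parity eq_sym; case: eqP => [->|_]; by apply: CplxP => /=; ring.
Qed.
Lemma parity_sign m S : m \in S -> RC ((-1) ^ #|S|) = (- RC ((-1) ^ #|S :\ m|))%ring.
Proof.
move=> h; have -> : #|S| = #|S :\ m|.+1 by rewrite (cardsD1 m S) h add1n.
by apply: CplxP => /=; ring.
Qed.
Lemma parity_cop m : (P * cop m = - (cop m * P) :> op F)%ring.
Proof.
rewrite copE parityE !pop_mul; apply: pop_opp => S; first by rewrite andbT.
move=> /andP[h _]; split=> //=.
by rewrite (parity_sign h) mulrN opprK mulrC.
Qed.
Lemma parity_cops m : (P * adj (cop m) = - (adj (cop m) * P) :> op F)%ring.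
Proof.
have := congr1 (@adj F) (parity_cop m); rewrite adjN !adjM adj_parity => ->.
by rewrite opprK.
Qed.

Lemma ferm_locP X A : ferm_loc X A <-> fgen X A /\ (A * P = P * A)%ring.
Proof.
split=> [[[A' [hA' e]] hP]|[hA hP]].
  by split; [rewrite (opP e) | apply: opP].
by split; [exists A | move=> i j; exact: (congr1 (fun Z : op F => Z i j) hP)].
Qed.

Lemma ferm_loc_id X : ferm_loc X (1%ring : op F).
Proof. by apply/ferm_locP; split; [exact: fg_id | rewrite mul1r mulr1]. Qed.
Lemma ferm_locD X A A' : ferm_loc X A -> ferm_loc X A' -> ferm_loc X (A + A')%ring.
Proof.
move=> /ferm_locP[h1 h2] /ferm_locP[h1' h2']; apply/ferm_locP; split; first exact: fg_add.
by rewrite mulrDl mulrDr h2 h2'.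
Qed.
Lemma ferm_locM X A A' : ferm_loc X A -> ferm_loc X A' -> ferm_loc X (A * A')%ring.
Proof.
move=> /ferm_locP[h1 h2] /ferm_locP[h1' h2']; apply/ferm_locP; split; first exact: fg_mul.
by rewrite -mulrA h2' !mulrA h2.
Qed.
Lemma ferm_locZ X c A : ferm_loc X A -> ferm_loc X (c *: A)%ring.
Proof.
move=> /ferm_locP[h1 h2]; apply/ferm_locP; split; first exact: fg_scale.
by rewrite opscaleAl opscaleAr h2.
Qed.
Lemma fgen_adj X A : fgen X A -> fgen X (adj A).
Proof.
elim=> [|x s hx|x s hx|C C' _ h _ h'|C C' _ h _ h'|c C _ h].
- by rewrite adj1; exact: fg_id.
- exact: fg_cs.
- by rewrite adjK; exact: fg_c.
- by rewrite adjD; exact: fg_add.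
- by rewrite adjM; exact: fg_mul.
- by rewrite adjZ; exact: fg_scale.
Qed.
Lemma ferm_loc_adj X A : ferm_loc X A -> ferm_loc X (adj A).
Proof.
move=> /ferm_locP[h1 h2]; apply/ferm_locP; split; first exact: fgen_adj.
by have := congr1 (@adj F) h2; rewrite !adjM adj_parity => ->.
Qed.
Lemma ferm_loc_mono X Y A : X \subset Y -> ferm_loc X A -> ferm_loc Y A.
Proof.
move=> /subsetP XY /ferm_locP[h1 h2]; apply/ferm_locP; split=> //.
elim: h1 => [|x s /XY hx|x s /XY hx|C C' _ h _ h'|C C' _ h _ h'|c C _ h].
- exact: fg_id.
- exact: fg_c.
- exact: fg_cs.
- exact: fg_add.
- exact: fg_mul.
- exact: fg_scale.
Qed.

(* Moving a generator through [A] costs a conjugation by the parity, hence nothing when [A] is even. *)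
Lemma fgen_twist X A (g : op F) : (forall x s, x \in X -> (g * cop (x, s) = - (cop (x, s) * g))%ring) ->
  (forall x s, x \in X -> (g * adj (cop (x, s)) = - (adj (cop (x, s)) * g))%ring) ->
  fgen X A -> (g * A = P * A * P * g)%ring.
Proof.
move=> hc hcs; elim=> [|x s hx|x s hx|C C' _ h _ h'|C C' _ h _ h'|c C _ h].
- by rewrite -[opid (B := _)]/(1%ring : op F) !mulr1 parity2 mul1r.
- by rewrite parity_cop mulNr -(mulrA _ P P) parity2 mulr1 mulNr hc.
- by rewrite parity_cops mulNr -(mulrA _ P P) parity2 mulr1 mulNr hcs.
- by rewrite mulrDr h h' mulrDr !mulrDl.
- rewrite -[opmul C C']/(C * C')%ring mulrA h -(mulrA _ g C') h' !mulrA.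
  by rewrite -(mulrA (P * C)%ring P P) parity2 mulr1.
- by rewrite -[opscale c C]/(c *: C)%ring !opscaleAr !opscaleAl h.
Qed.

(** Induction on the generators of [A']. Each of them anticommutes with the generators of [A], so by
    [fgen_twist] moving it through [A] replaces [A] by [P * A * P], which is [A] because [A] is
    even. *)
Lemma ferm_loc_comm X Y A A' : [disjoint X & Y] -> ferm_loc X A -> ferm_loc Y A' ->
  (A * A' = A' * A)%ring.
Proof.
move=> dXY /ferm_locP[h1 h2] /ferm_locP[h1' _]; apply/esym.
have PAP : (P * A * P = A)%ring by rewrite -mulrA h2 mulrA parity2 mul1r.
have ne x s y s' : x \in X -> y \in Y -> ((y, s') : mode) != (x, s).
  by move=> hx hy; apply: contraTneq hy => -[-> _]; rewrite (disjointFr dXY hx).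
elim: h1' => [|y s hy|y s hy|C C' _ h _ h'|C C' _ h _ h'|c C _ h].
- by rewrite -[opid (B := _)]/(1%ring : op F) mul1r mulr1.
- rewrite -{2}PAP; apply: fgen_twist h1 => x s' hx; first by apply: cop_anti; exact: ne.
  by apply: cop_adj_anti; exact: ne.
- rewrite -{2}PAP; apply: fgen_twist h1 => x s' hx.
    by apply: oppr_inj; rewrite opprK -cop_adj_anti // eq_sym; exact: ne.
  have := congr1 (@adj F) (cop_anti (ne x s' y s hx hy)); rewrite adjN !adjM => e.
  by rewrite -[LHS]opprK -e.
- by rewrite -[opadd C C']/(C + C')%ring mulrDr mulrDl h h'.
- by rewrite -[opmul C C']/(C * C')%ring -mulrA h' mulrA h mulrA.
- by rewrite -[opscale c C]/(c *: C)%ring opscaleAl opscaleAr h.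
Qed.

End FermionLocality.

Section Locality.
Variables (sys : system) (d n L : nat).
Local Notation O := (op (basis sys d n L)).
Implicit Types (X Y : {set site d L}).

Lemma loc_id X : loc X (1%ring : O).
Proof. case: sys; [exact: spin_loc_id | exact: ferm_loc_id]. Qed.
Lemma locD X (A A' : O) : loc X A -> loc X A' -> loc X (A + A')%ring.
Proof. case: sys A A' => A A'; [exact: spin_locD | exact: ferm_locD]. Qed.
Lemma locM X (A A' : O) : loc X A -> loc X A' -> loc X (A * A')%ring.
Proof. case: sys A A' => A A'; [exact: spin_locM | exact: ferm_locM]. Qed.
Lemma locZ X c (A : O) : loc X A -> loc X (c *: A)%ring.
Proof. case: sys A => A; [exact: spin_locZ | exact: ferm_locZ]. Qed.
Lemma loc_adj X (A : O) : loc X A -> loc X (adj A).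
Proof. case: sys A => A; [exact: spin_loc_adj | exact: ferm_loc_adj]. Qed.
Lemma loc_mono X Y (A : O) : X \subset Y -> loc X A -> loc Y A.
Proof. case: sys A => A; [exact: spin_loc_mono | exact: ferm_loc_mono]. Qed.
Lemma loc_comm X Y (A A' : O) : [disjoint X & Y] -> loc X A -> loc Y A' -> (A * A' = A' * A)%ring.
Proof. case: sys A A' => A A'; [exact: spin_loc_comm | exact: ferm_loc_comm]. Qed.
Lemma locB X (A A' : O) : loc X A -> loc X A' -> loc X (A - A')%ring.
Proof. by move=> h h'; rewrite -scaleN1r; apply: locD => //; exact: locZ. Qed.
Lemma loc0 X : loc X (0%ring : O).
Proof. by rewrite -(scale0r (1%ring : O)); apply: locZ; exact: loc_id. Qed.

Lemma loc_expsum X (A : O) N : loc X A -> loc X (expsum A N).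
Proof.
move=> h; have hk k : loc X (A ^+ k)%ring.
  by elim: k => [|k IH]; [exact: loc_id | rewrite exprS; exact: locM].
elim: N => [|N IH]; first exact: loc_id.
by rewrite expsumS; apply: locD => //; exact: locZ.
Qed.

(** The norm closure of the operators supported in [X]. Exponentials belong to it through their
    partial sums, and the estimates needed for them are continuous in the norm. *)
Definition aloc X (A : O) := forall eps, 0 < eps -> exists A' : O, loc X A' /\ opnorm (A - A')%ring <= eps.

Lemma aloc_V X (H : O) s : loc X H -> aloc X (V H s).
Proof.
move=> h eps e0; have [N hN] := mexp_tends (iR s *: H)%ring e0.
exists (expsum (iR s *: H)%ring N); split; first by apply: loc_expsum; exact: locZ.
have := hN N (Nat.le_refl N); rewrite /Rdist Rminus_0_r Rabs_pos_eq; last exact: opnorm_ge0.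
by rewrite opnorm_sub; exact: Rlt_le.
Qed.
Lemma alocM X (A A' : O) : aloc X A -> aloc X A' -> aloc X (A * A')%ring.
Proof.
move=> h h' eps e0; have n0 := opnorm_ge0 A; have n0' := opnorm_ge0 A'.
(* The error of the product is at most [x ||A'|| + (||A|| + x) x], and [x <= 1]. *)
pose x := Rmin 1 (eps / (opnorm A + opnorm A' + 1)).
have x0 : 0 < x by apply: Rmin_pos; [lra | apply: Rdiv_lt_0_compat; lra].
have x1 : x <= 1 by exact: Rmin_l.
have xe : x * (opnorm A + opnorm A' + 1) <= eps.
  apply: (Rle_trans _ (eps / (opnorm A + opnorm A' + 1) * (opnorm A + opnorm A' + 1))).
    by apply: Rmult_le_compat_r; [lra | exact: Rmin_r].
  by right; field; lra.
have [C [lC hC]] := h x x0; have [C' [lC' hC']] := h' x x0.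
exists (C * C')%ring; split; first exact: locM.
have -> : (A * A' - C * C' = (A - C) * A' + C * (A' - C'))%ring.
  by rewrite mulrBl mulrBr addrA subrK.
have nC : opnorm C <= opnorm A + x.
  have -> : C = (A - (A - C))%ring by rewrite opprB addrCA subrr addr0.
  by apply: opnormB_le => //; lra.
have b1 : opnorm ((A - C) * A')%ring <= x * opnorm A'.
  by apply: Rle_trans (opnormM _ _) _; apply: Rmult_le_compat_r.
have b2 : opnorm (C * (A' - C'))%ring <= (opnorm A + x) * x.
  by apply: Rle_trans (opnormM _ _) _; apply: Rmult_le_compat => //; exact: opnorm_ge0.
by apply: Rle_trans (opnormD_le b1 b2) _; nra.
Qed.

End Locality.

(** * Geometry of the strips *)

Section Geometry.
Variables (d L : nat).
Hypothesis L64 : (64 <= L)%N.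
Hypothesis Le : ~~ odd L.
Implicit Types (x y : site d L) (X : {set site d L}).

(** Truncated subtraction writes [|a - b|] as [(a - b) + (b - a)], which brings the strip inclusions
    within reach of [lia]. *)
Lemma pdistE a b : pdist L a b = minn ((a - b) + (b - a)) (L - ((a - b) + (b - a)))%N.
Proof. by rewrite /pdist; case: leqP => h; congr minn; lia. Qed.
Lemma half_even : (2 * L./2 = L)%N.
Proof. by have := odd_double_half L; rewrite (negbTE Le) add0n -mul2n. Qed.
Lemma x1_lt x : (x1 x < L)%N.
Proof. by rewrite /x1; case: pickP => [i _|_]; [exact: ltn_ord | lia]. Qed.
Lemma pdist_le_dist x y : (pdist L (x1 x) (x1 y) <= dist x y)%N.
Proof.
rewrite /x1 /dist; case: pickP => [i _|_]; first by rewrite (bigD1 i) //= leq_addr.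
by rewrite /pdist /= subn0 min0n.
Qed.

Lemma fatten_in X r x : x \in fatten X r -> exists2 y, y \in X & (pdist L (x1 y) (x1 x) <= r)%N.
Proof.
rewrite inE => /existsP[y /andP[hy hd]]; exists y => //; exact: leq_trans (pdist_le_dist _ _) hd.
Qed.
Lemma fatten_sub X r : X \subset fatten X r.
Proof.
apply/subsetP => x hx; rewrite inE; apply/existsP; exists x; rewrite hx /=.
by rewrite /dist big1 // => i _; rewrite /pdist leqnn subnn min0n.
Qed.

Lemma disjoint_Sm_Sp : [disjoint Sm d L & Sp d L].
Proof.
rewrite -setI_eq0; apply/eqP/setP => x; rewrite !inE; apply/negbTE/negP => /andP[].
have := x1_lt x; have := half_even; rewrite !pdistE; move: (x1 x) => a.
by lia.
Qed.
Lemma fatten_bdm_sub : fatten (fatten (bdm d L) (L %/ 16)) (L %/ 32) \subset Sm d L.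
Proof.
apply/subsetP => x /fatten_in[y /fatten_in[z]]; rewrite !inE => /eqP ->.
have := x1_lt x; have := x1_lt y; rewrite !pdistE; move: (x1 x) (x1 y) => a b.
by lia.
Qed.
(** The boundary layer sits at [L/2 - 1] while [S_+] is centred at [L/2]. Since [1/16 + 1/32 < 1/8],
    there is room for this extra unit once [64 <= L]. *)
Lemma fatten_bdp_sub : fatten (fatten (bdp d L) (L %/ 16)) (L %/ 32) \subset Sp d L.
Proof.
apply/subsetP => x /fatten_in[y /fatten_in[z]]; rewrite !inE => /eqP ->.
have := x1_lt x; have := x1_lt y; have := half_even.
rewrite !pdistE; move: (x1 x) (x1 y) => a b.
by lia.
Qed.
Lemma disjoint_fatten_Sm_Sp : [disjoint fatten (Sm d L) (L %/ 32) & Sp d L].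
Proof.
rewrite -setI_eq0; apply/eqP/setP => x; rewrite in_setI [RHS]inE; apply/negbTE/negP => /andP[/fatten_in[y]].
rewrite !inE.
have := x1_lt x; have := x1_lt y; have := half_even.
rewrite !pdistE; move: (x1 x) (x1 y) => a b.
by lia.
Qed.
Lemma dist1_Sm_Sp : (L <= 4 * dist1 (Sm d L) (Sp d L))%N.
Proof.
(* The value [L] of an empty minimum satisfies the bound as well. *)
rewrite /dist1; elim/big_ind: _ => [|a b ha hb|x hx]; [lia | lia |].
elim/big_ind: _ => [|a b ha hb|y hy]; [lia | lia |].
move: hx hy; rewrite !inE.
have := x1_lt x; have := x1_lt y; have := half_even.
rewrite !pdistE; move: (x1 x) (x1 y) => a b.
by lia.
Qed.

Lemma card_site_le X : INR #|X| <= INR L ^ d.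
Proof.
have -> : INR L ^ d = INR (expn L d).
  by elim: d => [//|k IH]; rewrite expnS mult_INR -IH.
apply/le_INR/leP; apply: leq_trans (max_card _) _.
by rewrite card_ffun !card_ord.
Qed.

End Geometry.

(** * The fixed-size estimate for the actual strips *)

Section Strips.
Variables (sys : system) (d n L : nat).
Hypothesis L64 : (64 <= L)%N.
Hypothesis Le : ~~ odd L.
Local Notation O := (op (basis sys d n L)).
Local Notation A1 := (Sm d L).
Local Notation A2 := (Sp d L).
Variables (Qc : site d L -> O) (U : O) (Om : vec (basis sys d n L)) (Tm Tp Km Kp : O).
Hypothesis HQ : forall x, loc [set x] (Qc x) /\ selfadj (Qc x) /\ spec_in_Z (Qc x).

Lemma loc_sum (P : pred (site d L)) (Y : {set site d L}) : (forall x, P x -> x \in Y) ->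
  loc Y (\sum_(x | P x) Qc x)%ring.
Proof.
move=> h; apply: big_ind => [|A A' hA hA'|x /h hx]; [exact: loc0 | exact: locD |].
by apply: loc_mono (proj1 (HQ x)); rewrite sub1set.
Qed.
Lemma sa_sum (P : pred (site d L)) : sa (\sum_(x | P x) Qc x)%ring.
Proof.
apply: big_ind => [|A A' hA hA'|x _]; [exact: adj0 | exact: saD |].
by apply/selfadjP; case: (HQ x) => _ [].
Qed.
Lemma charges_comm x y : (Qc x * Qc y = Qc y * Qc x)%ring.
Proof.
have [->//|/eqP ne] := pselect (x = y).
by apply: loc_comm (proj1 (HQ x)) (proj1 (HQ y)); rewrite disjoints1 inE.
Qed.
Lemma V_charge (P : pred (site d L)) : V (\sum_(x | P x) Qc x)%ring (2 * PI) = 1%ring.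
Proof.
elim: (index_enum _) => [|x r IH]; first by rewrite big_nil V_zero.
rewrite big_cons; case: ifP => // _; rewrite V_sum ?IH.
  by rewrite V_integral_spectrum ?mul1r //; case: (HQ x) => _ [] // /selfadjP.
apply: (big_ind (fun S : O => Qc x * S = S * Qc x)%ring) => [|A A' hA hA'|y _];
  last exact: charges_comm.
- by rewrite mulr0 mul0r.
- by rewrite mulrDr mulrDl hA hA'.
Qed.

Hypothesis HU : unitary U.
Hypothesis HOm : unit_vec Om.
Hypotheses (lTm : loc A1 Tm) (sTm : selfadj Tm) (lTp : loc A2 Tp) (sTp : selfadj Tp).
Hypotheses (lKm : loc (fatten (bdm d L) (L %/ 16)) Km) (sKm : selfadj Km)
  (lKp : loc (fatten (bdp d L) (L %/ 16)) Kp) (sKp : selfadj Kp).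
(** [D] is the error of almost locality at distance [L/32], relative to the norm, and [F] that of
    clustering between the strips; both include the volume factors. *)
Variables (a e D F : R).
Hypotheses (e0 : 0 <= e) (D0 : 0 < D) (F0 : 0 <= F).
Local Notation Q := (Qset Qc (Gam d L)).
Hypothesis hT : opnorm (adj U * (Q * U) - Q - Tm - Tp)%ring <= e.
Hypothesis hV : nrm Om (U - cst (expect Om U))%ring <= e.
Hypothesis hQ : nrm Om (Q - Km - Kp - cst (expect Om (Q - Km - Kp)))%ring <= e.
Hypothesis hE : opnorm (V (Q + Tm)%ring (2 * PI) - 1)%ring <= e.
Hypotheses (nTm : opnorm Tm <= a) (nTp : opnorm Tp <= a) (nKm : opnorm Km <= a) (nKp : opnorm Kp <= a).
Hypothesis Hloc : forall X (A : O), loc X A -> exists R : O,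
  loc (fatten X (L %/ 32)) R /\ opnorm (adj U * (A * U) - R)%ring <= D * opnorm A.
Hypothesis Hclu : forall A A' : O, loc A1 A -> loc A2 A' ->
  Cnorm (expect Om (A * A') - expect Om A * expect Om A')%ring <= F * (opnorm A * opnorm A').
Hypotheses (hD : 6 * D * a <= e) (hF : 4 * F <= e).

Let U1 : (adj U * U = 1)%ring. Proof. by apply: opP => i j; have [] := HU i j. Qed.
Let U2 : (U * adj U = 1)%ring. Proof. by apply: opP => i j; have [] := HU i j. Qed.
Let a0 : 0 <= a. Proof. exact: Rle_trans (opnorm_ge0 Tm) nTm. Qed.

(** Almost locality gives an approximant that need not be self-adjoint; its real part
    [(R + adj R) / 2] is, and is no further from the self-adjoint [adj U * K * U]. *)
Lemma local_conj_sa X (K : O) : loc X K -> selfadj K -> opnorm K <= a -> exists r : O,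
  [/\ loc (fatten X (L %/ 32)) r, sa r & opnorm (adj U * K * U - r)%ring <= e].
Proof.
move=> lK /selfadjP sK nK; have [R [lR hR]] := Hloc lK; rewrite mulrA in hR.
exists (RC (/ 2) *: (R + adj R))%ring; split.
- by apply: locZ; apply: locD => //; exact: loc_adj.
- by rewrite /sa adjZ adjD adjK addrC; congr (_ *: _)%ring; apply: CplxP => /=; ring.
set S := (adj U * K * U)%ring in hR *.
have sS : adj S = S by exact: sa_conj.
have -> : (S - RC (/ 2) *: (R + adj R) = RC (/ 2) *: ((S - R) + adj (S - R)))%ring.
  rewrite adjB sS; move: (adj R) S {hR sS} => R' S.
  by apply: opP => i j; apply: CplxP => /=; field.
apply: Rle_trans (opnormZ_le _ _) _; rewrite Cnorm_RC Rabs_pos_eq; last lra.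
have hR' : opnorm (adj (S - R))%ring <= D * opnorm K by rewrite opnorm_adj.
have := opnormD_le hR hR'; set y := opnorm _ => hy.
have := opnorm_ge0 K => n0; have : D * opnorm K <= D * a by apply: Rmult_le_compat_l; lra.
have : 0 <= D * a by apply: Rmult_le_pos; lra.
by lra.
Qed.

(** A local approximant of [W] has norm at most [2], so its conjugate is within [2 D] of an operator
    [R] on the enlarged [S_-], which commutes with [Tp]. Adding the first approximation error makes
    [3 D], and the commutator is at most [6 D a]. *)
Lemma aloc_locality (W : O) : aloc A1 W -> opnorm W <= 1 ->
  opnorm ((adj U * W * U) * Tp - Tp * (adj U * W * U))%ring <= e.
Proof.
move=> hW nW; pose x := Rmin 1 D.
have x0 : 0 < x by apply: Rmin_pos; lra.
have x1' : x <= 1 by exact: Rmin_l.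
have xD : x <= D by exact: Rmin_r.
have [W' [lW' hW']] := hW x x0.
have nW' : opnorm W' <= 2.
  have -> : W' = (W - (W - W'))%ring by rewrite opprB addrCA subrr addr0.
  by apply: Rle_trans (opnormB_le nW hW') _; lra.
have [R [lR hR]] := Hloc lW'; rewrite mulrA in hR.
set S := (adj U * W * U)%ring.
have hS : opnorm (S - R)%ring <= 3 * D.
  have -> : (S - R = adj U * (W - W') * U + (adj U * W' * U - R))%ring.
    by rewrite mulrBr mulrBl addrA subrK.
  have h1 : opnorm (adj U * (W - W') * U)%ring <= D.
    apply: Rle_trans xD; apply: Rle_trans (opnorm_mulr_le1 _ (opnorm_isom U1)) _.
    by apply: Rle_trans (opnorm_mul_le1 _ _) hW'; rewrite opnorm_adj; exact: opnorm_isom.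
  by apply: Rle_trans (opnormD_le h1 hR) _; have := opnorm_ge0 W'; nra.
have cR : (R * Tp = Tp * R)%ring by apply: loc_comm lR lTp; exact: disjoint_fatten_Sm_Sp.
have -> : (S * Tp - Tp * S = (S - R) * Tp - Tp * (S - R))%ring.
  by rewrite mulrBl mulrBr cR opprB addrA subrK.
have b1 : opnorm ((S - R) * Tp)%ring <= 3 * D * a.
  by apply: Rle_trans (opnormM _ _) _; apply: Rmult_le_compat => //; exact: opnorm_ge0.
have b2 : opnorm (Tp * (S - R))%ring <= a * (3 * D).
  by apply: Rle_trans (opnormM _ _) _; apply: Rmult_le_compat => //; exact: opnorm_ge0.
by apply: Rle_trans (opnormB_le b1 b2) _; lra.
Qed.

(** The local approximants have norms at most [2], whence [4 F]. Replacing them in [<Z Y>] and in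
    [<Z> <Y>] costs [3 x] each time, which is why [x] is at most [eps / 6]. *)
Lemma aloc_clustering (Z Y : O) : aloc A1 Z -> aloc A2 Y -> opnorm Z <= 1 -> opnorm Y <= 1 ->
  Cnorm (expect Om (Z * Y) - expect Om Z * expect Om Y)%ring <= e.
Proof.
move=> hZ hY nZ nY; apply: Rle_trans hF; apply: Rle_plus_epsilon => eps eps0.
pose x := Rmin 1 (eps / 6).
have x0 : 0 < x by apply: Rmin_pos; lra.
have x1' : x <= 1 by exact: Rmin_l.
have xe : x <= eps / 6 by exact: Rmin_r.
have [Z' [lZ' hZ']] := hZ x x0; have [Y' [lY' hY']] := hY x x0.
have nZ' : opnorm Z' <= 2.
  have -> : Z' = (Z - (Z - Z'))%ring by rewrite opprB addrCA subrr addr0.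
  by apply: Rle_trans (opnormB_le nZ hZ') _; lra.
have nY' : opnorm Y' <= 2.
  have -> : Y' = (Y - (Y - Y'))%ring by rewrite opprB addrCA subrr addr0.
  by apply: Rle_trans (opnormB_le nY hY') _; lra.
have w1 (A : O) y : opnorm A <= y -> Cnorm (expect Om A) <= y by exact: expect_opnorm_le.
have b1 : Cnorm (expect Om (Z * Y) - expect Om (Z' * Y'))%ring <= x * 1 + 2 * x.
  rewrite -expectB; have -> : (Z * Y - Z' * Y' = (Z - Z') * Y + Z' * (Y - Y'))%ring.
    by rewrite mulrBl mulrBr addrA subrK.
  rewrite expectD; apply: CnormD_le; apply: w1; apply: Rle_trans (opnormM _ _) _;
    by apply: Rmult_le_compat => //; exact: opnorm_ge0.
have b2 : Cnorm (expect Om Z * expect Om Y - expect Om Z' * expect Om Y')%ring <= x * 1 + 2 * x.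
  have -> : (expect Om Z * expect Om Y - expect Om Z' * expect Om Y'
     = expect Om (Z - Z') * expect Om Y + expect Om Z' * expect Om (Y - Y'))%ring.
    by rewrite !expectB mulrBl mulrBr addrA subrK.
  apply: CnormD_le; rewrite CnormM; apply: Rmult_le_compat; try exact: Cnorm_ge0; exact: w1.
have b3 := Hclu lZ' lY'.
have b3' : F * (opnorm Z' * opnorm Y') <= F * 4.
  apply: Rmult_le_compat_l => //; have := opnorm_ge0 Z'; have := opnorm_ge0 Y'; nra.
apply: Rle_trans (Cnorm_sub_tri _ (expect Om (Z' * Y'))%ring _) _.
apply: Rle_trans (Rplus_le_compat _ _ _ _ b1 (Cnorm_sub_tri _ (expect Om Z' * expect Om Y')%ring _)) _.
rewrite Cnorm_sub in b2.
apply: Rle_trans (Rplus_le_compat_l _ _ _ (Rplus_le_compat _ _ _ _ b3 b2)) _.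
by lra.
Qed.

Lemma strip_estimate :
  Cnorm (cis (2 * PI * Re (expect Om Tm)) - 1)%ring <= 500 * (1 + (a + e)) * (e + sqrt e).
Proof.
have [r1 [lr1 sr1 hr1]] := local_conj_sa lKm sKm nKm.
have [r2 [lr2 sr2 hr2]] := local_conj_sa lKp sKp nKp.
have lKm' : loc A1 Km.
  by apply: loc_mono lKm; apply: subset_trans (fatten_sub _ (L %/ 32)) _; exact: fatten_bdm_sub.
have lKp' : loc A2 Kp.
  by apply: loc_mono lKp; apply: subset_trans (fatten_sub _ (L %/ 32)) _; exact: fatten_bdp_sub.
have {}lr1 : loc A1 r1 by apply: loc_mono lr1; exact: fatten_bdm_sub.
have {}lr2 : loc A2 r2 by apply: loc_mono lr2; exact: fatten_bdp_sub.
pose A0 := ~: (A1 :|: A2).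
pose q1 := (\sum_(x in Gam d L :&: A1) Qc x)%ring.
pose q2 := (\sum_(x in (Gam d L :\: A1) :&: A2) Qc x)%ring.
pose q0 := (\sum_(x in Gam d L :\: A1 :\: A2) Qc x)%ring.
have QE : Q = (q1 + q0 + q2)%ring.
  have e2 : (\sum_(x in Gam d L :\: A1) Qc x = q2 + q0)%ring by rewrite (big_setID A2).
  rewrite -[Q]/(\sum_(x in Gam d L) Qc x)%ring (big_setID A1) /= e2.
  by rewrite -/q1 addrA addrAC.
have lq1 : loc A1 q1 by apply: loc_sum => x; rewrite inE => /andP[].
have lq2 : loc A2 q2 by apply: loc_sum => x; rewrite inE => /andP[].
have lq0 : loc A0 q0 by apply: loc_sum => x; rewrite !inE negb_or => /andP[-> /andP[-> _]].
have d12 : [disjoint A1 & A2] by exact: disjoint_Sm_Sp.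
have d10 : [disjoint A1 & A0] by rewrite -subsets_disjoint subsetUl.
have d20 : [disjoint A2 & A0] by rewrite -subsets_disjoint subsetUr.
(* The approximant is bounded by [a + e] only, so [core_estimate] is applied with [a + e] for
   [a]. *)
have nr1 : opnorm r1 <= a + e.
  have -> : r1 = (adj U * Km * U - (adj U * Km * U - r1))%ring by rewrite opprB addrCA subrr addr0.
  apply: opnormB_le => //; apply: Rle_trans (opnorm_mulr_le1 _ (opnorm_isom U1)) _.
  by apply: Rle_trans (opnorm_mul_le1 _ _) nKm; rewrite opnorm_adj; exact: opnorm_isom.
have hT' := hT; rewrite QE mulrA in hT'; have hQ' := hQ; rewrite QE in hQ'.
have hE' := hE; rewrite QE in hE'.
apply: (@core_estimate _ Om U HOm U1 U2 (@loc sys d n L A1) (@loc sys d n L A0) (@loc sys d n L A2)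
  _ _ _ _ _ _ _ q1 q0 q2 Tm Tp Km Kp r1 r2) => //.
- by move=> X Y; exact: locD.
- by move=> X Y; exact: locB.
- by move=> X Y; exact: locD.
- by move=> X Y; exact: locB.
- by move=> X Y; exact: loc_comm.
- by move=> X Y; exact: loc_comm.
- by move=> X Y; exact: loc_comm.
- exact: sa_sum.
- exact: sa_sum.
- exact: sa_sum.
- exact/selfadjP.
- exact/selfadjP.
- exact/selfadjP.
- exact/selfadjP.
- exact: V_charge.
- exact: V_charge.
- exact: V_charge.
- by lra.
- by lra.
- move=> H H' G G' s t l1 l1' l2 l2' h1 h1' h2 h2'; apply: aloc_clustering.
  + by apply: alocM; exact: aloc_V.
  + by apply: alocM; exact: aloc_V.
  + by apply: Rle_trans (opnorm_mul_le1 _ (opnorm_V _ h1)) (opnorm_V _ h1').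
  + by apply: Rle_trans (opnorm_mul_le1 _ (opnorm_V _ h2)) (opnorm_V _ h2').
- by move=> H s lH sH; apply: aloc_locality; [exact: aloc_V | exact: opnorm_V].
Qed.

End Strips.

(** * Asymptotics *)

(** With [x] the distance to a nearest integer, the right-hand side is [2 sin(PI x)]. On [[0, 2]]
    one has [sin y >= y - y^3 / 6 >= y / 3], and [PI > 3]. *)
Lemma dist_Z_le_cis t : exists m : Z, Rabs (t - IZR m) <= Cnorm (cis (2 * PI * t) - 1)%ring.
Proof.
(* [up r] lies in [(r, r + 1]], so this integer is within [1/2] of [t]. *)
exists (up (t - 1 / 2)); have [h1 h2] := archimed (t - 1 / 2).
set m := up _ in h1 h2 *; pose x := t - IZR m.
have -> : cis (2 * PI * t) = cis (2 * PI * x).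
  have -> : 2 * PI * t = 2 * PI * x + IZR m * (2 * PI) by rewrite /x; ring.
  by rewrite cisD cis_2PI_Z mulr1.
rewrite -/x; have hx : Rabs x <= 1 / 2 by rewrite /x; apply: Rabs_le; lra.
have pi4 := PI_4; have pi3 := PI2_3_2; have ax := Rabs_pos x.
pose y := PI * Rabs x.
have y0 : 0 <= y by apply: Rmult_le_pos; lra.
have y2 : y <= 2 by rewrite /y; nra.
have hs : y / 3 <= sin y.
  have y4 : y <= 4 by lra.
  have [hl _] := pre_sin_bound y 0 y0 y4.
  have {}hl : y - y * y * y / 6 <= sin y.
    by apply: Rle_trans hl; rewrite /sin_approx /sin_term /=; lra.
  suff : y * y * y <= 4 * y by lra.
  by nra.
have -> : Cnorm (cis (2 * PI * x) - 1)%ring = 2 * sin y.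
  apply: CnormE; first lra.
  have e1 : cos (2 * PI * x) = 1 - 2 * sin y * sin y.
    rewrite -cos_2a_sin /y; case: (Rle_lt_dec 0 x) => x0.
      by rewrite Rabs_pos_eq //; congr cos; ring.
    by rewrite Rabs_left // -cos_neg; congr cos; ring.
  have := sin2_cos2 (2 * PI * x); rewrite /Rsqr e1 /= e1; nra.
by rewrite /y in hs *; nra.
Qed.

(** The exponential series dominates its term of degree [n]: [exp x >= x^n / n!]. *)
Lemma exp_decay c n : 0 < c -> exists C, 0 <= C /\
  forall z, 0 < z -> exp (- (c * z)) <= C * / z ^ n.
Proof.
move=> c0; exists (INR (fact n) * / c ^ n); split.
  apply: Rmult_le_pos; first exact: pos_INR.
  by apply/Rlt_le/Rinv_0_lt_compat/pow_lt.
move=> z z0; have x0 : 0 < c * z by nra.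
have hf := INR_fact_lt_0 n; have hx := pow_lt _ n x0.
have h : / INR (fact n) * (c * z) ^ n <= exp (c * z).
  apply: Rle_trans (rexpsum_le n (Rlt_le _ _ x0)); rewrite rexpsumE.
  apply: (@Rsum_ge_term _ (fun k : 'I_n.+1 => / INR (fact k) * (c * z) ^ k) ord_max) => j.
  apply: Rmult_le_pos; first exact/Rlt_le/inv_fact_gt0.
  by apply: pow_le; lra.
have p0 : 0 < / INR (fact n) * (c * z) ^ n by apply: Rmult_lt_0_compat => //; exact: inv_fact_gt0.
rewrite exp_Ropp; apply: Rle_trans (Rinv_le_contravar _ _ p0 h) _.
right; rewrite Rpow_mult_distr; have := pow_lt _ n c0; have := pow_lt _ n z0 => ? ?.
by field; lra.
Qed.

Lemma Rle_of_sqr_le x y : 0 <= y -> x * x <= y * y -> x <= y.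
Proof. by move=> y0 h; nra. Qed.

Local Close Scope R_scope.

Theorem theorem2p1
  (sys : system) (d n : nat) (hd : 0 < d) (hn : 0 < n)
  (Qc : forall L, site d L -> op (basis sys d n L))
  (U : forall L, op (basis sys d n L))
  (Om : forall L, vec (basis sys d n L))
  (Tm Tp Km Kp : forall L, op (basis sys d n L))
  (* charges *)
  (HQ : forall L, evenpos L -> forall x : site d L,
      loc [set x] (Qc L x) /\ selfadj (Qc L x) /\ spec_in_Z (Qc L x))
  (HU : forall L, evenpos L -> unitary (U L))
  (HOm : forall L, evenpos L -> unit_vec (Om L))
  (* (i) almost locality *)
  (Hi : forall k : nat, exists Ck : R, forall L, evenpos L ->
      forall (X : {set site d L}) (A : op (basis sys d n L)), loc X A ->
      forall r : nat, 0 < r -> exists Rr : op (basis sys d n L),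
        loc (fatten X r) Rr /\
        (opnorm (opsub (opmul (adj (U L)) (opmul A (U L))) Rr)
           <= Ck * opnorm A * INR #|X| * / INR r ^ k)%R)
  (* (ii) *)
  (HiiTm : forall L, evenpos L -> loc (Sm d L) (Tm L) /\ selfadj (Tm L))
  (HiiTp : forall L, evenpos L -> loc (Sp d L) (Tp L) /\ selfadj (Tp L))
  (Hii : negl (fun L => opnorm
      (opsub (opsub (opsub (opmul (adj (U L)) (opmul (Qset (Qc L) (Gam d L)) (U L)))
                            (Qset (Qc L) (Gam d L)))
                    (Tm L)) (Tp L))))
  (* (iii) *)
  (Hiii : negl (fun L => Var (Om L) (U L)))
  (* (iv) local charge fluctuations *)
  (HivK : forall L, evenpos L ->
      loc (fatten (bdm d L) (L %/ 16)) (Km L) /\ selfadj (Km L) /\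
      loc (fatten (bdp d L) (L %/ 16)) (Kp L) /\ selfadj (Kp L))
  (HivKn : exists CK : R, forall L, evenpos L ->
      (opnorm (Km L) <= CK * INR (L ^ d))%R /\ (opnorm (Kp L) <= CK * INR (L ^ d))%R)
  (Hiv : negl (fun L => Var (Om L)
      (opsub (opsub (Qset (Qc L) (Gam d L)) (Km L)) (Kp L))))
  (* (v) clustering in the x_1-direction *)
  (Hv : exists c Cc : R, (0 < c)%R /\ (0 < Cc)%R /\
      forall L, evenpos L -> forall (X X' : {set site d L})
        (A B : op (basis sys d n L)), loc X A -> loc X' B ->
      (Cnorm (Csub (expect (Om L) (opmul A B))
                   (Cmul (expect (Om L) A) (expect (Om L) B)))
        <= Cc * opnorm A * opnorm B * INR #|X| * INR #|X'|
           * exp (- c * INR (dist1 X X')))%R)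
  (* additional choice of T_pm *)
  (Hexp : negl (fun L => opnorm
      (opsub (mexp (opscale (mkC 0 (2 * PI))
                      (opadd (Qset (Qc L) (Gam d L)) (Tm L))))
             (@opid (basis sys d n L)))))
  (HTn : exists CT : R, forall L, evenpos L ->
      (opnorm (Tm L) <= CT * INR (L ^ d))%R /\ (opnorm (Tp L) <= CT * INR (L ^ d))%R) :
  forall k : nat, exists Ck : R, forall L, evenpos L ->
    exists m : Z, (Cnorm (Csub (expect (Om L) (Tm L)) (RC (IZR m))) <= Ck * / INR L ^ k)%R.
Proof.
Local Open Scope R_scope.
(* The square root halves the exponent, and the norms of [T] and [K] cost [L^d]; hence
   [K = 2 (k + d)]. The further [2 d] in [K2] pays for two volume factors: [|X| |X'|] in clustering,
   [|X|] and the norm bound [a] in almost locality. The variances are squared norms, so they are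
   taken at [2 K]. *)
move=> k; pose K := (2 * (k + d))%N; pose K2 := (K + 2 * d)%N.
have [C1 h1] := Hii K; have [C2 h2] := Hiii (2 * K)%N; have [C3 h3] := Hiv (2 * K)%N.
have [C4 h4] := Hexp K; have [CT hCT] := HTn; have [CK hCK] := HivKn.
have [Ci hi] := Hi K2; have [c [Cc [c0 [Cc0 hv]]]] := Hv.
have c4 : 0 < c / 4 by lra.
have [C5 [C50 h5]] := exp_decay K2 c4.
pose Ac := Rabs CT + Rabs CK.
(* The radius is [L %/ 32], which is at least [L / 64]; this gives [64 ^ K2]. Adding [1] makes [D]
   positive, so that it can serve as a precision in [aloc_locality]. *)
pose Dc := Rabs Ci * 64 ^ K2 + 1.
pose Fc := Cc * C5.
pose E := Rabs C1 + sqrt (Rabs C2) + sqrt (Rabs C3) + Rabs C4 + 6 * Dc * Ac + 4 * Fc.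
have Ac0 : 0 <= Ac by have := Rabs_pos CT; have := Rabs_pos CK; rewrite /Ac; lra.
have Dc0 : 0 < Dc.
  rewrite /Dc; have : 0 <= Rabs Ci * 64 ^ K2; last lra.
  by apply: Rmult_le_pos; [exact: Rabs_pos | apply: pow_le; lra].
have Fc0 : 0 <= Fc by apply: Rmult_le_pos; lra.
have DA0 : 0 <= 6 * Dc * Ac by apply: Rmult_le_pos; lra.
have p1 := Rabs_pos C1; have p4 := Rabs_pos C4.
have p2 := sqrt_pos (Rabs C2); have p3 := sqrt_pos (Rabs C3).
have E0 : 0 <= E by rewrite /E; lra.
(* The last summand takes care of [L < 64], where the integer [0] is used and [|<T_->|] is bounded
   by the norm of [T_-]. *)
exists (500 * (1 + Ac + E) * (E + sqrt E) + Rabs CT * 64 ^ d * 64 ^ k) => L hL.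
have sT : expect (Om L) (Tm L) = RC (Re (expect (Om L) (Tm L))).
  by apply: expect_selfadj; case: (HiiTm L hL).
set t := Re _ in sT.
have distE m : Cnorm (Csub (expect (Om L) (Tm L)) (RC (IZR m))) = Rabs (t - IZR m).
  rewrite sT -Cnorm_RC; congr Cnorm; apply: CplxP => /=; ring.
have [L0 Le] := hL.
pose z := INR L.
have z1 : 1 <= z by apply: (le_INR 1); apply/leP.
have zp j : 0 < z ^ j by apply: pow_lt; lra.
have zV j : 0 < / z ^ j by apply: Rinv_0_lt_compat.
have zd : INR (L ^ d) = z ^ d by rewrite pow_INR.
have absle (x y : R) j : x <= y * / z ^ j -> x <= Rabs y * / z ^ j.
  move=> hx; apply: Rle_trans hx _; apply: Rmult_le_compat_r; first exact/Rlt_le/zV.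
  exact: Rle_abs.
have absle' (x y : R) : x <= y * INR (L ^ d) -> x <= Rabs y * z ^ d.
  rewrite zd => hx; apply: Rle_trans hx _; apply: Rmult_le_compat_r; first exact/Rlt_le/zp.
  exact: Rle_abs.
have ctk : 0 <= Rabs CT * 64 ^ d * 64 ^ k.
  by apply: Rmult_le_pos; [apply: Rmult_le_pos; [exact: Rabs_pos|] |]; apply: pow_le; lra.
have bk : 0 <= 500 * (1 + Ac + E) * (E + sqrt E).
  by apply: Rmult_le_pos; [lra | have := sqrt_pos E; lra].
case: (leqP 64 L) => L64; last first.
  have z64 : z <= 64.
    have -> : 64 = INR 64 by rewrite INR_IZR_INZ.
    by apply/le_INR/leP/ltnW.
  exists 0%Z; rewrite distE Rminus_0_r.
  apply: (Rle_trans _ (Rabs CT * 64 ^ d)).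
    apply: Rle_trans (Re_le_Cnorm _) _; apply: Rle_trans (expect_le_opnorm _ _) _.
      by rewrite (HOm L hL); lra.
    apply: Rle_trans (absle' _ _ (proj1 (hCT L hL))) _.
    apply: Rmult_le_compat_l; first exact: Rabs_pos.
    apply: pow_incr; split; first lra.
    exact: z64.
  apply: (Rle_trans _ (Rabs CT * 64 ^ d * 64 ^ k * / z ^ k)); last first.
    by apply: Rmult_le_compat_r; [exact/Rlt_le/zV | lra].
  have zk : z ^ k <= 64 ^ k.
    apply: pow_incr; split; first lra.
    exact: z64.
  have one : 1 <= 64 ^ k * / z ^ k.
    apply: (Rmult_le_reg_r (z ^ k)) => //; rewrite Rmult_1_l Rmult_assoc Rinv_l; first lra.
    by have := zp k; lra.
  rewrite (Rmult_assoc (Rabs CT * 64 ^ d)) -{1}(Rmult_1_r (Rabs CT * 64 ^ d)).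
  apply: Rmult_le_compat_l one; apply: Rmult_le_pos; first exact: Rabs_pos.
  by apply: pow_le; lra.
pose e := E * / z ^ K.
have e0 : 0 <= e by apply: Rmult_le_pos => //; exact/Rlt_le/zV.
have piece x : x <= E -> x * / z ^ K <= e.
  by move=> hx; apply: Rmult_le_compat_r => //; exact/Rlt_le/zV.
have z2K : z ^ (2 * K)%N = z ^ K * z ^ K by rewrite -pow_add; congr pow; lia.
have zK2 : z ^ K2 = z ^ K * (z ^ d * z ^ d) by rewrite -!pow_add; congr pow; lia.
have var_le (A : op (basis sys d n L)) C : 0 <= C -> Var (Om L) A <= C * / z ^ (2 * K)%N ->
    nrm (Om L) (A - cst (expect (Om L) A))%ring <= sqrt C * / z ^ K.
  move=> C0' hA; apply: Rle_of_sqr_le.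
    by apply: Rmult_le_pos; [exact: sqrt_pos | exact/Rlt_le/zV].
  have -> : sqrt C * / z ^ K * (sqrt C * / z ^ K) = (sqrt C * sqrt C) * / z ^ (2 * K)%N.
    by rewrite z2K; field; have := zp K; lra.
  by rewrite sqrt_sqrt //; apply: Rle_trans hA; rewrite /Var /= Rmult_1_r; right.
pose a := Ac * z ^ d.
pose D := Dc * / (z ^ K * z ^ d).
pose F := Fc * / z ^ K.
have D0 : 0 < D by apply: Rmult_lt_0_compat => //; apply/Rinv_0_lt_compat/Rmult_lt_0_compat.
have F0 : 0 <= F by apply: Rmult_le_pos => //; exact/Rlt_le/zV.
have [lTm sTm] := HiiTm L hL; have [lTp sTp] := HiiTp L hL.
have [lKm [sKm [lKp sKp]]] := HivK L hL.
have [nTm nTp] := hCT L hL; have [nKm nKp] := hCK L hL.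
have aT : Rabs CT * z ^ d <= a.
  apply: Rmult_le_compat_r; first exact/Rlt_le/zp.
  by rewrite /Ac; have := Rabs_pos CK; lra.
have aK : Rabs CK * z ^ d <= a.
  apply: Rmult_le_compat_r; first exact/Rlt_le/zp.
  by rewrite /Ac; have := Rabs_pos CT; lra.
have key : Cnorm (cis (2 * PI * t) - 1)%ring <= 500 * (1 + (a + e)) * (e + sqrt e).
  apply: (@strip_estimate sys d n L L64 Le (Qc L) (U L) (Om L) (Tm L) (Tp L) (Km L) (Kp L)
    (HQ L hL) (HU L hL) (HOm L hL) lTm sTm lTp sTp lKm sKm lKp sKp a e D F) => //.
  - apply: Rle_trans (absle _ _ _ (h1 L hL)) (piece _ _).
    by rewrite /E; lra.
  - apply: Rle_trans (var_le _ _ (Rabs_pos C2) (absle _ _ _ (h2 L hL))) (piece _ _).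
    by rewrite /E; lra.
  - apply: Rle_trans (var_le _ _ (Rabs_pos C3) (absle _ _ _ (h3 L hL))) (piece _ _).
    by rewrite /E; lra.
  - apply: Rle_trans (absle _ _ _ (h4 L hL)) (piece _ _).
    by rewrite /E; lra.
  - exact: Rle_trans (absle' _ _ nTm) aT.
  - exact: Rle_trans (absle' _ _ nTp) aT.
  - exact: Rle_trans (absle' _ _ nKm) aK.
  - exact: Rle_trans (absle' _ _ nKp) aK.
  - move=> X A lA; have r0 : (0 < L %/ 32)%N by lia.
    have [R [lR hR]] := hi L hL X A lA _ r0; exists R; split=> //.
    apply: Rle_trans hR _.
    have hr : z / 64 <= INR (L %/ 32).
      have : INR L <= INR (64 * (L %/ 32)%N)%N by apply/le_INR/leP; lia.
      have e64 : INR 64 = 64 by rewrite INR_IZR_INZ.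
      by rewrite mult_INR -/z e64; lra.
    have hp : / INR (L %/ 32) ^ K2 <= 64 ^ K2 * / z ^ K2.
      have q0 : 0 < (z / 64) ^ K2 by apply: pow_lt; lra.
      have hq : (z / 64) ^ K2 <= INR (L %/ 32) ^ K2 by apply: pow_incr; lra.
      apply: Rle_trans (Rinv_le_contravar _ _ q0 hq) _; right.
      rewrite /Rdiv Rpow_mult_distr pow_inv.
      have : 0 < 64 ^ K2 by apply: pow_lt; lra.
      by move=> q1; field; have := zp K2; lra.
    have nA := opnorm_ge0 A; have q1 : 0 <= 64 ^ K2 by apply: pow_le; lra.
    have b1 : Ci * opnorm A * INR #|X| <= Rabs Ci * opnorm A * z ^ d.
      apply: (Rle_trans _ (Rabs Ci * opnorm A * INR #|X|)).
        apply: Rmult_le_compat_r; first exact: pos_INR.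
        by apply: Rmult_le_compat_r => //; exact: Rle_abs.
      apply: Rmult_le_compat_l; first by apply: Rmult_le_pos => //; exact: Rabs_pos.
      exact: card_site_le.
    have b2 : 0 <= Rabs Ci * opnorm A * z ^ d.
      by apply: Rmult_le_pos; [apply: Rmult_le_pos => //; exact: Rabs_pos | exact/Rlt_le/zp].
    have rV : 0 <= / INR (L %/ 32) ^ K2.
      by apply/Rlt_le/Rinv_0_lt_compat/pow_lt; lra.
    apply: Rle_trans (Rmult_le_compat_r _ _ _ rV b1) _.
    apply: Rle_trans (Rmult_le_compat_l _ _ _ b2 hp) _.
    have -> : Rabs Ci * opnorm A * z ^ d * (64 ^ K2 * / z ^ K2)
       = (Rabs Ci * 64 ^ K2) * / (z ^ K * z ^ d) * opnorm A.
      by rewrite zK2; field; have := zp K; have := zp d; lra.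
    apply: Rmult_le_compat_r => //; apply: Rmult_le_compat_r; last by rewrite /Dc; lra.
    by apply/Rlt_le/Rinv_0_lt_compat/Rmult_lt_0_compat.
  - move=> A A' lA lA'; apply: Rle_trans (hv L hL _ _ A A' lA lA') _.
    have nA := opnorm_ge0 A; have nA' := opnorm_ge0 A'.
    have hx : exp (- c * INR (dist1 (Sm d L) (Sp d L))) <= C5 * / z ^ K2.
      apply: Rle_trans (h5 z _); last lra.
      have hd1 : z <= 4 * INR (dist1 (Sm d L) (Sp d L)).
        have -> : 4 = INR 4 by rewrite INR_IZR_INZ.
        by rewrite -mult_INR; apply/le_INR/leP; exact: dist1_Sm_Sp.
      have : - c * INR (dist1 (Sm d L) (Sp d L)) <= - (c / 4 * z) by nra.
      by case=> [/exp_increasing|->]; lra.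
    have b1 : Cc * opnorm A * opnorm A' * INR #|Sm d L| * INR #|Sp d L|
        <= Cc * opnorm A * opnorm A' * z ^ d * z ^ d.
      have q0 : 0 <= Cc * opnorm A * opnorm A' by apply: Rmult_le_pos => //; apply: Rmult_le_pos => //; lra.
      apply: Rmult_le_compat; try exact: pos_INR; try exact: card_site_le.
        by apply: Rmult_le_pos => //; exact: pos_INR.
      by apply: Rmult_le_compat_l => //; exact: card_site_le.
    have b2 : 0 <= Cc * opnorm A * opnorm A' * z ^ d * z ^ d.
      by have := zp d => q; apply: Rmult_le_pos; [apply: Rmult_le_pos; [apply: Rmult_le_pos; [apply: Rmult_le_pos|]|]|]; lra.
    apply: Rle_trans (Rmult_le_compat_r _ _ _ (Rlt_le _ _ (exp_pos _)) b1) _.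
    apply: Rle_trans (Rmult_le_compat_l _ _ _ b2 hx) _.
    by right; rewrite /F /Fc zK2; field; have := zp K; have := zp d; lra.
  - have -> : 6 * D * a = (6 * Dc * Ac) * / z ^ K.
      by rewrite /D /a; field; have := zp K; have := zp d; lra.
    by apply: piece; rewrite /E; lra.
  - have -> : 4 * F = (4 * Fc) * / z ^ K by rewrite /F; ring.
    by apply: piece; rewrite /E; lra.
have [m hm] := dist_Z_le_cis t; exists m; rewrite distE.
apply: Rle_trans hm _; apply: Rle_trans key _.
(* [e] equals [E y^2], so [e + sqrt e] is of order [y]; the factor [z ^ d] in [1 + (a + e)] then
   leaves exactly [/ z ^ k]. *)
pose y := / (z ^ k * z ^ d).
have zkd : 1 <= z ^ k * z ^ d by rewrite -pow_add; apply: pow_R1_Rle.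
have y0 : 0 < y by apply: Rinv_0_lt_compat; lra.
have y1 : y <= 1 by rewrite /y -Rinv_1; apply: Rinv_le_contravar; lra.
have zKE : / z ^ K = y * y.
  have -> : z ^ K = (z ^ k * z ^ d) * (z ^ k * z ^ d).
    by rewrite -!pow_add; congr pow; lia.
  by rewrite /y; field; have := zp k; have := zp d; lra.
have sE := sqrt_pos E.
have se : sqrt e = sqrt E * y.
  by rewrite /e zKE sqrt_mult_alt // sqrt_square //; lra.
have b1 : e + sqrt e <= (E + sqrt E) * y.
  have yy : y * y <= y by nra.
  by rewrite se /e zKE; nra.
have zd1 : 1 <= z ^ d by apply: pow_R1_Rle.
have b2 : 1 + (a + e) <= (1 + Ac + E) * z ^ d.
  have yy : y * y <= 1 by nra.
  have : e <= E by rewrite /e zKE; nra.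
  by rewrite /a; nra.
have b3 : 0 <= e + sqrt e by have := sqrt_pos e; lra.
have b4 : 0 <= 1 + (a + e) by rewrite /a; have := Rmult_le_pos _ _ Ac0 (Rlt_le _ _ (zp d)); lra.
apply: (Rle_trans _ (500 * ((1 + Ac + E) * z ^ d) * ((E + sqrt E) * y))).
  by apply: Rmult_le_compat => //; lra.
have -> : 500 * ((1 + Ac + E) * z ^ d) * ((E + sqrt E) * y) = 500 * (1 + Ac + E) * (E + sqrt E) * / z ^ k.
  by rewrite /y; field; have := zp k; have := zp d; lra.
by apply: Rmult_le_compat_r; [exact/Rlt_le/zV | lra].
Qed.
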